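(* Let $d\ge2$ be an integer, let $0<\alpha\le1$, let $0\le f\in C^\alpha(\mathbb{T})$, and suppose that the transfer operator $L:C(\mathbb{T})\to C(\mathbb{T})$, $(Lu)(t)=\frac1d\sum_{i=0}^{d-1} f\left(\frac{t+i}{d}\right)u\left(\frac{t+i}{d}\right)$, is a Krein operator. Let $R=\lim_{n\to\infty}\left(\max_{t\in\mathbb{T}}(L^n1)(t)\right)^{1/n}$, let $L_\alpha$ be the restriction of $L$ to $C^\alpha(\mathbb{T})$, and let $P$ be the spectral projection onto the eigenspace of $L_\alpha$ corresponding to the eigenvalue $R$. Then: (a) The sequence $R^{-n}L_\alpha^n$ converges to $P$ as $n\to\infty$ with respect to the operator norm on $C^\alpha(\mathbb{T})$. (b) The sequence $R^{-n}h_n$, where $h_n=L^n1$, converges in $C^\alpha(\mathbb{T})$ to an eigenfunction of $L_\alpha$ corresponding to the eigenvalue $R$.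
   Context: $\mathbb{T}=\mathbb{R}/\mathbb{Z}$ is identified with $[0,1]$ with $0$ and $1$ identified; functions on $\mathbb{T}$ are viewed as $1$-periodic functions on $\mathbb{R}$. $C(\mathbb{T})$ is the Banach space of continuous complex-valued functions on $\mathbb{T}$ with the maximum norm $\|\cdot\|_\infty$. $C^\alpha(\mathbb{T})$ is the Banach space of H\''older continuous functions $u:\mathbb{T}\to\mathbb{C}$ with norm $\|u\|_\alpha=\sup_{s\ne t}\frac{|u(s)-u(t)|}{|s-t|^\alpha}+\|u\|_\infty$; $L_\alpha:C^\alpha(\mathbb{T})\to C^\alpha(\mathbb{T})$, $L_\alpha u=Lu$, is a bounded linear operator. A function $w\in C(\mathbb{T})$ is a unit if $w(t)>0$ for all $t$. $L$ is a Krein operator if, for every $u\in C(\mathbb{T})$ with $u\ge0$ everywhere and $u(t_0)>0$ for at least one $t_0$, there is $n\in\mathbb{N}$ such that $L^nu$ is a unit. The limit $R$ exists and equals the spectral radius of $L$. Under the hypotheses, $R>0$ is an isolated point of the spectrum of $L_\alpha$ and an eigenvalue of $L_\alpha$ of algebraic multiplicity $1$; the spectral projection $P$ is the Riesz projection of $L_\alpha$ associated with the isolated spectral point $R$. *)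

(* Defs.v *)
From Stdlib Require Import Reals ZArith Lra Lia.
From Stdlib Require Import FunctionalExtensionality ProofIrrelevance ClassicalEpsilon.
From Coquelicot Require Import Coquelicot.
Open Scope R_scope.

(* Meaningful only when [E] is nonempty and bounded above. *)
Definition supR (E : R -> Prop) : R := real (Lub_Rbar E).

Lemma supR_ub (E : R -> Prop) (M x : R) :
  (forall y, E y -> y <= M) -> E x -> x <= supR E.
Proof.
intros HM Hx. unfold supR.
destruct (Lub_Rbar_correct E) as [Hub Hlub].
assert (H1 : Rbar_le (Lub_Rbar E) M).
{ apply Hlub. intros y Hy. exact (HM y Hy). }
specialize (Hub x Hx).
destruct (Lub_Rbar E); simpl in *; tauto.
Qed.

Lemma supR_le (E : R -> Prop) (M : R) :
  (exists x, E x) -> (forall y, E y -> y <= M) -> supR E <= M.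
Proof.
intros [x Hx] HM. unfold supR.
destruct (Lub_Rbar_correct E) as [Hub Hlub].
assert (H1 : Rbar_le (Lub_Rbar E) M).
{ apply Hlub. intros y Hy. exact (HM y Hy). }
specialize (Hub x Hx).
destruct (Lub_Rbar E); simpl in *; tauto.
Qed.

Record normed_data (K : AbsRing) (T : Type) := {
  nd_plus : T -> T -> T;
  nd_zero : T;
  nd_opp : T -> T;
  nd_scal : K -> T -> T;
  nd_norm : T -> R;
  nd_plusC : forall x y, nd_plus x y = nd_plus y x;
  nd_plusA : forall x y z, nd_plus x (nd_plus y z) = nd_plus (nd_plus x y) z;
  nd_plus0 : forall x, nd_plus x nd_zero = x;
  nd_plusN : forall x, nd_plus x (nd_opp x) = nd_zero;
  nd_scalA : forall a b x, nd_scal a (nd_scal b x) = nd_scal (mult a b) x;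
  nd_scal1 : forall x, nd_scal one x = x;
  nd_scalDr : forall a x y,
    nd_scal a (nd_plus x y) = nd_plus (nd_scal a x) (nd_scal a y);
  nd_scalDl : forall a b x,
    nd_scal (plus a b) x = nd_plus (nd_scal a x) (nd_scal b x);
  nd_norm0 : nd_norm nd_zero = 0;
  nd_normN : forall x, nd_norm (nd_opp x) = nd_norm x;
  nd_normD : forall x y, nd_norm (nd_plus x y) <= nd_norm x + nd_norm y;
  nd_normZ : forall a x, nd_norm (nd_scal a x) <= abs a * nd_norm x;
  nd_norm_eq0 : forall x, nd_norm x = 0 -> x = nd_zero
}.

Definition nd_AbelianMonoid (K : AbsRing) (T : Type) (D : normed_data K T) :
  AbelianMonoid.mixin_of T :=
  AbelianMonoid.Mixin T (nd_plus K T D) (nd_zero K T D)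
    (nd_plusC K T D) (nd_plusA K T D) (nd_plus0 K T D).

Definition nd_AbelianGroup (K : AbsRing) (T : Type) (D : normed_data K T) :
  AbelianGroup.class_of T :=
  AbelianGroup.Class T (nd_AbelianMonoid K T D)
    (AbelianGroup.Mixin (AbelianMonoid.Pack T (nd_AbelianMonoid K T D) T)
       (nd_opp K T D) (nd_plusN K T D)).

Definition nd_ModuleSpace (K : AbsRing) (T : Type) (D : normed_data K T) :
  ModuleSpace.class_of K T :=
  ModuleSpace.Class K T (nd_AbelianGroup K T D)
    (ModuleSpace.Mixin K (AbelianGroup.Pack T (nd_AbelianGroup K T D) T)
       (nd_scal K T D) (nd_scalA K T D) (nd_scal1 K T D)
       (nd_scalDr K T D) (nd_scalDl K T D)).

Definition nd_ball (K : AbsRing) (T : Type) (D : normed_data K T)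
  (x : T) (e : R) (y : T) : Prop :=
  nd_norm K T D (nd_plus K T D y (nd_opp K T D x)) < e.

Lemma nd_ball_refl (K : AbsRing) (T : Type) (D : normed_data K T)
  (x : T) (e : posreal) : nd_ball K T D x e x.
Proof.
unfold nd_ball. rewrite nd_plusN, nd_norm0. apply cond_pos.
Qed.

Lemma nd_ball_sym (K : AbsRing) (T : Type) (D : normed_data K T)
  (x y : T) (e : R) : nd_ball K T D x e y -> nd_ball K T D y e x.
Proof.
unfold nd_ball. intros H. rewrite <- nd_normN in H.
set (G := AbelianGroup.Pack T (nd_AbelianGroup K T D) T).
change (nd_norm K T D (opp (minus (y : G) (x : G))) < e) in H.
rewrite opp_minus in H. exact H.
Qed.

Lemma nd_ball_triangle (K : AbsRing) (T : Type) (D : normed_data K T)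
  (x y z : T) (e1 e2 : R) :
  nd_ball K T D x e1 y -> nd_ball K T D y e2 z -> nd_ball K T D x (e1 + e2) z.
Proof.
unfold nd_ball. intros H1 H2.
set (G := AbelianGroup.Pack T (nd_AbelianGroup K T D) T).
change (nd_norm K T D (minus (z : G) (x : G)) < e1 + e2).
rewrite (minus_trans (y : G)).
eapply Rle_lt_trans.
- exact (nd_normD K T D (minus (z : G) y) (minus (y : G) x)).
- unfold minus, plus, opp; simpl. lra.
Qed.

Definition nd_UniformSpace (K : AbsRing) (T : Type) (D : normed_data K T) :
  UniformSpace.mixin_of T :=
  UniformSpace.Mixin T (nd_zero K T D) (nd_ball K T D)
    (nd_ball_refl K T D) (nd_ball_sym K T D) (nd_ball_triangle K T D).

Definition nd_Aux (K : AbsRing) (T : Type) (D : normed_data K T) :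
  NormedModuleAux.class_of K T :=
  NormedModuleAux.Class K T (nd_ModuleSpace K T D) (nd_UniformSpace K T D).

Lemma nd_ax3 (K : AbsRing) (T : Type) (D : normed_data K T) :
  let V := NormedModuleAux.Pack K T (nd_Aux K T D) T in
  forall (x y : V) (eps : R),
    nd_norm K T D (minus y x) < eps -> ball x eps y.
Proof. intros V x y eps H. exact H. Qed.

Lemma nd_ax4 (K : AbsRing) (T : Type) (D : normed_data K T) :
  let V := NormedModuleAux.Pack K T (nd_Aux K T D) T in
  forall (x y : V) (eps : posreal),
    ball x eps y -> nd_norm K T D (minus y x) < 1 * eps.
Proof. intros V x y eps H. rewrite Rmult_1_l. exact H. Qed.

Definition NormedModule_of (K : AbsRing) (T : Type) (D : normed_data K T) :
  NormedModule K :=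
  NormedModule.Pack K T
    (NormedModule.Class K T (nd_Aux K T D)
       (NormedModule.Mixin K (NormedModuleAux.Pack K T (nd_Aux K T D) T)
          (nd_norm K T D) 1 (nd_normD K T D) (nd_normZ K T D)
          (nd_ax3 K T D) (nd_ax4 K T D) (nd_norm_eq0 K T D))) T.

Definition Rscal (V : NormedModule C_AbsRing) (a : R) (v : V) : V :=
  scal (RtoC a : C_AbsRing) v.

Lemma Rscal_assoc (V : NormedModule C_AbsRing) (a b : R) (v : V) :
  Rscal V a (Rscal V b v) = Rscal V (mult a b) v.
Proof.
unfold Rscal. rewrite scal_assoc. apply (f_equal (fun z => scal z v)).
unfold mult; simpl. symmetry. apply RtoC_mult.
Qed.

Lemma Rscal_distr_r (V : NormedModule C_AbsRing) (a b : R) (v : V) :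
  Rscal V (plus a b) v = plus (Rscal V a v) (Rscal V b v).
Proof.
unfold Rscal.
transitivity (scal (plus (RtoC a : C_AbsRing) (RtoC b : C_AbsRing)) v).
- apply (f_equal (fun z => scal z v)). apply RtoC_plus.
- exact (scal_distr_r (RtoC a : C_AbsRing) (RtoC b : C_AbsRing) v).
Qed.

Lemma Rscal_norm (V : NormedModule C_AbsRing) (a : R) (v : V) :
  norm (Rscal V a v) <= Rabs a * norm v.
Proof.
unfold Rscal. eapply Rle_trans. apply norm_scal.
unfold abs; simpl. rewrite Cmod_R. apply Rle_refl.
Qed.

Definition restrict_Module (V : NormedModule C_AbsRing) :
  ModuleSpace.class_of R_AbsRing V :=
  ModuleSpace.Class R_AbsRing V (AbelianGroup.class V)
    (ModuleSpace.Mixin R_AbsRing (AbelianGroup.Pack V (AbelianGroup.class V) V)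
       (Rscal V) (Rscal_assoc V) (fun v : V => scal_one v)
       (fun a (u v : V) => scal_distr_l (RtoC a : C_AbsRing) u v)
       (Rscal_distr_r V)).

Definition restrict_Aux (V : NormedModule C_AbsRing) :
  NormedModuleAux.class_of R_AbsRing V :=
  NormedModuleAux.Class R_AbsRing V (restrict_Module V) (UniformSpace.class V).

(* The vector space, norm and topology of [V], with real scalars: [is_RInt]
   only integrates functions with values in a real normed module. *)
Definition restrict_scalars (V : NormedModule C_AbsRing) :
  NormedModule R_AbsRing :=
  NormedModule.Pack R_AbsRing V
    (NormedModule.Class R_AbsRing V (restrict_Aux V)
       (NormedModule.Mixin R_AbsRing
          (NormedModuleAux.Pack R_AbsRing V (restrict_Aux V) V)
          norm norm_factor norm_triangle (Rscal_norm V)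
          norm_compat1 norm_compat2 norm_eq_zero)) V.

Record bounded_op (E : NormedModule C_AbsRing) := {
  bop_fun :> E -> E;
  bop_linear : is_linear bop_fun
}.

Lemma bop_ext (E : NormedModule C_AbsRing) (S T : bounded_op E) :
  (forall u, S u = T u) -> S = T.
Proof.
destruct S as [S HS], T as [T HT]; simpl; intros H.
assert (H' : S = T) by (apply functional_extensionality; exact H).
subst T. f_equal. apply proof_irrelevance.
Qed.

Definition bop_id (E : NormedModule C_AbsRing) : bounded_op E :=
  Build_bounded_op E (fun u => u) is_linear_id.

Definition bop_comp (E : NormedModule C_AbsRing) (S T : bounded_op E) : bounded_op E :=
  Build_bounded_op E (fun u => S (T u))
    (is_linear_comp T S (bop_linear E T) (bop_linear E S)).

Definition bop_zero (E : NormedModule C_AbsRing) : bounded_op E :=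
  Build_bounded_op E (fun _ => zero) is_linear_zero.

Definition bop_plus (E : NormedModule C_AbsRing) (S T : bounded_op E) : bounded_op E :=
  Build_bounded_op E (fun u => plus (S u) (T u))
    (is_linear_comp (fun u => (S u, T u)) (fun p : E * E => plus (fst p) (snd p))
       (is_linear_prod S T (bop_linear E S) (bop_linear E T)) is_linear_plus).

Definition bop_opp (E : NormedModule C_AbsRing) (T : bounded_op E) : bounded_op E :=
  Build_bounded_op E (fun u => opp (T u))
    (is_linear_comp T opp (bop_linear E T) is_linear_opp).

Definition bop_scal (E : NormedModule C_AbsRing) (a : C) (T : bounded_op E) : bounded_op E :=
  Build_bounded_op E (fun u => scal (a : C_AbsRing) (T u))
    (is_linear_comp T (fun u : E => scal (a : C_AbsRing) u) (bop_linear E T)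
       (is_linear_scal_r (a : C_AbsRing) Cmult_comm)).

Definition opnorm (E : NormedModule C_AbsRing) (T : bounded_op E) : R :=
  supR (fun x => exists u : E, norm u <= 1 /\ x = norm (T u)).

Lemma opnorm_ub1 (E : NormedModule C_AbsRing) (T : bounded_op E) (u : E) :
  norm u <= 1 -> norm (T u) <= opnorm E T.
Proof.
intros Hu. destruct (linear_norm _ (bop_linear E T)) as [M [HM H]].
apply (supR_ub _ M); [| now exists u].
intros y [v [Hv ->]]. eapply Rle_trans. apply H.
rewrite <- (Rmult_1_r M) at 2. apply Rmult_le_compat_l; lra.
Qed.

Lemma opnorm_le (E : NormedModule C_AbsRing) (T : bounded_op E) (M : R) :
  (forall u, norm u <= 1 -> norm (T u) <= M) -> opnorm E T <= M.
Proof.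
intros H. apply supR_le.
- exists (norm (T zero)), zero. split; [rewrite norm_zero; lra | reflexivity].
- intros y [v [Hv ->]]. now apply H.
Qed.

Lemma opnorm_ge0 (E : NormedModule C_AbsRing) (T : bounded_op E) : 0 <= opnorm E T.
Proof.
apply Rle_trans with (norm (T zero)). apply norm_ge_0.
apply opnorm_ub1. rewrite norm_zero; lra.
Qed.

Lemma opnorm_ub (E : NormedModule C_AbsRing) (T : bounded_op E) (u : E) :
  norm (T u) <= opnorm E T * norm u.
Proof.
destruct (Req_dec (norm u) 0) as [H0|H0].
- rewrite (norm_eq_zero _ H0), (linear_zero _ (bop_linear E T)), !norm_zero. lra.
- assert (Hp : 0 < norm u) by (pose proof (norm_ge_0 u); lra).
  set (a := RtoC (/ norm u) : C_AbsRing).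
  set (b := RtoC (norm u) : C_AbsRing).
  assert (Hi : 0 < / norm u) by now apply Rinv_0_lt_compat.
  assert (Ha : abs a = / norm u).
  { unfold abs; simpl. unfold a. rewrite Cmod_R. apply Rabs_pos_eq; lra. }
  assert (Hb : abs b = norm u).
  { unfold abs; simpl. unfold b. rewrite Cmod_R. apply Rabs_pos_eq; lra. }
  assert (Hba : mult b a = one).
  { unfold mult, one; simpl. unfold a, b. rewrite <- RtoC_mult.
    apply f_equal. field. exact H0. }
  replace (T u) with (scal b (T (scal a u))).
  2:{ rewrite (linear_scal _ (bop_linear E T)), scal_assoc, Hba.
      exact (scal_one (T u)). }
  eapply Rle_trans. apply norm_scal. rewrite Hb, Rmult_comm.
  apply Rmult_le_compat_r; [lra|]. apply opnorm_ub1.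
  eapply Rle_trans. apply norm_scal. rewrite Ha, Rinv_l; lra.
Qed.

Definition bop_data (E : NormedModule C_AbsRing) : normed_data C_AbsRing (bounded_op E).
Proof.
refine (Build_normed_data C_AbsRing (bounded_op E) (bop_plus E) (bop_zero E)
          (bop_opp E) (bop_scal E) (opnorm E) _ _ _ _ _ _ _ _ _ _ _ _ _).
- intros S T; apply bop_ext; intros u; exact (plus_comm (S u) (T u)).
- intros S T U; apply bop_ext; intros u; exact (plus_assoc (S u) (T u) (U u)).
- intros S; apply bop_ext; intros u; exact (plus_zero_r (S u)).
- intros S; apply bop_ext; intros u; exact (plus_opp_r (S u)).
- intros a b S; apply bop_ext; intros u; exact (scal_assoc a b (S u)).
- intros S; apply bop_ext; intros u; exact (scal_one (S u)).
- intros a S T; apply bop_ext; intros u; exact (scal_distr_l a (S u) (T u)).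
- intros a b S; apply bop_ext; intros u; exact (scal_distr_r a b (S u)).
- apply Rle_antisym; [| apply opnorm_ge0].
  apply opnorm_le; intros u _; simpl; rewrite norm_zero; lra.
- intros S; apply Rle_antisym; apply opnorm_le; intros u Hu; simpl.
  + rewrite norm_opp. now apply opnorm_ub1.
  + rewrite <- (norm_opp (S u)). exact (opnorm_ub1 E (bop_opp E S) u Hu).
- intros S T; apply opnorm_le; intros u Hu; simpl.
  eapply Rle_trans. apply norm_triangle.
  apply Rplus_le_compat; now apply opnorm_ub1.
- intros a S; apply opnorm_le; intros u Hu; simpl.
  eapply Rle_trans. apply norm_scal.
  apply Rmult_le_compat_l; [apply abs_ge_0 | now apply opnorm_ub1].
- intros S H; apply bop_ext; intros u; simpl. apply norm_eq_zero.
  apply Rle_antisym; [| apply norm_ge_0].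
  rewrite <- (Rmult_0_l (norm u)), <- H. apply opnorm_ub.
Defined.

Definition BL (E : NormedModule C_AbsRing) : NormedModule C_AbsRing :=
  NormedModule_of C_AbsRing (bounded_op E) (bop_data E).

Definition bop_pow (E : NormedModule C_AbsRing) (T : bounded_op E) (n : nat) : bounded_op E :=
  Nat.iter n (bop_comp E T) (bop_id E).

Definition is_inverse (E : NormedModule C_AbsRing) (S T : bounded_op E) : Prop :=
  bop_comp E S T = bop_id E /\ bop_comp E T S = bop_id E.

Definition shifted (E : NormedModule C_AbsRing) (T : bounded_op E) (z : C) : bounded_op E :=
  minus (scal (z : C_AbsRing) (bop_id E : BL E)) (T : BL E).

Definition resolvent_set (E : NormedModule C_AbsRing) (T : bounded_op E) (z : C) : Prop :=
  exists S : bounded_op E, is_inverse E S (shifted E T z).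

Definition spectrum (E : NormedModule C_AbsRing) (T : bounded_op E) (z : C) : Prop :=
  ~ resolvent_set E T z.

(* [(z - T)^-1] when [z] is in the resolvent set, arbitrary otherwise. *)
Definition resolvent (E : NormedModule C_AbsRing) (T : bounded_op E) (z : C) : bounded_op E :=
  epsilon (inhabits (bop_zero E)) (fun S => is_inverse E S (shifted E T z)).

Definition Cexpi (theta : R) : C := (cos theta, sin theta).

Definition isolating_radius (E : NormedModule C_AbsRing) (T : bounded_op E)
  (z0 : C) (r : R) : Prop :=
  0 < r /\
  forall z : C, 0 < Cmod (z - z0)%C <= r -> resolvent_set E T z.

(* [P = 1/(2 pi i) \oint_{|z - z0| = r} (z - T)^-1 dz], parametrised by
   [z = z0 + r e^{i theta}], [dz = i r e^{i theta} d theta]; the integral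
   converges in operator norm. *)
Definition is_circle_integral (E : NormedModule C_AbsRing) (T : bounded_op E)
  (z0 : C) (r : R) (P : bounded_op E) : Prop :=
  is_RInt (V := restrict_scalars (BL E))
    (fun theta =>
       scal ((/ (2 * PI * Ci) * (Ci * r * Cexpi theta))%C : C_AbsRing)
            (resolvent E T (z0 + r * Cexpi theta)%C : BL E))
    0 (2 * PI) P.

(* [z0] is an isolated point of the spectrum and [P] is the contour integral
   over every circle around [z0] that separates it from the rest of the
   spectrum (by Cauchy's theorem they all agree). *)
Definition is_riesz_projection (E : NormedModule C_AbsRing) (T : bounded_op E)
  (z0 : C) (P : bounded_op E) : Prop :=
  spectrum E T z0 /\
  (exists r, isolating_radius E T z0 r) /\
  (forall r, isolating_radius E T z0 r -> is_circle_integral E T z0 r P).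

Lemma is_riesz_projection_unique (E : NormedModule C_AbsRing) (T : bounded_op E)
  (z0 : C) (P Q : bounded_op E) :
  is_riesz_projection E T z0 P -> is_riesz_projection E T z0 Q -> P = Q.
Proof.
intros [_ [[r Hr] HP]] [_ [_ HQ]].
exact (filterlim_locally_unique (V := restrict_scalars (BL E)) _ _ _
         (HP r Hr) (HQ r Hr)).
Qed.

Definition in_eigenspace (E : NormedModule C_AbsRing) (T : bounded_op E)
  (z : C) (u : E) : Prop :=
  T u = scal (z : C_AbsRing) u.

Definition eigenvector (E : NormedModule C_AbsRing) (T : bounded_op E)
  (z : C) (u : E) : Prop :=
  u <> zero /\ in_eigenspace E T z u.

(* The Riesz projection, when it is a projection onto the eigenspace of an
   eigenvalue. *)
Definition is_spectral_projection (E : NormedModule C_AbsRing) (T : bounded_op E)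
  (z0 : C) (P : bounded_op E) : Prop :=
  is_riesz_projection E T z0 P /\
  (exists v, eigenvector E T z0 v) /\
  (forall u, in_eigenspace E T z0 u <-> exists v, u = P v).

Record CT := {
  ct_fun :> R -> C;
  ct_periodic : forall t, ct_fun (t + 1) = ct_fun t;
  ct_continuous : forall t, continuous ct_fun t
}.

Lemma CT_ext (u v : CT) : (forall t, u t = v t) -> u = v.
Proof.
destruct u as [u Hu Cu], v as [v Hv Cv]; simpl; intros H.
assert (H' : u = v) by (apply functional_extensionality; exact H).
subst v. f_equal; apply proof_irrelevance.
Qed.

Lemma CT_periodic_nat (u : CT) (n : nat) (t : R) : u (t + INR n) = u t.
Proof.
induction n as [|n IH].
- simpl. now rewrite Rplus_0_r.
- rewrite S_INR, <- Rplus_assoc, ct_periodic. exact IH.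
Qed.

Lemma CT_periodic_Z (u : CT) (n : Z) (t : R) : u (t + IZR n) = u t.
Proof.
destruct (Z.le_gt_cases 0 n) as [H|H].
- rewrite <- (Z2Nat.id n H), <- INR_IZR_INZ. apply CT_periodic_nat.
- rewrite <- (CT_periodic_nat u (Z.to_nat (- n)) (t + IZR n)).
  f_equal. rewrite INR_IZR_INZ, Z2Nat.id by lia. rewrite opp_IZR. ring.
Qed.

Lemma CT_bounded (u : CT) : exists M, forall t, Cmod (u t) <= M.
Proof.
assert (Hc : forall t, continuity_pt (fun x => Cmod (u x)) t).
{ intros t. apply continuity_pt_filterlim.
  apply (continuous_comp u Cmod). apply ct_continuous.
  apply (filterlim_norm (K := C_AbsRing) (V := C_NormedModule) (u t)). }
destruct (continuity_ab_maj (fun x => Cmod (u x)) 0 1) as [m [Hm _]];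
  [lra | intros; apply Hc |].
exists (Cmod (u m)). intros t.
replace (u t) with (u (t + IZR (- Int_part t))) by apply CT_periodic_Z.
rewrite opp_IZR.
destruct (base_Int_part t) as [H1 H2].
apply (Hm (t + - IZR (Int_part t))). lra.
Qed.

Definition sup_norm (u : CT) : R := supR (fun x => exists t, x = Cmod (u t)).

Lemma sup_norm_ub (u : CT) (t : R) : Cmod (u t) <= sup_norm u.
Proof.
destruct (CT_bounded u) as [M HM].
apply (supR_ub _ M); [| now exists t]. intros y [s ->]. apply HM.
Qed.

Lemma sup_norm_le (u : CT) (M : R) :
  (forall t, Cmod (u t) <= M) -> sup_norm u <= M.
Proof.
intros H. apply supR_le. now exists (Cmod (u 0)), 0. intros y [s ->]. apply H.
Qed.

Definition CT_const (c : C) : CT :=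
  Build_CT (fun _ => c) (fun _ => eq_refl) (fun t => continuous_const c t).

Definition Cnonneg (z : C) : Prop := 0 <= Re z /\ Im z = 0.
Definition Cpos (z : C) : Prop := 0 < Re z /\ Im z = 0.

Definition is_unit (w : CT) : Prop := forall t, Cpos (w t).

Definition krein (T : CT -> CT) : Prop :=
  forall u : CT,
    (forall t, Cnonneg (u t)) -> (exists t0, Cpos (u t0)) ->
    exists n : nat, is_unit (Nat.iter n T u).

Definition transfer_fun (d : nat) (f u : R -> C) (t : R) : C :=
  (RtoC (/ INR d) *
   sum_n (fun i => f ((t + INR i) / INR d)%R * u ((t + INR i) / INR d)%R) (d - 1))%C.

Lemma transfer_fun0 (f u : R -> C) (t : R) : transfer_fun 0 f u t = 0.
Proof. unfold transfer_fun. simpl INR. rewrite Rinv_0. apply Cmult_0_l. Qed.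

Lemma sum_n_shift (G : AbelianMonoid) (a : nat -> G) (n : nat) :
  a (S n) = a O -> sum_n (fun i => a (S i)) n = sum_n a n.
Proof.
intros H.
destruct n as [|n].
- rewrite !sum_O. exact H.
- unfold sum_n. rewrite (sum_n_m_S a 0 (S n)).
  rewrite (sum_n_Sm a 1 (S n)) by lia. rewrite (sum_Sn_m a 0 (S n)) by lia.
  rewrite H. apply plus_comm.
Qed.

Lemma transfer_periodic (d : nat) (f u : CT) (t : R) :
  transfer_fun d f u (t + 1) = transfer_fun d f u t.
Proof.
destruct d as [|k]; [now rewrite !transfer_fun0|].
unfold transfer_fun. f_equal.
replace (S k - 1)%nat with k by lia.
set (a := fun i : nat => (f ((t + INR i) / INR (S k))%R * u ((t + INR i) / INR (S k))%R)%C).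
rewrite <- (sum_n_shift C_AbelianMonoid a k).
- apply sum_n_ext. intros i. unfold a.
  replace ((t + 1 + INR i) / INR (S k)) with ((t + INR (S i)) / INR (S k)).
  reflexivity. rewrite (S_INR i). f_equal. ring.
- unfold a.
  replace ((t + INR (S k)) / INR (S k)) with ((t + INR 0) / INR (S k) + 1).
  now rewrite !ct_periodic.
  simpl (INR 0). field. apply not_0_INR. lia.
Qed.

Lemma continuous_Cmult (g h : R -> C) (t : R) :
  continuous g t -> continuous h t -> continuous (fun s => g s * h s)%C t.
Proof.
intros Hg Hh.
assert (Hg1 : continuous (fun s => fst (g s)) t)
  by (apply (continuous_comp g fst); [exact Hg | apply continuous_fst]).
assert (Hg2 : continuous (fun s => snd (g s)) t)
  by (apply (continuous_comp g snd); [exact Hg | apply continuous_snd]).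
assert (Hh1 : continuous (fun s => fst (h s)) t)
  by (apply (continuous_comp h fst); [exact Hh | apply continuous_fst]).
assert (Hh2 : continuous (fun s => snd (h s)) t)
  by (apply (continuous_comp h snd); [exact Hh | apply continuous_snd]).
apply (continuous_comp_2
  (fun s => fst (g s) * fst (h s) - snd (g s) * snd (h s))
  (fun s => fst (g s) * snd (h s) + snd (g s) * fst (h s))
  (fun x y => (x, y)) t).
- apply (continuous_minus (fun s => fst (g s) * fst (h s))).
  + apply (continuous_mult (fun s => fst (g s)) (fun s => fst (h s)) t Hg1 Hh1).
  + apply (continuous_mult (fun s => snd (g s)) (fun s => snd (h s)) t Hg2 Hh2).
- apply (continuous_plus (fun s => fst (g s) * snd (h s))).
  + apply (continuous_mult (fun s => fst (g s)) (fun s => snd (h s)) t Hg1 Hh2).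
  + apply (continuous_mult (fun s => snd (g s)) (fun s => fst (h s)) t Hg2 Hh1).
- apply continuous_ext with (fun p => p); [now intros [x y] | apply continuous_id].
Qed.

Lemma transfer_continuous (d : nat) (f u : CT) (t : R) :
  continuous (transfer_fun d f u) t.
Proof.
assert (Ha : forall i,
  continuous (fun s => (s + INR i) / INR d) t).
{ intros i. apply (continuous_scal_l (fun s => s + INR i) (/ INR d) t).
  apply (continuous_plus (fun s : R => s) (fun _ => INR i) t).
  apply continuous_id. apply continuous_const. }
assert (Hi : forall (g : CT) i,
  continuous (fun s => g ((s + INR i) / INR d)) t).
{ intros g i. apply (continuous_comp (fun s => (s + INR i) / INR d) g).
  apply Ha. apply ct_continuous. }
unfold transfer_fun.
apply continuous_Cmult; [apply continuous_const|].
induction (d - 1)%nat as [|n IH].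
- apply continuous_ext with
    (fun s => (f ((s + INR 0) / INR d)%R * u ((s + INR 0) / INR d)%R)%C).
  { intros s. now rewrite sum_O. }
  apply (continuous_Cmult _ _ t (Hi f O) (Hi u O)).
- apply continuous_ext with
    (fun s => plus (sum_n (fun i => f ((s + INR i) / INR d)%R * u ((s + INR i) / INR d)%R)%C n)
                (f ((s + INR (S n)) / INR d)%R * u ((s + INR (S n)) / INR d)%R)%C).
  { intros s. now rewrite sum_Sn. }
  apply (continuous_plus (K := C_AbsRing) (V := C_NormedModule)); [exact IH|].
  apply (continuous_Cmult _ _ t (Hi f (S n)) (Hi u (S n))).
Qed.

Definition transfer (d : nat) (f u : CT) : CT :=
  Build_CT (transfer_fun d f u) (transfer_periodic d f u)
    (transfer_continuous d f u).

(* [Rpower 0 y = 1] in the standard library, hence the case distinction. *)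
Definition nth_root (n : nat) (x : R) : R :=
  if Rle_dec x 0 then 0 else Rpower x (/ INR n).

(* [max_t w(t)] for a real-valued [w]. *)
Definition max_CT (w : CT) : R := supR (fun x => exists t, x = Re (w t)).

Definition growth_rate (T : CT -> CT) : R :=
  real (Lim_seq (fun n => nth_root n (max_CT (Nat.iter n T (CT_const 1))))).

Record holder (alpha : R) := {
  holder_CT :> CT;
  holder_bound : exists M, forall s t, s <> t ->
    Cmod (holder_CT s - holder_CT t)%C <= M * Rpower (Rabs (s - t)) alpha
}.

Lemma holder_ext (alpha : R) (u v : holder alpha) : (forall t, u t = v t) -> u = v.
Proof.
destruct u as [u Hu], v as [v Hv]; simpl; intros H.
assert (H' : u = v) by (apply CT_ext; exact H).
subst v. f_equal; apply proof_irrelevance.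
Qed.

(* As [u] is 1-periodic on the real line, this is the seminorm for the
   distance of the circle [R/Z]. *)
Definition holder_seminorm (alpha : R) (u : holder alpha) : R :=
  supR (fun x => exists s t, s <> t /\
    x = Cmod (u s - u t)%C / Rpower (Rabs (s - t)) alpha).

Definition holder_norm (alpha : R) (u : holder alpha) : R :=
  holder_seminorm alpha u + sup_norm u.

Lemma Rpower_pos (x y : R) : 0 < Rpower x y.
Proof. apply exp_pos. Qed.

Lemma holder_seminorm_ub (alpha : R) (u : holder alpha) (s t : R) : s <> t ->
  Cmod (u s - u t)%C <= holder_seminorm alpha u * Rpower (Rabs (s - t)) alpha.
Proof.
intros Hst. destruct (holder_bound _ u) as [M HM].
pose proof (Rpower_pos (Rabs (s - t)) alpha) as Hp.
apply Rmult_le_reg_r with (/ Rpower (Rabs (s - t)) alpha).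
now apply Rinv_0_lt_compat.
rewrite Rmult_assoc, Rinv_r, Rmult_1_r by lra.
apply (supR_ub _ M).
- intros y [s' [t' [H ->]]].
  pose proof (Rpower_pos (Rabs (s' - t')) alpha) as Hp'.
  apply Rmult_le_reg_r with (Rpower (Rabs (s' - t')) alpha); [exact Hp'|].
  unfold Rdiv. rewrite Rmult_assoc, Rinv_l, Rmult_1_r by lra. now apply HM.
- now exists s, t.
Qed.

Lemma holder_seminorm_le (alpha : R) (u : holder alpha) (M : R) :
  (forall s t, s <> t ->
     Cmod (u s - u t)%C <= M * Rpower (Rabs (s - t)) alpha) ->
  holder_seminorm alpha u <= M.
Proof.
intros HM. apply supR_le.
- exists (Cmod (u 0 - u 1)%C / Rpower (Rabs (0 - 1)) alpha), 0, 1. split; [lra|reflexivity].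
- intros y [s' [t' [H ->]]].
  pose proof (Rpower_pos (Rabs (s' - t')) alpha) as Hp'.
  apply Rmult_le_reg_r with (Rpower (Rabs (s' - t')) alpha); [exact Hp'|].
  unfold Rdiv. rewrite Rmult_assoc, Rinv_l, Rmult_1_r by lra. now apply HM.
Qed.

Lemma holder_norm_le (alpha : R) (u : holder alpha) (A B : R) :
  (forall s t, s <> t ->
     Cmod (u s - u t)%C <= A * Rpower (Rabs (s - t)) alpha) ->
  (forall t, Cmod (u t) <= B) -> holder_norm alpha u <= A + B.
Proof.
intros HA HB. apply Rplus_le_compat.
now apply holder_seminorm_le. now apply sup_norm_le.
Qed.

Lemma sup_norm_ge0 (u : CT) : 0 <= sup_norm u.
Proof. eapply Rle_trans. apply Cmod_ge_0. apply (sup_norm_ub u 0). Qed.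

Lemma holder_seminorm_ge0 (alpha : R) (u : holder alpha) :
  0 <= holder_seminorm alpha u.
Proof.
assert (H : (0 <> 1)%R) by lra.
pose proof (holder_seminorm_ub alpha u 0 1 H) as H1.
pose proof (Cmod_ge_0 (u 0 - u 1)%C).
pose proof (Rpower_pos (Rabs (0 - 1)) alpha).
nra.
Qed.

Definition CT_plus (u v : CT) : CT :=
  Build_CT (fun t => u t + v t)%C
    (fun t => f_equal2 Cplus (ct_periodic u t) (ct_periodic v t))
    (fun t => continuous_plus (K := C_AbsRing) (V := C_NormedModule) u v t
                (ct_continuous u t) (ct_continuous v t)).

Definition CT_scal (c : C) (u : CT) : CT :=
  Build_CT (fun t => c * u t)%C
    (fun t => f_equal (Cmult c) (ct_periodic u t))
    (fun t => continuous_Cmult (fun _ => c) u t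
                (continuous_const c t) (ct_continuous u t)).

Lemma holder_const_bound (alpha : R) (c : C) :
  exists M, forall s t, s <> t ->
    Cmod (CT_const c s - CT_const c t)%C <= M * Rpower (Rabs (s - t)) alpha.
Proof.
exists 0. intros s t _. simpl.
replace (c - c)%C with (RtoC 0) by ring. rewrite Cmod_0. lra.
Qed.

Definition holder_const (alpha : R) (c : C) : holder alpha :=
  Build_holder alpha (CT_const c) (holder_const_bound alpha c).

Lemma holder_plus_est (alpha : R) (u v : holder alpha) (s t : R) : s <> t ->
  Cmod (CT_plus u v s - CT_plus u v t)%C <=
  (holder_seminorm alpha u + holder_seminorm alpha v) * Rpower (Rabs (s - t)) alpha.
Proof.
intros H. simpl.
replace (u s + v s - (u t + v t))%C with ((u s - u t) + (v s - v t))%C by ring.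
eapply Rle_trans. apply Cmod_triangle. rewrite Rmult_plus_distr_r.
apply Rplus_le_compat; now apply holder_seminorm_ub.
Qed.

Definition holder_plus (alpha : R) (u v : holder alpha) : holder alpha :=
  Build_holder alpha (CT_plus u v) (ex_intro _ _ (holder_plus_est alpha u v)).

Lemma holder_scal_est (alpha : R) (c : C) (u : holder alpha) (s t : R) : s <> t ->
  Cmod (CT_scal c u s - CT_scal c u t)%C <=
  (Cmod c * holder_seminorm alpha u) * Rpower (Rabs (s - t)) alpha.
Proof.
intros H. simpl.
replace (c * u s - c * u t)%C with (c * (u s - u t))%C by ring.
rewrite Cmod_mult, Rmult_assoc. apply Rmult_le_compat_l. apply Cmod_ge_0.
now apply holder_seminorm_ub.
Qed.

Definition holder_scal (alpha : R) (c : C) (u : holder alpha) : holder alpha :=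
  Build_holder alpha (CT_scal c u) (ex_intro _ _ (holder_scal_est alpha c u)).

Lemma holder_norm_scal (alpha : R) (c : C) (u : holder alpha) :
  holder_norm alpha (holder_scal alpha c u) <= Cmod c * holder_norm alpha u.
Proof.
unfold holder_norm at 2. rewrite Rmult_plus_distr_l. apply holder_norm_le.
- exact (holder_scal_est alpha c u).
- intros t. simpl. rewrite Cmod_mult. apply Rmult_le_compat_l. apply Cmod_ge_0.
  apply sup_norm_ub.
Qed.

Definition holder_data (alpha : R) : normed_data C_AbsRing (holder alpha).
Proof.
refine (Build_normed_data C_AbsRing (holder alpha) (holder_plus alpha)
          (holder_const alpha 0) (holder_scal alpha (- (1))%C)
          (holder_scal alpha) (holder_norm alpha) _ _ _ _ _ _ _ _ _ _ _ _ _).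
- intros u v; apply holder_ext; intros t; simpl; ring.
- intros u v w; apply holder_ext; intros t; simpl; ring.
- intros u; apply holder_ext; intros t; simpl; ring.
- intros u; apply holder_ext; intros t; simpl; ring.
- intros a b u; apply holder_ext; intros t; simpl; apply Cmult_assoc.
- intros u; apply holder_ext; intros t; simpl; apply Cmult_1_l.
- intros a u v; apply holder_ext; intros t; simpl; apply Cmult_plus_distr_l.
- intros a b u; apply holder_ext; intros t; simpl; apply Cmult_plus_distr_r.
- apply Rle_antisym.
  + apply Rle_trans with (0 + 0); [apply holder_norm_le | lra].
    * intros s t _. change (Cmod (0 - 0)%C <= 0 * Rpower (Rabs (s - t)) alpha).
      replace (0 - 0)%C with (RtoC 0) by ring. rewrite Cmod_0. lra.
    * intros t. change (Cmod (RtoC 0) <= 0). rewrite Cmod_0. lra.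
  + apply Rplus_le_le_0_compat. apply holder_seminorm_ge0. apply sup_norm_ge0.
- assert (H : forall u, holder_norm alpha (holder_scal alpha (- (1))%C u)
                        <= holder_norm alpha u).
  { intros u. eapply Rle_trans. apply holder_norm_scal.
    rewrite Cmod_opp, Cmod_1. lra. }
  intros u; apply Rle_antisym; [apply H|].
  replace u with (holder_scal alpha (- (1))%C (holder_scal alpha (- (1))%C u)) at 1.
  apply H. apply holder_ext; intros t; simpl; ring.
- intros u v. eapply Rle_trans.
  + apply holder_norm_le. apply holder_plus_est.
    intros t; simpl. eapply Rle_trans. apply Cmod_triangle.
    apply Rplus_le_compat; apply sup_norm_ub.
  + unfold holder_norm. lra.
- exact (holder_norm_scal alpha).
- intros u H; apply holder_ext; intros t; simpl.
  apply Cmod_eq_0. apply Rle_antisym; [|apply Cmod_ge_0].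
  eapply Rle_trans. apply sup_norm_ub.
  pose proof (holder_seminorm_ge0 alpha u). unfold holder_norm in H. lra.
Defined.

Definition HolderSpace (alpha : R) : NormedModule C_AbsRing :=
  NormedModule_of C_AbsRing (holder alpha) (holder_data alpha).

Lemma Cmod_sum_n_le (a : nat -> C) (B : R) (n : nat) :
  (forall i, Cmod (a i) <= B) -> Cmod (sum_n a n) <= INR (S n) * B.
Proof.
intros H. induction n as [|n IH].
- rewrite sum_O. simpl. rewrite Rmult_1_l. apply H.
- rewrite sum_Sn. eapply Rle_trans. apply Cmod_triangle.
  rewrite (S_INR (S n)). specialize (H (S n)). lra.
Qed.

Lemma Csum_n_minus (a b : nat -> C) (n : nat) :
  (sum_n a n - sum_n b n = sum_n (fun i => a i - b i) n)%C.
Proof.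
induction n as [|n IH].
- now rewrite !sum_O.
- rewrite !sum_Sn, <- IH. unfold plus; simpl. ring.
Qed.

Lemma transfer_sup_est (d : nat) (f u : CT) (t : R) :
  Cmod (transfer d f u t) <= sup_norm f * sup_norm u.
Proof.
simpl. pose proof (sup_norm_ge0 f). pose proof (sup_norm_ge0 u).
destruct d as [|k].
{ rewrite transfer_fun0, Cmod_0. now apply Rmult_le_pos. }
unfold transfer_fun. rewrite Cmod_mult, Cmod_R.
assert (Hd : 0 < INR (S k)) by (apply lt_0_INR; lia).
rewrite Rabs_pos_eq by (left; now apply Rinv_0_lt_compat).
replace (S k - 1)%nat with k by lia.
apply Rmult_le_reg_l with (INR (S k)); [exact Hd|].
rewrite <- Rmult_assoc, Rinv_r, Rmult_1_l by lra.
apply Cmod_sum_n_le. intros i. rewrite Cmod_mult.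
apply Rmult_le_compat; try apply Cmod_ge_0; apply sup_norm_ub.
Qed.

Lemma holder_mult_est (alpha : R) (f u : holder alpha) (s t : R) : s <> t ->
  Cmod (f s * u s - f t * u t)%C <=
  holder_norm alpha f * holder_norm alpha u * Rpower (Rabs (s - t)) alpha.
Proof.
intros Hst.
replace (f s * u s - f t * u t)%C
  with (f s * (u s - u t) + (f s - f t) * u t)%C by ring.
eapply Rle_trans. apply Cmod_triangle. rewrite !Cmod_mult.
pose proof (holder_seminorm_ub alpha f s t Hst).
pose proof (holder_seminorm_ub alpha u s t Hst).
pose proof (sup_norm_ub f s). pose proof (sup_norm_ub u t).
pose proof (Cmod_ge_0 (f s)). pose proof (Cmod_ge_0 (u t)).
pose proof (Cmod_ge_0 (f s - f t)%C). pose proof (Cmod_ge_0 (u s - u t)%C).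
pose proof (holder_seminorm_ge0 alpha f). pose proof (holder_seminorm_ge0 alpha u).
pose proof (sup_norm_ge0 f). pose proof (sup_norm_ge0 u).
pose proof (Rpower_pos (Rabs (s - t)) alpha).
set (p := Rpower (Rabs (s - t)) alpha) in *.
apply Rle_trans with
  (sup_norm f * (holder_seminorm alpha u * p)
   + holder_seminorm alpha f * p * sup_norm u).
- apply Rplus_le_compat; apply Rmult_le_compat; assumption.
- unfold holder_norm.
  assert (0 <= holder_seminorm alpha f * holder_seminorm alpha u) by now apply Rmult_le_pos.
  assert (0 <= sup_norm f * sup_norm u) by now apply Rmult_le_pos.
  nra.
Qed.

Lemma transfer_holder_est (alpha : R) (d : nat) (f u : holder alpha) (s t : R) :
  s <> t ->
  Cmod (transfer d f u s - transfer d f u t)%C <=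
  Rpower (/ INR d) alpha * holder_norm alpha f * holder_norm alpha u
    * Rpower (Rabs (s - t)) alpha.
Proof.
intros Hst. simpl.
assert (Hf : 0 <= holder_norm alpha f)
  by (apply Rplus_le_le_0_compat; [apply holder_seminorm_ge0|apply sup_norm_ge0]).
assert (Hu : 0 <= holder_norm alpha u)
  by (apply Rplus_le_le_0_compat; [apply holder_seminorm_ge0|apply sup_norm_ge0]).
destruct d as [|k].
{ rewrite !transfer_fun0. replace (0 - 0)%C with (RtoC 0) by ring.
  rewrite Cmod_0. repeat apply Rmult_le_pos; try assumption; left; apply Rpower_pos. }
assert (Hd : 0 < INR (S k)) by (apply lt_0_INR; lia).
assert (Hid : 0 < / INR (S k)) by now apply Rinv_0_lt_compat.
unfold transfer_fun.
match goal with |- Cmod (?c * ?x - ?c * ?y)%C <= _ =>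
  replace (c * x - c * y)%C with (c * (x - y))%C by ring end.
rewrite Csum_n_minus, Cmod_mult, Cmod_R.
rewrite Rabs_pos_eq by lra.
replace (S k - 1)%nat with k by lia.
apply Rmult_le_reg_l with (INR (S k)); [exact Hd|].
rewrite <- Rmult_assoc, Rinv_r, Rmult_1_l by lra.
apply Cmod_sum_n_le. intros i.
assert (Hne : (s + INR i) / INR (S k) <> (t + INR i) / INR (S k)).
{ intros H. apply Hst. apply Rmult_eq_reg_r in H; lra. }
eapply Rle_trans. apply (holder_mult_est alpha f u _ _ Hne).
replace ((s + INR i) / INR (S k) - (t + INR i) / INR (S k))
  with ((s - t) * / INR (S k)) by (field; lra).
rewrite Rabs_mult, (Rabs_pos_eq (/ INR (S k))) by lra.
rewrite <- Rpower_mult_distr; [|apply Rabs_pos_lt; lra|exact Hid].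
right. ring.
Qed.

Definition transfer_holder_fun (alpha : R) (d : nat) (f u : holder alpha) :
  holder alpha :=
  Build_holder alpha (transfer d f u)
    (ex_intro _ _ (transfer_holder_est alpha d f u)).

Lemma transfer_holder_linear (alpha : R) (d : nat) (f : holder alpha) :
  is_linear (U := HolderSpace alpha) (V := HolderSpace alpha)
    (transfer_holder_fun alpha d f).
Proof.
split.
- intros u v. apply holder_ext. intros t. unfold plus; simpl. unfold transfer_fun.
  rewrite <- Cmult_plus_distr_l. f_equal.
  rewrite <- (sum_n_plus (G := C_AbelianMonoid)). apply sum_n_ext. intros i.
  unfold plus; simpl. ring.
- intros c u. apply holder_ext. intros t. unfold scal; simpl. unfold transfer_fun.
  transitivity (RtoC (/ INR d) * (c * sum_n (fun i => f ((t + INR i) / INR d)%R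
     * u ((t + INR i) / INR d)%R) (d - 1)))%C; [|simpl; ring].
  f_equal.
  rewrite <- (sum_n_mult_l (K := C_Ring)). apply sum_n_ext. intros i.
  unfold mult; simpl. ring.
- assert (Hf : 0 <= holder_norm alpha f)
    by (apply Rplus_le_le_0_compat; [apply holder_seminorm_ge0|apply sup_norm_ge0]).
  pose proof (Rpower_pos (/ INR d) alpha) as Hp.
  exists (Rpower (/ INR d) alpha * holder_norm alpha f + sup_norm f + 1). split.
  { pose proof (sup_norm_ge0 f). nra. }
  intros u. change (holder_norm alpha (transfer_holder_fun alpha d f u) <=
    (Rpower (/ INR d) alpha * holder_norm alpha f + sup_norm f + 1)
      * holder_norm alpha u).
  pose proof (holder_seminorm_ge0 alpha u). pose proof (sup_norm_ge0 u).
  pose proof (sup_norm_ge0 f).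
  eapply Rle_trans.
  + apply holder_norm_le. apply transfer_holder_est. apply transfer_sup_est.
  + unfold holder_norm at 2 4.
    set (c := Rpower (/ INR d) alpha * holder_norm alpha f).
    assert (0 <= sup_norm f * holder_seminorm alpha u) by now apply Rmult_le_pos.
    lra.
Qed.

Definition transfer_holder (alpha : R) (d : nat) (f : holder alpha) :
  bounded_op (HolderSpace alpha) :=
  Build_bounded_op (HolderSpace alpha) (transfer_holder_fun alpha d f)
    (transfer_holder_linear alpha d f).

(* Main.v *)
(* Write L for the transfer operator on real functions and theta = d^(-alpha) < 1. Pulling back along
   the inverse branches contracts distances, which gives the Lasota-Yorke inequality
   |L^n u|_alpha <= theta^n |L^n 1|_oo |u|_alpha + C_n |u|_oo.

   Let R0 be the exponential growth rate of max L^n 1. The partial sums u_N of sum R0^-n L^n 1 are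
   unbounded, and by Lasota-Yorke the functions u_N / max u_N are uniformly Hoelder; their pointwise
   limsup h satisfies L h >= R0 h, h <> 0. The Krein property turns this into L h = R0 h, h > 0,
   because a defect L h - R0 h would become strictly positive under some L^n and so contradict the
   definition of R0.

   For T = L / R0, a Hoelder function with 0 <= u <= w h is, after enough steps, either bounded below
   by c w h (by Krein applied to finitely many bump functions, if u is somewhere at least w h / 2) or
   bounded above by w h / 2. With Lasota-Yorke the oscillation relative to h therefore contracts
   geometrically in the Hoelder norm, so T^n converges exponentially to a projection P.

   P is the Riesz projection: the resolvent is P / (z - R0) plus a regular part Q(z) which satisfies the
   resolvent identity on every isolating disc including its centre, and the contour integral of Q
   vanishes by shrinking the circle to a point. *)

Require Import Defs.
From Stdlib Require Import Reals ZArith Lra Lia List.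
From Stdlib Require Import FunctionalExtensionality ClassicalEpsilon Classical.
From Coquelicot Require Import Coquelicot.
Open Scope R_scope.

(** * Periodic Hoelder functions and the transfer operator *)

(** The Riesz projection has to be recognised through its contour integral over every isolating
    circle, however large, inside an operator space whose completeness is never established. Two
    choices follow. All limits are taken along sequences with geometrically decaying increments, so
    [fast_complete] is all that is asked of the Hoelder space and each limit comes with a rate. The
    contour integral is shown to vanish at the level of Riemann sums, with exact difference
    identities in place of derivatives. The Krein property supplies an exponent that depends on the
    function. Uniform statements are therefore reduced to one fixed function or to finitely many,
    with a uniform Hoelder constant providing the reduction. The spectral gap is obtained without
    quasi-compactness: decay of [T^(n+1) - T^n] produces [P] as a limit, and every property of [P]
    is read off from the rate. During the real-variable argument [R0] is a supremum of lower growth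
    rates. Its identity with the limit of n-th roots is a consequence of the eigenfunction, not an
    ingredient of its construction. *)

Ltac rring := match goal with |- @eq _ ?a ?b => change (@eq R a b) end;
  unfold mult, plus, opp, zero, one; simpl; ring.

(* [Rpower 0 alpha = 1], so the condition is harmless for [s = t]. *)
Definition hol (alpha A : R) (u : R -> R) : Prop :=
  forall s t, Rabs (u s - u t) <= A * Rpower (Rabs (s - t)) alpha.

Definition per (u : R -> R) : Prop := forall t, u (t + 1) = u t.

Definition branch (d i : nat) (t : R) : R := (t + INR i) / INR d.

Definition rop (d : nat) (F u : R -> R) (t : R) : R :=
  / INR d * sum_n (fun i => F (branch d i t) * u (branch d i t)) (d - 1).

Lemma sum_n_le_R (a b : nat -> R) (n : nat) :
  (forall i, a i <= b i) -> sum_n a n <= sum_n b n.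
Proof.
intros H. induction n as [|n IH].
- rewrite !sum_O. apply H.
- rewrite !sum_Sn. apply Rplus_le_compat; [exact IH | apply H].
Qed.

Lemma Rabs_sum_n_le (a : nat -> R) (n : nat) :
  Rabs (sum_n a n) <= sum_n (fun i => Rabs (a i)) n.
Proof.
induction n as [|n IH].
- rewrite !sum_O. apply Rle_refl.
- rewrite !sum_Sn. eapply Rle_trans. apply Rabs_triang.
  apply Rplus_le_compat; [exact IH | apply Rle_refl].
Qed.

Lemma sum_n_lin (a b : nat -> R) (x y : R) (n : nat) :
  sum_n (fun i => x * a i + y * b i) n = x * sum_n a n + y * sum_n b n.
Proof.
induction n as [|n IH].
- now rewrite !sum_O.
- rewrite !sum_Sn, IH. unfold plus; simpl. rring.
Qed.

Lemma sum_n_1 (n : nat) : sum_n (fun _ => 1) n = INR (S n).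
Proof. rewrite sum_n_const. apply Rmult_1_r. Qed.

Lemma hol_ge0 (alpha A : R) (u : R -> R) : hol alpha A u -> 0 <= A.
Proof.
intros H. specialize (H 1 0). pose proof (Rabs_pos (u 1 - u 0)).
pose proof (Rpower_pos (Rabs (1 - 0)) alpha). nra.
Qed.

Lemma hol_weaken (alpha A B : R) (u : R -> R) :
  hol alpha A u -> A <= B -> hol alpha B u.
Proof.
intros H HAB s t. eapply Rle_trans. apply H.
apply Rmult_le_compat_r; [left; apply Rpower_pos | exact HAB].
Qed.

Lemma hol_lin (alpha A B x y : R) (u v : R -> R) :
  hol alpha A u -> hol alpha B v ->
  hol alpha (Rabs x * A + Rabs y * B) (fun t => x * u t + y * v t).
Proof.
intros Hu Hv s t. specialize (Hu s t). specialize (Hv s t).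
replace (x * u s + y * v s - (x * u t + y * v t))
  with (x * (u s - u t) + y * (v s - v t)) by ring.
eapply Rle_trans. apply Rabs_triang. rewrite !Rabs_mult.
pose proof (Rabs_pos x). pose proof (Rabs_pos y). nra.
Qed.

Lemma hol_const (alpha c : R) : hol alpha 0 (fun _ => c).
Proof. intros s t. rewrite Rminus_diag, Rabs_R0. lra. Qed.

Lemma hol_ext (alpha A : R) (u v : R -> R) :
  (forall t, u t = v t) -> hol alpha A u -> hol alpha A v.
Proof. intros H Hu s t. rewrite <- !H. apply Hu. Qed.

Lemma hol_scal (alpha A x : R) (u : R -> R) :
  hol alpha A u -> hol alpha (Rabs x * A) (fun t => x * u t).
Proof.
intros Hu s t. rewrite <- Rmult_minus_distr_l, Rabs_mult, Rmult_assoc.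
apply Rmult_le_compat_l; [apply Rabs_pos | apply Hu].
Qed.

Lemma Rpower_small (alpha eps : R) : 0 < alpha -> 0 < eps ->
  exists del, 0 < del /\ forall x, 0 < x -> x < del -> Rpower x alpha < eps.
Proof.
intros Ha He. exists (Rpower eps (/ alpha)). split; [apply Rpower_pos|].
intros x Hx Hxd.
replace eps with (Rpower (Rpower eps (/ alpha)) alpha).
- apply Rlt_Rpower_l; [exact Ha | lra].
- rewrite Rpower_mult, Rinv_l, Rpower_1; lra.
Qed.

Lemma hol_continuous (alpha A : R) (u : R -> R) (t : R) :
  0 < alpha -> hol alpha A u -> continuity_pt u t.
Proof.
intros Ha Hu. pose proof (hol_ge0 _ _ _ Hu) as HA.
intros eps He.
destruct (Rpower_small alpha (eps / (A + 1)) Ha) as [del [Hd H]].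
{ apply Rdiv_lt_0_compat; lra. }
exists del. split; [exact Hd|]. intros x [[_ Hne] Hx].
simpl in *. unfold Rdist in *.
eapply Rle_lt_trans. apply Hu.
assert (H1 : Rpower (Rabs (x - t)) alpha < eps / (A + 1)).
{ apply H; [|exact Hx]. apply Rabs_pos_lt. intros E. apply Hne. lra. }
pose proof (Rpower_pos (Rabs (x - t)) alpha).
apply Rle_lt_trans with (Rpower (Rabs (x - t)) alpha * (A + 1)); [nra|].
apply Rmult_lt_reg_r with (/ (A + 1)). apply Rinv_0_lt_compat; lra.
rewrite Rmult_assoc, Rinv_r by lra. unfold Rdiv in H1. lra.
Qed.

Lemma per_nat (u : R -> R) (n : nat) (t : R) : per u -> u (t + INR n) = u t.
Proof.
intros Hu. induction n as [|n IH].
- simpl. now rewrite Rplus_0_r.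
- rewrite S_INR, <- Rplus_assoc, Hu. exact IH.
Qed.

Lemma per_Z (u : R -> R) (n : Z) (t : R) : per u -> u (t + IZR n) = u t.
Proof.
intros Hu. destruct (Z.le_gt_cases 0 n) as [H|H].
- rewrite <- (Z2Nat.id n H), <- INR_IZR_INZ. now apply per_nat.
- rewrite <- (per_nat u (Z.to_nat (- n)) (t + IZR n) Hu).
  f_equal. rewrite INR_IZR_INZ, Z2Nat.id by lia. rewrite opp_IZR. ring.
Qed.

Lemma per_frac (u : R -> R) (t : R) : per u ->
  exists t', 0 <= t' <= 1 /\ u t' = u t /\ exists n, t' = t + IZR n.
Proof.
intros Hu. destruct (base_Int_part t) as [H1 H2].
exists (t + IZR (- Int_part t)). pose proof (opp_IZR (Int_part t)) as E.
repeat split; [lra|lra| |]. now apply per_Z. now exists (- Int_part t)%Z.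
Qed.

Lemma per_hol_max (alpha A : R) (u : R -> R) : 0 < alpha -> per u -> hol alpha A u ->
  exists m, 0 <= m <= 1 /\ forall t, u t <= u m.
Proof.
intros Ha Hp Hu.
destruct (continuity_ab_maj u 0 1) as [m [Hm Hm1]].
- lra.
- intros; now apply (hol_continuous alpha A).
- exists m. split; [exact Hm1|]. intros t.
  destruct (per_frac u t Hp) as [t' [Ht' [<- _]]]. now apply Hm.
Qed.

Lemma per_lin (x y : R) (u v : R -> R) :
  per u -> per v -> per (fun t => x * u t + y * v t).
Proof. intros Hu Hv t. now rewrite Hu, Hv. Qed.

Lemma per_hol_min (alpha A : R) (u : R -> R) : 0 < alpha -> per u -> hol alpha A u ->
  exists m, forall t, u m <= u t.
Proof.
intros Ha Hp Hu.
destruct (per_hol_max alpha (Rabs (-1) * A + Rabs 0 * A) (fun t => -1 * u t + 0 * u t) Ha)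
  as [m [_ Hm]].
- now apply per_lin.
- now apply hol_lin.
- exists m. intros t. specialize (Hm t). simpl in Hm. lra.
Qed.

Lemma per_hol_bounded (alpha A : R) (u : R -> R) : 0 < alpha -> per u -> hol alpha A u ->
  exists B, 0 < B /\ forall t, Rabs (u t) <= B.
Proof.
intros Ha Hp Hu.
destruct (per_hol_max alpha A u Ha Hp Hu) as [m [_ Hm]].
destruct (per_hol_min alpha A u Ha Hp Hu) as [m' Hm'].
exists (Rabs (u m) + Rabs (u m') + 1).
pose proof (Rabs_pos (u m)). pose proof (Rabs_pos (u m')). split; [lra|].
intros t. specialize (Hm t). specialize (Hm' t).
apply Rabs_le. pose proof (Rle_abs (u m)). pose proof (Rle_abs (- u m')).
rewrite Rabs_Ropp in *. lra.
Qed.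

Section RealOperator.
Context (d : nat) (alpha AF FB : R) (F : R -> R).
Context (Hd : (2 <= d)%nat) (Ha : 0 < alpha <= 1).
Context (F0 : forall t, 0 <= F t) (F1 : forall t, F t <= FB).
Context (Fper : per F) (Fhol : hol alpha AF F).

Notation L := (rop d F).
Notation th := (Rpower (/ INR d) alpha).

Lemma INRd_ge2 : 2 <= INR d.
Proof. apply (le_INR 2 d). exact Hd. Qed.

Lemma th_lt1 : 0 < th < 1.
Proof.
pose proof INRd_ge2. split; [apply Rpower_pos|].
unfold Rpower. apply Rlt_le_trans with (exp 0); [apply exp_increasing | rewrite exp_0; lra].
rewrite ln_Rinv by lra. assert (0 < ln (INR d)) by (rewrite <- ln_1; apply ln_increasing; lra).
nra.
Qed.

Lemma rop_lin (x y : R) (u v : R -> R) :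
  L (fun t => x * u t + y * v t) = (fun t => x * L u t + y * L v t).
Proof.
apply functional_extensionality. intros t. unfold rop.
replace (x * (/ INR d * sum_n (fun i => F (branch d i t) * u (branch d i t)) (d - 1))
  + y * (/ INR d * sum_n (fun i => F (branch d i t) * v (branch d i t)) (d - 1)))
  with (/ INR d * (x * sum_n (fun i => F (branch d i t) * u (branch d i t)) (d - 1)
        + y * sum_n (fun i => F (branch d i t) * v (branch d i t)) (d - 1))) by ring.
rewrite <- sum_n_lin. f_equal. apply sum_n_ext. intros i. rring.
Qed.

Lemma rop_scal (x : R) (u : R -> R) : L (fun t => x * u t) = (fun t => x * L u t).
Proof.
transitivity (L (fun t => x * u t + 0 * u t)).
- f_equal. apply functional_extensionality; intros; ring.
- rewrite rop_lin. apply functional_extensionality; intros; ring.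
Qed.

Lemma rop_le (u v : R -> R) : (forall t, u t <= v t) -> forall t, L u t <= L v t.
Proof.
intros H t. unfold rop. pose proof INRd_ge2.
apply Rmult_le_compat_l. left; apply Rinv_0_lt_compat; lra.
apply sum_n_le_R. intros i. apply Rmult_le_compat_l; [apply F0 | apply H].
Qed.

Lemma rop_per (u : R -> R) : per u -> per (L u).
Proof.
intros Hu t. unfold rop. f_equal. pose proof INRd_ge2.
set (a := fun i : nat => F (branch d i t) * u (branch d i t)).
transitivity (sum_n (fun i => a (S i)) (d - 1)).
- apply sum_n_ext. intros i. unfold a.
  replace (branch d i (t + 1)) with (branch d (S i) t). reflexivity.
  unfold branch. rewrite (S_INR i). f_equal. ring.
- apply (sum_n_shift R_AbelianMonoid a).
  replace (S (d - 1)) with d by lia. unfold a.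
  replace (branch d d t) with (branch d 0 t + 1). now rewrite Fper, Hu.
  unfold branch. simpl (INR 0). field. lra.
Qed.

Lemma branch_scale (i : nat) (s t : R) : s <> t ->
  Rpower (Rabs (branch d i s - branch d i t)) alpha = th * Rpower (Rabs (s - t)) alpha.
Proof.
intros Hst. pose proof INRd_ge2.
replace (branch d i s - branch d i t) with ((s - t) * / INR d) by (unfold branch; field; lra).
assert (Hi : 0 < / INR d) by (apply Rinv_0_lt_compat; lra).
rewrite Rabs_mult, (Rabs_pos_eq (/ INR d)) by lra.
rewrite <- Rpower_mult_distr; [ring | apply Rabs_pos_lt; lra | exact Hi].
Qed.

(** The Hoelder constant [W] may depend on the base point, so that iteration produces [L^n 1] at
    [s]. A constant [W] would pick up the supremum of [L 1] at each step, a rate that can exceed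
    [R0]. *)
Lemma rop_est (u W : R -> R) (B : R) :
  (forall s t, Rabs (u s - u t) <= W s * Rpower (Rabs (s - t)) alpha) ->
  (forall t, Rabs (u t) <= B) ->
  forall s t, Rabs (L u s - L u t) <=
    (th * L W s + th * AF * B) * Rpower (Rabs (s - t)) alpha.
Proof.
intros HW HB s t.
pose proof INRd_ge2 as Hd2. pose proof th_lt1 as Hth. pose proof (hol_ge0 _ _ _ Fhol) as HAF.
assert (HW0 : forall x, 0 <= W x).
{ intros x. specialize (HW x (x + 1)). pose proof (Rabs_pos (u x - u (x + 1))).
  pose proof (Rpower_pos (Rabs (x - (x + 1))) alpha). nra. }
assert (HB0 : 0 <= B) by (pose proof (HB 0); pose proof (Rabs_pos (u 0)); lra).
assert (Hi : 0 < / INR d) by (apply Rinv_0_lt_compat; lra).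
set (om := Rpower (Rabs (s - t)) alpha).
assert (Hom : 0 < om) by apply Rpower_pos.
assert (HLW : 0 <= L W s).
{ assert (H := rop_le (fun x => 0 * W x) W). rewrite rop_scal in H.
  specialize (H (fun x => ltac:(specialize (HW0 x); lra)) s). simpl in H. lra. }
destruct (Req_dec s t) as [E|E].
{ subst t. rewrite Rminus_diag, Rabs_R0.
  assert (0 <= th * L W s) by (apply Rmult_le_pos; lra).
  assert (0 <= th * AF * B) by (repeat apply Rmult_le_pos; lra). nra. }
unfold rop at 1 2. rewrite <- Rmult_minus_distr_l, Rabs_mult, (Rabs_pos_eq (/ INR d)) by lra.
replace (sum_n (fun i => F (branch d i s) * u (branch d i s)) (d - 1)
   - sum_n (fun i => F (branch d i t) * u (branch d i t)) (d - 1))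
 with (1 * sum_n (fun i => F (branch d i s) * u (branch d i s)) (d - 1)
   + (-1) * sum_n (fun i => F (branch d i t) * u (branch d i t)) (d - 1)) by ring.
rewrite <- sum_n_lin.
apply Rle_trans with (/ INR d * sum_n (fun i => (th * om) * (F (branch d i s) * W (branch d i s))
   + (th * om * AF * B) * 1) (d - 1)).
- apply Rmult_le_compat_l; [lra|]. eapply Rle_trans. apply Rabs_sum_n_le.
  apply sum_n_le_R. intros i.
  (* With [F] taken at the branch of [s] in the first term, the products [F * W] add up to
     [L W s]. *)
  replace (1 * (F (branch d i s) * u (branch d i s)) + -1 * (F (branch d i t) * u (branch d i t)))
   with (F (branch d i s) * (u (branch d i s) - u (branch d i t))
      + (F (branch d i s) - F (branch d i t)) * u (branch d i t)) by ring.
  eapply Rle_trans. apply Rabs_triang. rewrite !Rabs_mult.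
  rewrite (Rabs_pos_eq (F _)) by apply F0.
  pose proof (HW (branch d i s) (branch d i t)) as H1.
  pose proof (Fhol (branch d i s) (branch d i t)) as H2.
  rewrite branch_scale in H1, H2 by exact E. fold om in H1, H2.
  pose proof (F0 (branch d i s)). pose proof (HB (branch d i t)) as H4.
  apply Rplus_le_compat.
  + apply Rle_trans with (F (branch d i s) * (W (branch d i s) * (th * om))); [|right; ring].
    apply Rmult_le_compat_l; assumption.
  + apply Rle_trans with (AF * (th * om) * B); [|right; ring].
    apply Rmult_le_compat; try apply Rabs_pos; assumption.
- rewrite sum_n_lin, sum_n_1. replace (S (d - 1)) with d by lia.
  unfold rop. right. field. lra.
Qed.

Lemma rop_abs_le (u : R -> R) (B : R) :
  (forall t, Rabs (u t) <= B) -> forall t, Rabs (L u t) <= FB * B.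
Proof.
intros HB t. pose proof INRd_ge2 as Hd2.
assert (Hi : 0 < / INR d) by (apply Rinv_0_lt_compat; lra).
unfold rop. rewrite Rabs_mult, (Rabs_pos_eq (/ INR d)) by lra.
apply Rle_trans with (/ INR d * sum_n (fun i => (FB * B) * 1 + 0 * 1) (d - 1)).
- apply Rmult_le_compat_l; [lra|]. eapply Rle_trans. apply Rabs_sum_n_le.
  apply sum_n_le_R. intros i. rewrite Rabs_mult, (Rabs_pos_eq (F _)) by apply F0.
  replace (FB * B * 1 + 0 * 1) with (FB * B) by ring.
  apply Rmult_le_compat; [apply F0|apply Rabs_pos|apply F1|apply HB].
- rewrite sum_n_lin, sum_n_1. replace (S (d - 1)) with d by lia. right; field; lra.
Qed.

Lemma iter_abs_le (n : nat) (u : R -> R) (B : R) :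
  (forall t, Rabs (u t) <= B) -> forall t, Rabs (Nat.iter n L u t) <= FB ^ n * B.
Proof.
intros H. induction n as [|n IH]; intros t.
- simpl. rewrite Rmult_1_l. apply H.
- simpl. rewrite Rmult_assoc. now apply rop_abs_le.
Qed.

Lemma iter_lin (n : nat) (x y : R) (u v : R -> R) :
  Nat.iter n L (fun t => x * u t + y * v t) =
  (fun t => x * Nat.iter n L u t + y * Nat.iter n L v t).
Proof. induction n as [|n IH]; [reflexivity|]. simpl. rewrite IH. apply rop_lin. Qed.

Lemma iter_scal (n : nat) (x : R) (u : R -> R) :
  Nat.iter n L (fun t => x * u t) = (fun t => x * Nat.iter n L u t).
Proof. induction n as [|n IH]; [reflexivity|]. simpl. rewrite IH. apply rop_scal. Qed.

Lemma iter_le (n : nat) (u v : R -> R) :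
  (forall t, u t <= v t) -> forall t, Nat.iter n L u t <= Nat.iter n L v t.
Proof. intros H. induction n as [|n IH]; [exact H|]. simpl. now apply rop_le. Qed.

Lemma iter_ge0 (n : nat) (u : R -> R) :
  (forall t, 0 <= u t) -> forall t, 0 <= Nat.iter n L u t.
Proof.
intros H t. assert (H1 := iter_le n (fun x => 0 * u x) u). rewrite iter_scal in H1.
specialize (H1 (fun x => ltac:(specialize (H x); lra)) t). simpl in H1. lra.
Qed.

Lemma iter_per (n : nat) (u : R -> R) : per u -> per (Nat.iter n L u).
Proof. intros H. induction n as [|n IH]; [exact H|]. simpl. now apply rop_per. Qed.

(** Induction through [rop_est] with [W = th^n A L^n 1 + Cn B]. All losses go into [Cn], which may
    grow with [n] because it multiplies only the sup bound. *)
Lemma lasota_yorke (n : nat) : exists Cn, 0 <= Cn /\ forall (u : R -> R) (A B : R),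
  hol alpha A u -> (forall t, Rabs (u t) <= B) ->
  forall s t, Rabs (Nat.iter n L u s - Nat.iter n L u t) <=
    (th ^ n * A * Nat.iter n L (fun _ => 1) s + Cn * B) * Rpower (Rabs (s - t)) alpha.
Proof.
pose proof th_lt1 as Hth. pose proof (hol_ge0 _ _ _ Fhol) as HAF.
assert (HFB : 0 <= FB) by (specialize (F0 0); specialize (F1 0); lra).
induction n as [|n [Cn [HCn IH]]].
- exists 0. split; [lra|]. intros u A B Hu HB s t. simpl.
  replace (1 * A * 1 + 0 * B) with A by ring. apply Hu.
- exists (th * Cn * FB + th * AF * FB ^ n).
  assert (0 <= FB ^ n) by now apply pow_le.
  split. { apply Rplus_le_le_0_compat; repeat apply Rmult_le_pos; lra. }
  intros u A B Hu HB s t. simpl.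
  eapply Rle_trans.
  + apply (rop_est _ (fun s => (th ^ n * A) * Nat.iter n L (fun _ => 1) s + (Cn * B) * 1) (FB ^ n * B)).
    * intros s' t'. rewrite (Rmult_1_r (Cn * B)). now apply IH.
    * now apply iter_abs_le.
  + apply Rmult_le_compat_r; [left; apply Rpower_pos|].
    assert (HB0 : 0 <= B) by (pose proof (HB 0); pose proof (Rabs_pos (u 0)); lra).
    rewrite rop_lin.
    assert (H1 : L (fun _ => 1) s <= FB).
    { eapply Rle_trans. apply Rle_abs. rewrite <- (Rmult_1_r FB).
      apply rop_abs_le. intros. rewrite Rabs_R1. lra. }
    assert (th * (Cn * B) * L (fun _ => 1) s <= th * (Cn * B) * FB).
    { apply Rmult_le_compat_l; [repeat apply Rmult_le_pos; lra | exact H1]. }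
    lra.
Qed.

Lemma iter_hol (n : nat) (u : R -> R) (A : R) :
  per u -> hol alpha A u -> exists A', hol alpha A' (Nat.iter n L u).
Proof.
intros Hp Hu. destruct (lasota_yorke n) as [Cn [HCn H]].
destruct (per_hol_bounded alpha A u) as [B [HB0 HB]]; [lra|exact Hp|exact Hu|].
exists (th ^ n * A * FB ^ n + Cn * B). intros s t.
eapply Rle_trans. now apply H.
apply Rmult_le_compat_r; [left; apply Rpower_pos|].
apply Rplus_le_compat_r. apply Rmult_le_compat_l.
- apply Rmult_le_pos; [apply pow_le; left; apply Rpower_pos | now apply (hol_ge0 alpha A u)].
- eapply Rle_trans. apply Rle_abs. rewrite <- (Rmult_1_r (FB ^ n)).
  apply iter_abs_le. intros. rewrite Rabs_R1. lra.
Qed.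

(** * Growth rate and positive eigenfunction *)

Lemma Rabs_cos_diff (a b : R) : Rabs (cos a - cos b) <= Rabs (a - b).
Proof.
destruct (MVT_abs cos (fun x => - sin x) b a) as [c [H _]].
- intros c _. apply derivable_pt_lim_cos.
- rewrite H, Rabs_Ropp. pose proof (Rabs_pos (a - b)). pose proof (SIN_bound c).
  assert (Rabs (sin c) <= 1) by (apply Rabs_le; lra). nra.
Qed.

Lemma Rpower_ge_self (x : R) : 0 < x <= 1 -> x <= Rpower x alpha.
Proof.
intros Hx. rewrite <- (Rpower_1 x) at 1 by lra. unfold Rpower.
assert (ln x <= 0) by (rewrite <- ln_1; apply ln_le; lra).
assert (H1 : 1 * ln x <= alpha * ln x) by nra.
destruct H1 as [H1|H1]; [left; now apply exp_increasing | rewrite H1; lra].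
Qed.

Lemma Rpower_ge1 (x : R) : 1 <= x -> 1 <= Rpower x alpha.
Proof.
intros Hx. rewrite <- (Rpower_O x) by lra. apply Rle_Rpower; lra.
Qed.

(** Up to distance 1 the Lipschitz bound suffices, as [alpha <= 1] makes the power at least
    [|s - t|]; beyond 1 the power is at least 1 and the oscillation bound takes over. *)
Lemma lipschitz_hol (K B : R) (u : R -> R) :
  (forall s t, Rabs (u s - u t) <= K * Rabs (s - t)) ->
  (forall s t, Rabs (u s - u t) <= B) -> hol alpha (K + B) u.
Proof.
intros HK HB s t.
assert (K0 : 0 <= K).
{ specialize (HK 1 0). pose proof (Rabs_pos (u 1 - u 0)).
  rewrite Rminus_0_r, Rabs_R1 in HK. lra. }
assert (B0 : 0 <= B) by (specialize (HB 0 0); pose proof (Rabs_pos (u 0 - u 0)); lra).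
pose proof (Rpower_pos (Rabs (s - t)) alpha).
destruct (Req_dec s t) as [->|E].
{ rewrite (Rminus_diag (u t)), Rabs_R0. nra. }
specialize (HK s t). specialize (HB s t).
assert (0 < Rabs (s - t)) by (apply Rabs_pos_lt; lra).
destruct (Rle_dec (Rabs (s - t)) 1).
- assert (Rabs (s - t) <= Rpower (Rabs (s - t)) alpha) by (apply Rpower_ge_self; lra). nra.
- assert (1 <= Rpower (Rabs (s - t)) alpha) by (apply Rpower_ge1; lra). nra.
Qed.

Lemma cos_hol (t0 : R) : hol alpha (2 * PI + 2) (fun t => cos (2 * PI * (t - t0))).
Proof.
apply lipschitz_hol; intros s t.
- eapply Rle_trans. apply Rabs_cos_diff.
  replace (2 * PI * (s - t0) - 2 * PI * (t - t0)) with (2 * PI * (s - t)) by ring.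
  rewrite Rabs_mult, (Rabs_pos_eq (2 * PI)). lra. pose proof PI_RGT_0; lra.
- pose proof (COS_bound (2 * PI * (s - t0))). pose proof (COS_bound (2 * PI * (t - t0))).
  apply Rabs_le. lra.
Qed.

Lemma cos_per (t0 : R) : per (fun t => cos (2 * PI * (t - t0))).
Proof.
intros t. replace (2 * PI * (t + 1 - t0)) with (2 * PI * (t - t0) + 2 * INR 1 * PI) by (simpl; ring).
apply cos_period.
Qed.

(** The Krein property for real Hoelder functions, the form in which the argument applies it;
    [krein_real] derives it. *)
Context (KR : forall (u : R -> R) (A : R), per u -> hol alpha A u ->
  (forall t, 0 <= u t) -> (exists t, 0 < u t) ->
  exists n, forall t, 0 < Nat.iter n L u t).

Lemma per_1 : per (fun _ => 1).
Proof. intros t. reflexivity. Qed.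

(** If [L 1] vanished at [t0], so would [L v] for every bounded [v]. The test function [1 - cos]
    also vanishes at [t0], which rules out the exponent 0, so none of its iterates would be positive
    there. *)
Lemma rop_1_pos (t0 : R) : 0 < L (fun _ => 1) t0.
Proof.
assert (H0 : 0 <= L (fun _ => 1) t0) by (apply (iter_ge0 1); intros; lra).
destruct H0 as [H0|H0]; [exact H0|exfalso].
set (u := fun t => 1 * 1 + (-1) * cos (2 * PI * (t - t0))).
destruct (KR u (Rabs 1 * 0 + Rabs (-1) * (2 * PI + 2))) as [n Hn].
- apply (per_lin 1 (-1) (fun _ => 1)). apply per_1. apply cos_per.
- apply (hol_lin alpha _ _ 1 (-1) (fun _ => 1)). apply hol_const. apply cos_hol.
- intros t. unfold u. pose proof (COS_bound (2 * PI * (t - t0))). lra.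
- exists (t0 + / 2). unfold u.
  replace (2 * PI * (t0 + / 2 - t0)) with PI by field. rewrite cos_PI. lra.
- specialize (Hn t0). destruct n as [|n].
  + simpl in Hn. unfold u in Hn. rewrite Rminus_diag, Rmult_0_r, cos_0 in Hn. lra.
  + simpl in Hn.
    assert (H : L (Nat.iter n L u) t0 <= L (fun t => (FB ^ n * 2) * 1) t0).
    { apply rop_le. intros t. rewrite Rmult_1_r. eapply Rle_trans. apply Rle_abs.
      apply iter_abs_le. intros s. unfold u.
      pose proof (COS_bound (2 * PI * (s - t0))). apply Rabs_le. lra. }
    rewrite rop_scal, <- H0 in H. lra.
Qed.

Lemma hol_iter_1 (n : nat) : exists A, hol alpha A (Nat.iter n L (fun _ => 1)).
Proof. apply (iter_hol n _ 0 per_1). apply hol_const. Qed.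

(* The growth rate is the supremum of these [r]; this avoids n-th roots. *)
Definition growth_lb (r : R) : Prop :=
  0 <= r /\ forall n, exists t, r ^ n <= Nat.iter n L (fun _ => 1) t.

Lemma growth_exists : exists R0, 0 < R0 /\
  (forall r, R0 < r -> exists n, forall t, Nat.iter n L (fun _ => 1) t < r ^ n) /\
  (forall r, 0 <= r < R0 -> growth_lb r).
Proof.
destruct (completeness growth_lb) as [R0 [Hub Hlub]].
- exists FB. intros r [Hr H]. destruct (H 1%nat) as [t Ht].
  simpl in Ht. rewrite Rmult_1_r in Ht.
  eapply Rle_trans. exact Ht. eapply Rle_trans. apply Rle_abs.
  rewrite <- (Rmult_1_r FB). apply rop_abs_le. intros; rewrite Rabs_R1; lra.
- exists 0. split; [lra|]. intros n. exists 0.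
  destruct n; simpl; [lra|]. rewrite Rmult_0_l. apply (iter_ge0 (S n)). intros; lra.
- exists R0. repeat split.
  (* The minimum [c] of [L 1] is positive and [L^n 1 >= c^n], hence [R0 >= c]. *)
  + destruct (hol_iter_1 1) as [A HA].
    destruct (per_hol_min alpha A (L (fun _ => 1))) as [m Hm].
    lra. apply rop_per. apply per_1. exact HA.
    pose proof (rop_1_pos m) as Hpos. set (c := L (fun _ => 1) m) in *.
    apply Rlt_le_trans with c; [exact Hpos|]. apply Hub. split; [lra|].
    intros n. exists 0.
    assert (H : forall t, c ^ n <= Nat.iter n L (fun _ => 1) t); [|apply H].
    induction n as [|n IH]; intros t; simpl; [lra|].
    apply Rle_trans with (L (fun _ => c ^ n * 1) t).
    * rewrite rop_scal. rewrite Rmult_comm. apply Rmult_le_compat_l; [apply pow_le; lra|]. apply Hm.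
    * apply rop_le. intros s. rewrite Rmult_1_r. apply IH.
  + intros r Hr. apply NNPP. intros Hn.
    assert (0 <= R0) by (apply Hub; split; [lra|]; intros n; exists 0;
      destruct n; simpl; [lra|]; rewrite Rmult_0_l; apply (iter_ge0 (S n)); intros; lra).
    apply (Rlt_not_le _ _ Hr). apply Hub. split; [lra|].
    intros n. apply NNPP. intros H1. apply Hn. exists n. intros t.
    apply Rnot_le_lt. intros H2. apply H1. now exists t.
  + apply H.
  + intros n. apply NNPP. intros Hn. apply (Rlt_not_le _ _ (proj2 H)).
    apply Hlub. intros r' [Hr' H']. apply Rnot_lt_le. intros Hrr.
    apply Hn. destruct (H' n) as [t Ht]. exists t.
    apply Rle_trans with (r' ^ n); [|exact Ht]. apply pow_incr. lra.
Qed.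

Lemma pow_exceeds (x B : R) : 1 < x -> exists n, B < x ^ n.
Proof.
intros Hx. destruct (Pow_x_infinity x) with (b := B + 1) as [N HN].
rewrite Rabs_pos_eq; lra.
exists N. specialize (HN N (le_n N)). rewrite Rabs_pos_eq in HN; [lra | apply pow_le; lra].
Qed.

(** * Potentials and the positive eigenfunction *)

Section Eigenfunction.
Context (R0 : R) (R0pos : 0 < R0).
Context (R0up : forall r, R0 < r -> exists n, forall t, Nat.iter n L (fun _ => 1) t < r ^ n).
Context (R0lo : forall r, 0 <= r < R0 -> growth_lb r).

Lemma growth_le (q B : R) :
  0 <= q -> (forall n t, Nat.iter n L (fun _ => 1) t <= B * q ^ n) -> R0 <= q.
Proof.
intros Hq H. apply Rnot_lt_le. intros Hlt.
set (r := (q + R0) / 2).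
assert (Hr : q < r < R0) by (unfold r; lra).
(* Unlike [q], the number [p] is certainly positive, so one may divide by [p ^ n]. *)
set (p := (q + r) / 2). assert (Hp : q <= p /\ 0 < p /\ p < r) by (unfold p; lra).
destruct (pow_exceeds (r / p) (Rabs B)) as [n Hn].
{ apply Rmult_lt_reg_r with p; [lra|].
  unfold Rdiv. rewrite Rmult_assoc, Rinv_l; lra. }
destruct (R0lo r) as [_ H1]; [lra|]. destruct (H1 n) as [t Ht].
specialize (H n t).
assert (Hqp : q ^ n <= p ^ n) by (apply pow_incr; lra).
assert (Hpn : 0 < p ^ n) by (apply pow_lt; lra).
assert (Hq0 : 0 <= q ^ n) by now apply pow_le.
unfold Rdiv in Hn. rewrite Rpow_mult_distr, pow_inv in Hn.
assert (Hrn : Rabs B * p ^ n < r ^ n).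
{ apply Rmult_lt_reg_r with (/ p ^ n). now apply Rinv_0_lt_compat.
  rewrite Rmult_assoc, Rinv_r; lra. }
pose proof (Rle_abs B). pose proof (Rabs_pos B). nra.
Qed.

(* Its [N]-th iterate at [1] is [sum_(n <= N) R0^-n L^n 1]. *)
Definition affine_step (u : R -> R) (t : R) : R := 1 + / R0 * L u t.

Notation pot N := (Nat.iter N affine_step (fun _ => 1)).

(** Separates from a later potential a part that does not depend on the starting point; Lasota-Yorke
    then applies to the linear part. *)
Lemma affine_iter (n : nat) (u : R -> R) (t : R) :
  Nat.iter n affine_step u t =
  Nat.iter n affine_step (fun _ => 0) t + / R0 ^ n * Nat.iter n L u t.
Proof.
revert t. induction n as [|n IH]; intros t.
- simpl. rewrite Rinv_1. ring.
- simpl. unfold affine_step at 1 3.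
  replace (Nat.iter n affine_step u) with
    (fun t => 1 * Nat.iter n affine_step (fun _ => 0) t + / R0 ^ n * Nat.iter n L u t)
    by (apply functional_extensionality; intros s; rewrite IH; ring).
  rewrite rop_lin, Rinv_mult. ring.
Qed.

Lemma affine_per_hol (n : nat) (u : R -> R) (A : R) : per u -> hol alpha A u ->
  per (Nat.iter n affine_step u) /\ exists A', hol alpha A' (Nat.iter n affine_step u).
Proof.
intros Hp Hu. induction n as [|n [IH1 [A' IH2]]]; [split; eauto|].
simpl. split.
- intros t. unfold affine_step. f_equal. f_equal. now apply rop_per.
- destruct (iter_hol 1 _ A' IH1 IH2) as [A'' H]. simpl in H.
  exists (Rabs 1 * 0 + Rabs (/ R0) * A'').
  apply (hol_ext alpha _ (fun t => 1 * 1 + / R0 * L (Nat.iter n affine_step u) t)).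
  { intros t. unfold affine_step at 2. ring. }
  apply (hol_lin alpha _ _ _ _ (fun _ => 1)). apply hol_const. exact H.
Qed.

Lemma affine_le (u v : R -> R) : (forall t, u t <= v t) ->
  forall t, affine_step u t <= affine_step v t.
Proof.
intros H t. unfold affine_step. apply Rplus_le_compat_l.
apply Rmult_le_compat_l. left; now apply Rinv_0_lt_compat. now apply rop_le.
Qed.

Lemma pot_step_le (N : nat) (t : R) : pot N t <= pot (S N) t.
Proof.
revert t. induction N as [|N IH]; intros t.
- simpl. unfold affine_step. assert (0 < / R0) by now apply Rinv_0_lt_compat.
  pose proof (rop_1_pos t). nra.
- simpl. now apply affine_le.
Qed.

Lemma pot_mono (n N : nat) (t : R) : pot N t <= pot (n + N)%nat t.
Proof.
induction n as [|n IH]; [apply Rle_refl|].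
eapply Rle_trans; [exact IH|]. apply (pot_step_le (n + N)).
Qed.

Lemma pot_ge1 (N : nat) (t : R) : 1 <= pot N t.
Proof. rewrite (plus_n_O N). apply (pot_mono N 0). Qed.

Lemma rop_pot (N : nat) (t : R) : L (pot N) t = R0 * (pot (S N) t - 1).
Proof. simpl. unfold affine_step at 2. field. lra. Qed.

(* A bound [B] would give [L (pot N) <= R0 (1 - 1/B) pot (N+1)], hence growth slower than [R0]. *)
Lemma pot_unbounded (B : R) : exists N t, B < pot N t.
Proof.
apply NNPP. intros Hn.
assert (HB : forall N t, pot N t <= B).
{ intros N t. apply Rnot_lt_le. intros H. apply Hn. now exists N, t. }
assert (B1 : 1 <= B) by (apply (Rle_trans _ (pot 0 0)); [apply (pot_ge1 0) | apply HB]).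
assert (Hi : 0 < / B <= 1).
{ split. apply Rinv_0_lt_compat; lra. rewrite <- Rinv_1. apply Rinv_le_contravar; lra. }
set (q := R0 * (1 - / B)).
assert (Hq : 0 <= q < R0) by (unfold q; nra).
assert (Hit : forall n t, Nat.iter n L (fun _ => 1) t <= q ^ n * pot n t).
{ induction n as [|n IH]; intros t.
  - simpl. lra.
  - change (L (Nat.iter n L (fun _ => 1)) t <= q ^ S n * pot (S n) t).
    apply Rle_trans with (L (fun t => q ^ n * pot n t) t).
    + now apply rop_le.
    + rewrite rop_scal, rop_pot. simpl (q ^ S n).
      assert (H1 : / B * pot (S n) t <= 1).
      { apply Rmult_le_reg_l with B; [lra|]. rewrite <- Rmult_assoc, Rinv_r by lra.
        specialize (HB (S n) t). lra. }
      assert (0 <= q ^ n * R0) by (apply Rmult_le_pos; [apply pow_le|]; lra).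
      unfold q at 2. set (x := pot (S n) t) in *. nra. }
apply (Rlt_not_le _ _ (proj2 Hq)). apply (growth_le q B); [lra|].
intros n t. eapply Rle_trans. apply Hit. rewrite Rmult_comm.
apply Rmult_le_compat_r; [apply pow_le; lra | apply HB].
Qed.

(** Any [r] between [R0] and [R0 / th] satisfies [th * r < R0]. Thus Lasota-Yorke contracts relative
    to [R0^n] although [R0^-n L^n 1] is not yet known to be bounded. *)
Lemma contraction_time : exists n0 kappa, 0 <= kappa < 1 /\
  forall t, th ^ n0 * Nat.iter n0 L (fun _ => 1) t <= kappa * R0 ^ n0.
Proof.
pose proof th_lt1 as Hth.
set (r := (R0 + R0 / th) / 2).
assert (H1 : R0 < R0 / th).
{ apply Rmult_lt_reg_r with th; [lra|]. unfold Rdiv. rewrite Rmult_assoc, Rinv_l by lra. nra. }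
destruct (R0up r) as [n Hn]; [unfold r; lra|].
exists n, ((r * th / R0) ^ n).
assert (H2 : 0 <= r * th / R0 < 1).
{ split. apply Rmult_le_pos. unfold r; nra. left; now apply Rinv_0_lt_compat.
  apply Rmult_lt_reg_r with R0; [lra|]. unfold Rdiv. rewrite Rmult_assoc, Rinv_l by lra.
  assert (R0 / th * th = R0) by (field; lra). unfold r. nra. }
split.
- split; [apply pow_le; lra|]. apply pow_lt_1_compat; [lra|].
  (* At [n = 0] the strict bound would read [1 < 1]. *)
  destruct n; [|lia]. specialize (Hn 0). simpl in Hn. lra.
- intros t. rewrite <- Rpow_mult_distr.
  replace (r * th / R0 * R0) with (th * r) by (field; lra). rewrite Rpow_mult_distr.
  apply Rmult_le_compat_l. apply pow_le; lra. left. apply Hn.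
Qed.

(** Strong induction in strides of [n0]: a potential is a fixed function plus [R0^-n0 L^n0] of an
    earlier one, and a bound [B] for the later potential also bounds the earlier one by
    monotonicity. The additive constant [Z] is absorbed into [Z * B] because [B >= 1]. *)
Lemma pot_hol : exists A, 0 <= A /\ forall N B, (forall t, pot N t <= B) -> hol alpha (A * B) (pot N).
Proof.
destruct contraction_time as [n0 [k [Hk Hn0]]].
destruct (lasota_yorke n0) as [Cn [HCn HLY]].
destruct (affine_per_hol n0 (fun _ => 0) 0) as [_ [Z HZ]].
{ intros t; reflexivity. } { apply hol_const. }
assert (HA0 : exists A0, 0 <= A0 /\ forall N, (N < n0)%nat -> hol alpha A0 (pot N)).
{ clear -Ha Hd F0 F1 Fper Fhol. induction n0 as [|n [A0 [HA0 IH]]].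
  - exists 0. split; [lra|]. intros; lia.
  - destruct (affine_per_hol n (fun _ => 1) 0) as [_ [Z HZ]]. apply per_1. apply hol_const.
    exists (A0 + Z). pose proof (hol_ge0 _ _ _ HZ). split; [lra|].
    intros N HN. destruct (Nat.eq_dec N n) as [->|E].
    + apply (hol_weaken alpha Z); [exact HZ|lra].
    + apply (hol_weaken alpha A0); [apply IH; lia|lra]. }
destruct HA0 as [A0 [HA0 Hb]].
assert (HRn : 0 < R0 ^ n0) by now apply pow_lt.
assert (HiR : 0 < / R0 ^ n0) by now apply Rinv_0_lt_compat.
pose proof (hol_ge0 _ _ _ HZ) as HZ0.
set (D := Cn * / R0 ^ n0 + Z).
assert (HD : 0 <= D) by (unfold D; apply Rplus_le_le_0_compat; [apply Rmult_le_pos; lra | lra]).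
assert (HD1 : 0 <= D / (1 - k)) by (apply Rmult_le_pos; [lra | left; apply Rinv_0_lt_compat; lra]).
(* [A0] serves the first [n0] potentials; [D / (1 - k)] is the fixed point of [x -> k x + D]. *)
set (A := A0 + D / (1 - k)).
assert (HA : k * A + D <= A).
{ assert (D / (1 - k) * (1 - k) = D) by (field; lra). unfold A. nra. }
exists A. split; [unfold A; lra|].
induction N as [N IH] using (well_founded_induction lt_wf).
intros B HB.
assert (B1 : 1 <= B) by (apply (Rle_trans _ (pot N 0)); [apply pot_ge1 | apply HB]).
destruct (le_lt_dec n0 N) as [Hle|Hlt].
- destruct n0 as [|n1].
  { exfalso. specialize (Hn0 0). simpl in Hn0. lra. }
  assert (HN : N = (S n1 + (N - S n1))%nat) by lia.
  set (N' := (N - S n1)%nat) in *.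
  assert (HB' : forall t, Rabs (pot N' t) <= B).
  { intros t. rewrite Rabs_pos_eq by (pose proof (pot_ge1 N' t); lra).
    eapply Rle_trans; [apply (pot_mono (S n1))|]. rewrite <- HN. apply HB. }
  specialize (IH N' ltac:(lia) B (fun t => Rle_trans _ _ _ (Rle_abs _) (HB' t))).
  intros s t. specialize (HLY (pot N') (A * B) B IH HB' s t).
  specialize (HZ s t). specialize (Hn0 s).
  rewrite HN. rewrite Nat.iter_add. rewrite (affine_iter (S n1) (pot N')).
  rewrite (affine_iter (S n1) (pot N') t).
  set (z := Nat.iter (S n1) affine_step (fun _ => 0)) in *.
  set (y := Nat.iter (S n1) L (pot N')) in *.
  set (i := / R0 ^ S n1) in *. set (om := Rpower (Rabs (s - t)) alpha) in *.
  assert (Hom : 0 < om) by apply Rpower_pos.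
  replace (z s + i * y s - (z t + i * y t)) with ((z s - z t) + i * (y s - y t)) by ring.
  eapply Rle_trans. apply Rabs_triang. rewrite Rabs_mult, (Rabs_pos_eq i) by lra.
  assert (Hx : i * (th ^ S n1 * (A * B) * Nat.iter (S n1) L (fun _ => 1) s + Cn * B)
     <= (k * A + Cn * i) * B).
  { set (x := Nat.iter (S n1) L (fun _ => 1) s) in *.
    assert (0 <= A * B) by (apply Rmult_le_pos; unfold A; lra).
    assert (A * B * (th ^ S n1 * x) <= A * B * (k * R0 ^ S n1)) by (apply Rmult_le_compat_l; assumption).
    apply Rle_trans with (i * (A * B * (k * R0 ^ S n1) + Cn * B)).
    - apply Rmult_le_compat_l; lra.
    - right. unfold i. field. apply pow_nonzero. lra. }
  apply Rle_trans with (Z * om + (k * A + Cn * i) * B * om).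
  + apply Rplus_le_compat; [exact HZ|].
    apply Rle_trans with (i * ((th ^ S n1 * (A * B) * Nat.iter (S n1) L (fun _ => 1) s + Cn * B) * om)).
    * apply Rmult_le_compat_l; [lra|exact HLY].
    * rewrite <- Rmult_assoc. apply Rmult_le_compat_r; [lra|exact Hx].
  + rewrite <- Rmult_plus_distr_r. apply Rmult_le_compat_r; [lra|].
    assert (Z <= Z * B) by nra. unfold D in HA.
    assert ((k * A + (Cn * i + Z)) * B <= A * B) by (apply Rmult_le_compat_r; lra). lra.
- apply (hol_weaken alpha A0); [now apply Hb|]. unfold A. nra.
Qed.
Lemma bounded_limsup (u : nat -> R) : (forall n, 0 <= u n <= 1) ->
  exists l, 0 <= l /\ forall eps, 0 < eps ->
    (forall N, exists n, (N <= n)%nat /\ l - eps < u n) /\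
    (exists N, forall n, (N <= n)%nat -> u n < l + eps).
Proof.
intros Hu. destruct (ex_LimSup_seq u) as [[l| |] Hl].
- exists l. assert (H : forall eps, 0 < eps ->
    (forall N, exists n, (N <= n)%nat /\ l - eps < u n) /\
    (exists N, forall n, (N <= n)%nat -> u n < l + eps)).
  { intros eps He. exact (Hl (mkposreal eps He)). }
  split; [|exact H]. apply Rnot_lt_le. intros Hlt.
  destruct (H (- l)) as [_ [N HN]]; [lra|]. specialize (HN N (le_n N)).
  specialize (Hu N). lra.
- exfalso. destruct (Hl 1 0%nat) as [n [_ Hn]]. specialize (Hu n). lra.
- exfalso. destruct (Hl 0) as [N HN]. specialize (HN N (le_n N)). specialize (Hu N). lra.
Qed.

Lemma eventually_forall_le (P : nat -> nat -> Prop) (k : nat) :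
  (forall i, exists N, forall n, (N <= n)%nat -> P i n) ->
  exists N, forall n, (N <= n)%nat -> forall i, (i <= k)%nat -> P i n.
Proof.
intros H. induction k as [|k [N HN]].
- destruct (H 0%nat) as [N HN]. exists N. intros n Hn i Hi.
  replace i with 0%nat by lia. now apply HN.
- destruct (H (S k)) as [N' HN']. exists (Nat.max N N'). intros n Hn i Hi.
  destruct (Nat.eq_dec i (S k)) as [->|E]; [apply HN'; lia | apply HN; lia].
Qed.

(** A bound by a limsup holds from an index that depends on the point, so functions can be compared
    only at the finitely many preimages of [t]. *)
Lemma rop_le_at (u v : R -> R) (t : R) :
  (forall i, (i <= d - 1)%nat -> u (branch d i t) <= v (branch d i t)) -> L u t <= L v t.
Proof.
intros H. unfold rop. pose proof INRd_ge2.
apply Rmult_le_compat_l. left; apply Rinv_0_lt_compat; lra.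
revert H. generalize (d - 1)%nat. intros n Hn.
assert (H : forall k, (k <= n)%nat -> sum_n (fun i => F (branch d i t) * u (branch d i t)) k
  <= sum_n (fun i => F (branch d i t) * v (branch d i t)) k); [|now apply H].
induction k as [|k IH]; intros Hk.
- rewrite !sum_O. apply Rmult_le_compat_l; [apply F0 | now apply Hn].
- rewrite !sum_Sn. apply Rplus_le_compat; [apply IH; lia|].
  apply Rmult_le_compat_l; [apply F0 | now apply Hn].
Qed.

(* Since only a subsolution is wanted, a pointwise limsup does the work of Arzela-Ascoli; the maxima
   [tau n] are made to accumulate in order to keep the limit nonzero. *)
Lemma limsup_sub (A : R) (v : nat -> R -> R) (tau e : nat -> R) :
  (forall n, per (v n)) -> (forall n, hol alpha A (v n)) ->
  (forall n t, 0 <= v n t <= 1) ->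
  (forall n, 0 <= tau n <= 1) -> (forall n, v n (tau n) = 1) ->
  (forall eps, 0 < eps -> exists N, forall n, (N <= n)%nat -> e n < eps) ->
  (forall n t, R0 * v n t - e n <= L (v n) t) ->
  exists w, per w /\ hol alpha A w /\ (forall t, 0 <= w t) /\ (exists t, 1 <= w t) /\
    forall t, R0 * w t <= L w t.
Proof.
intros Hp Hh Hb Htau Hone He Hsub.
set (W := fun t l => 0 <= l /\ forall eps, 0 < eps ->
    (forall N, exists n, (N <= n)%nat /\ l - eps < v n t) /\
    (exists N, forall n, (N <= n)%nat -> v n t < l + eps)).
assert (HW : forall t, exists l, W t l) by (intros t; apply bounded_limsup; intros; apply Hb).
set (w := fun t => proj1_sig (constructive_indefinite_description _ (HW t))).
assert (Hw : forall t, W t (w t)) by (intros t; exact (proj2_sig (constructive_indefinite_description _ (HW t)))).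
(* The pointwise limsup inherits such inequalities, and both periodicity and the Hoelder bound are
   of this shape. *)
assert (Hcmp : forall s t c, (forall n, v n s <= v n t + c) -> w s <= w t + c).
{ intros s t c H. apply Rnot_lt_le. intros Hlt.
  destruct (proj2 (Hw s) ((w s - w t - c) / 2)) as [Hs _]; [lra|].
  destruct (proj2 (Hw t) ((w s - w t - c) / 2)) as [_ [N Ht]]; [lra|].
  destruct (Hs N) as [n [Hn Hn']]. specialize (Ht n Hn). specialize (H n). lra. }
exists w. repeat split.
- intros t. apply Rle_antisym.
  + rewrite <- (Rplus_0_r (w t)). apply Hcmp. intros n. rewrite Hp. lra.
  + rewrite <- (Rplus_0_r (w (t + 1))). apply Hcmp. intros n. rewrite Hp. lra.
- intros s t. apply Rabs_le. split.
  + apply Rplus_le_reg_l with (w s + A * Rpower (Rabs (s - t)) alpha).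
    assert (w t <= w s + A * Rpower (Rabs (s - t)) alpha); [|lra].
    apply Hcmp. intros n. specialize (Hh n s t). pose proof (Rle_abs (- (v n s - v n t))) as H.
    rewrite Rabs_Ropp in H. lra.
  + assert (w s <= w t + A * Rpower (Rabs (s - t)) alpha); [|lra].
    apply Hcmp. intros n. specialize (Hh n s t). pose proof (Rle_abs (v n s - v n t)). lra.
- intros t. apply (Hw t).
(* At an accumulation point [x] of the maximum points, the common Hoelder constant keeps [v n x]
   close to 1 for infinitely many [n]. *)
- destruct (Bolzano_Weierstrass tau (fun x => 0 <= x <= 1)) as [x Hx].
  { apply compact_P3. } { exact Htau. }
  exists x. apply Rnot_lt_le. intros Hlt.
  set (eps := (1 - w x) / 2). assert (Heps : 0 < eps) by (unfold eps; lra).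
  destruct (proj2 (Hw x) eps Heps) as [_ [N HN]].
  pose proof (hol_ge0 _ _ _ (Hh 0%nat)) as HA.
  destruct (Rpower_small alpha (eps / (A + 1))) as [del [Hdel Hs]].
  { lra. } { apply Rdiv_lt_0_compat; lra. }
  destruct (Hx (fun y => Rabs (y - x) < del) N) as [n [Hn Hd1]].
  { exists (mkposreal del Hdel). intros y Hy. exact Hy. }
  specialize (HN n Hn). specialize (Hone n). specialize (Hh n (tau n) x).
  rewrite Hone in Hh.
  destruct (Req_dec (tau n) x) as [E|E].
  { rewrite E in Hone. unfold eps in *. lra. }
  assert (H1 : Rpower (Rabs (tau n - x)) alpha < eps / (A + 1)).
  { apply Hs; [apply Rabs_pos_lt; lra | exact Hd1]. }
  pose proof (Rpower_pos (Rabs (tau n - x)) alpha).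
  set (p := Rpower (Rabs (tau n - x)) alpha) in *.
  assert (eps / (A + 1) * (A + 1) = eps) by (field; lra).
  pose proof (Rle_abs (1 - v n x)).
  assert (A * p < eps) by nra. unfold eps in *. lra.
- intros t. apply Rnot_lt_le. intros Hlt.
  assert (HL1 : 0 < L (fun _ => 1) t) by apply rop_1_pos.
  (* The three summands account for errors of size [eps]: at the branches, in [R0 * v n t], and in
     [e n]. *)
  set (c := L (fun _ => 1) t + R0 + 1).
  set (eps := (R0 * w t - L w t) / c).
  assert (Hc : 0 < c) by (unfold c; lra).
  assert (Heps : 0 < eps) by (apply Rdiv_lt_0_compat; lra).
  destruct (eventually_forall_le (fun i n => v n (branch d i t) < w (branch d i t) + eps) (d - 1))
    as [N1 HN1].
  { intros i. apply (Hw (branch d i t)). exact Heps. }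
  destruct (He eps Heps) as [N2 HN2].
  destruct (proj2 (Hw t) eps Heps) as [H3 _].
  destruct (H3 (Nat.max N1 N2)) as [n [Hn Hn']].
  specialize (Hsub n t). specialize (HN2 n ltac:(lia)).
  assert (H4 : L (v n) t <= L (fun s => 1 * w s + eps * 1) t).
  { apply rop_le_at. intros i Hi. specialize (HN1 n ltac:(lia) i Hi). simpl in HN1. lra. }
  rewrite rop_lin in H4.
  assert (eps * c = R0 * w t - L w t) by (unfold eps; field; lra).
  assert (R0 * (w t - eps) < R0 * v n t) by (apply Rmult_lt_compat_l; lra).
  unfold c in *. lra.
Qed.

Lemma sub_eigen_exists : exists A w, per w /\ hol alpha A w /\ (forall t, 0 <= w t) /\
  (exists t, 0 < w t) /\ forall t, R0 * w t <= L w t.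
Proof.
destruct pot_hol as [A [HA Hpot]].
assert (Hk : forall k, exists p : nat * R, 0 <= snd p <= 1 /\
   (forall t, pot (fst p) t <= pot (fst p) (snd p)) /\ INR k + 1 <= pot (fst p) (snd p)).
{ intros k. destruct (pot_unbounded (INR k + 1)) as [N [t Ht]].
  destruct (affine_per_hol N (fun _ => 1) 0 per_1 (hol_const _ _)) as [H1 [A' H2]].
  destruct (per_hol_max alpha A' (pot N)) as [m [Hm Hm']]; [lra|exact H1|exact H2|].
  exists (N, m). simpl. repeat split; try lra; [exact Hm'|]. specialize (Hm' t). lra. }
set (p := fun k => proj1_sig (constructive_indefinite_description _ (Hk k))).
assert (Hp := fun k => proj2_sig (constructive_indefinite_description _ (Hk k))).
change (forall k, 0 <= snd (p k) <= 1 /\ (forall t, pot (fst (p k)) t <= pot (fst (p k)) (snd (p k)))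
  /\ INR k + 1 <= pot (fst (p k)) (snd (p k))) in Hp.
set (M := fun k => pot (fst (p k)) (snd (p k))).
assert (HM : forall k, 0 < M k /\ INR k + 1 <= M k).
{ intros k. destruct (Hp k) as [_ [_ H]]. fold (M k) in H. pose proof (pos_INR k). lra. }
(* Dividing [L (pot N) = R0 (pot (N+1) - 1) >= R0 pot N - R0] by the maximum gives the defect
   [R0 / M k], which tends to 0. *)
destruct (limsup_sub A (fun k t => / M k * pot (fst (p k)) t) (fun k => snd (p k)) (fun k => R0 / M k))
  as [w [H1 [H2 [H3 [[t Ht] H5]]]]].
- intros k t.
  destruct (affine_per_hol (fst (p k)) (fun _ => 1) 0 per_1 (hol_const _ _)) as [H1 _]. now rewrite H1.
- intros k. destruct (HM k) as [HM1 _].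
  apply (hol_weaken alpha (Rabs (/ M k) * (A * M k))).
  + apply hol_scal, Hpot, Hp.
  + rewrite Rabs_pos_eq by (left; now apply Rinv_0_lt_compat).
    right. field. lra.
- intros k t. destruct (HM k) as [HM1 _]. pose proof (pot_ge1 (fst (p k)) t).
  assert (Hi : 0 < / M k) by now apply Rinv_0_lt_compat.
  split; [apply Rmult_le_pos; lra|].
  apply Rmult_le_reg_l with (M k); [lra|]. rewrite <- Rmult_assoc, Rinv_r, Rmult_1_l, Rmult_1_r by lra.
  apply Hp.
- intros k. apply Hp.
- intros k. destruct (HM k) as [HM1 _]. apply (Rinv_l (M k)). lra.
- intros eps Heps. destruct (INR_unbounded (R0 / eps)) as [N HN].
  exists N. intros n Hn. destruct (HM n) as [HM1 HM2].
  apply le_INR in Hn. apply Rmult_lt_reg_r with (M n); [lra|].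
  unfold Rdiv. rewrite Rmult_assoc, Rinv_l, Rmult_1_r by lra.
  assert (R0 / eps * eps = R0) by (field; lra). nra.
- intros k t. destruct (HM k) as [HM1 _]. rewrite rop_scal, rop_pot.
  assert (Hi : 0 < / M k) by now apply Rinv_0_lt_compat.
  pose proof (pot_step_le (fst (p k)) t).
  unfold Rdiv. assert (R0 * / M k * pot (fst (p k)) t <= R0 * / M k * pot (S (fst (p k))) t).
  { apply Rmult_le_compat_l; [apply Rmult_le_pos; lra | assumption]. }
  lra.
- exists A, w. repeat split; try assumption. exists t. lra.
Qed.

Lemma iter_eigen (w : R -> R) (n : nat) : (forall t, L w t = R0 * w t) ->
  forall t, Nat.iter n L w t = R0 ^ n * w t.
Proof.
intros H. induction n as [|n IH]; intros t; simpl; [ring|].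
rewrite (functional_extensionality _ _ IH), rop_scal, H. ring.
Qed.

Lemma iter_super (w : R -> R) (r : R) (n : nat) : 0 <= r -> (forall t, r * w t <= L w t) ->
  forall t, r ^ n * w t <= Nat.iter n L w t.
Proof.
intros Hr H. induction n as [|n IH]; intros t; simpl; [lra|].
apply Rle_trans with (L (fun t => r ^ n * w t) t).
- rewrite rop_scal. specialize (H t). assert (0 <= r ^ n) by now apply pow_le. nra.
- now apply rop_le.
Qed.

Lemma iter_comm (n : nat) (u : R -> R) : Nat.iter n L (L u) = L (Nat.iter n L u).
Proof. induction n as [|n IH]; [reflexivity|]. simpl. now rewrite IH. Qed.

Lemma eigenfunction_exists : exists A h, per h /\ hol alpha A h /\ (forall t, 0 < h t) /\
  forall t, L h t = R0 * h t.
Proof.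
destruct sub_eigen_exists as [A [h [Hp [Hh [H0 [Ht Hsub]]]]]].
assert (Heq : forall t, L h t = R0 * h t).
{ apply NNPP. intros Hn.
  set (w := fun t => 1 * L h t + - R0 * h t).
  assert (Hw0 : forall t, 0 <= w t) by (intros t; specialize (Hsub t); unfold w; lra).
  assert (Hwt : exists t, 0 < w t).
  { apply NNPP. intros H. apply Hn. intros t. apply Rle_antisym; [|apply Hsub].
    apply Rnot_lt_le. intros Hlt. apply H. exists t. unfold w. lra. }
  destruct (iter_hol 1 h A Hp Hh) as [A1 HA1].
  assert (Hwp : per w) by (apply per_lin; [now apply rop_per | exact Hp]).
  assert (Hwh : hol alpha (Rabs 1 * A1 + Rabs (- R0) * A) w) by now apply hol_lin.
  destruct (KR w _ Hwp Hwh Hw0 Hwt) as [n Hpos].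
  set (y := Nat.iter n L h).
  assert (HLy : forall t, L y t = R0 * y t + Nat.iter n L w t).
  { intros t. unfold w. rewrite iter_lin, iter_comm. fold y. lra. }
  destruct (iter_hol n _ _ Hwp Hwh) as [A2 HA2].
  destruct (per_hol_min alpha A2 (Nat.iter n L w)) as [m Hm]; [lra|now apply iter_per|exact HA2|].
  specialize (Hpos m). set (d0 := Nat.iter n L w m) in *.
  destruct (iter_hol n _ _ Hp Hh) as [A3 HA3].
  destruct (per_hol_max alpha A3 y) as [m1 [_ Hm1]]; [lra|now apply iter_per|exact HA3|].
  assert (Hy0 : forall t, 0 <= y t) by now apply iter_ge0.
  set (Y := y m1) in *.
  assert (HY : 0 < Y).
  { destruct (Hy0 m1) as [H|H]; [exact H|exfalso]. fold Y in H.
    assert (H1 : L y m1 <= L (fun _ => 0 * 1) m1).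
    { apply rop_le. intros t. specialize (Hm1 t). lra. }
    rewrite rop_scal, HLy in H1. specialize (Hm m1). fold Y in H1. rewrite <- H in H1. lra. }
  assert (Hd0Y : 0 < d0 / Y) by now apply Rdiv_lt_0_compat.
  (* The constant gain [d0] dominates [d0 / Y * y] since [y <= Y]. So [y] grows at a rate above
     [R0], and [y <= Y * 1] passes this growth on to [L^k 1] at the point where [y = Y]. *)
  assert (Hsup : forall t, (R0 + d0 / Y) * y t <= L y t).
  { intros t. rewrite HLy. specialize (Hm t). specialize (Hm1 t).
    assert (d0 / Y * y t <= d0 / Y * Y) by (apply Rmult_le_compat_l; lra).
    assert (d0 / Y * Y = d0) by (field; lra). lra. }
  destruct (R0up (R0 + d0 / Y)) as [k Hk]; [lra|].
  specialize (Hk m1).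
  assert (H1 := iter_super y (R0 + d0 / Y) k ltac:(lra) Hsup m1).
  assert (H2 : Nat.iter k L y m1 <= Nat.iter k L (fun t => Y * 1) m1).
  { apply iter_le. intros t. specialize (Hm1 t). lra. }
  rewrite iter_scal in H2. fold Y in H1. nra. }
exists A, h. repeat split; try assumption.
(* Strict positivity is free once [h] is an eigenfunction: some [L^n h] is positive and equals
   [R0^n h]. *)
intros t. destruct (KR h A Hp Hh H0 Ht) as [n Hn]. specialize (Hn t).
rewrite iter_eigen in Hn by exact Heq.
assert (0 < R0 ^ n) by now apply pow_lt. specialize (H0 t). nra.
Qed.

End Eigenfunction.
(** * Contraction relative to the eigenfunction *)

Section Contraction.
Context (h : R -> R) (Ah m M : R).
Context (hper : per h) (hhol : hol alpha Ah h) (hm : 0 < m) (hle : forall t, m <= h t <= M).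
(** The section is meant for the normalised weight: [transfer_increments] instantiates it with
    [/ R0 * F], for which the eigenfunction is a fixed point. *)
Context (hfix : L h = h).

Lemma iter_fix (n : nat) : Nat.iter n L h = h.
Proof. induction n as [|n IH]; [reflexivity|]. simpl. now rewrite IH. Qed.

Lemma iter_sub_fix (n : nat) (a : R) (u : R -> R) :
  Nat.iter n L (fun t => u t - a * h t) = (fun t => Nat.iter n L u t - a * h t).
Proof.
replace (fun t => u t - a * h t) with (fun t => 1 * u t + (- a) * h t)
  by (apply functional_extensionality; intros; ring).
rewrite iter_lin, iter_fix. apply functional_extensionality; intros; ring.
Qed.

Lemma iter_between (n : nat) (w : R) (u : R -> R) :
  (forall t, 0 <= u t <= w * h t) -> forall t, 0 <= Nat.iter n L u t <= w * h t.
Proof.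
intros H t. split.
- apply iter_ge0. intros s. apply H.
- pose proof (iter_le n u (fun s => w * h s) (fun s => proj2 (H s)) t) as H1.
  now rewrite iter_scal, iter_fix in H1.
Qed.

(** [1 <= h / m] and [h] is fixed. This power-boundedness makes the Lasota-Yorke contraction factor
    independent of the growth rate. *)
Lemma iter_1_le (n : nat) (t : R) : Nat.iter n L (fun _ => 1) t <= M / m.
Proof.
pose proof (iter_le n (fun _ => 1) (fun s => / m * h s)) as H.
rewrite iter_scal, iter_fix in H.
apply Rle_trans with (/ m * h t).
- apply H. intros s. apply Rmult_le_reg_l with m; [exact hm|].
  rewrite <- Rmult_assoc, Rinv_r, Rmult_1_l, Rmult_1_r by lra. apply hle.
- unfold Rdiv. rewrite Rmult_comm. apply Rmult_le_compat_r; [left; now apply Rinv_0_lt_compat|apply hle].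
Qed.

Lemma M_over_m : 1 <= M / m.
Proof.
apply Rmult_le_reg_r with m; [exact hm|]. unfold Rdiv.
rewrite Rmult_assoc, Rinv_l by lra. pose proof (hle 0). lra.
Qed.

(* The constants must not depend on [j]: in [contraction_step] the number of iterations is chosen after
   the Hoelder constant [K], which in turn depends on [k] and [C]. *)
Lemma lasota_yorke_unif : exists n0 k C, (1 <= n0)%nat /\ 0 <= k < 1 /\ 0 <= C /\
  forall u A w j, hol alpha A u -> (forall t, 0 <= u t <= w * h t) -> (1 <= j)%nat ->
  hol alpha (k * A + C * w) (Nat.iter (j * n0) L u).
Proof.
pose proof th_lt1 as Hth. pose proof M_over_m as HMm.
(* [n0] is taken so large that [th^n0] beats the uniform bound [M / m] on [L^n 1]. *)
destruct (pow_exceeds (/ th) (M / m)) as [n0 Hn0].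
{ rewrite <- Rinv_1. apply Rinv_lt_contravar; lra. }
rewrite pow_inv in Hn0. assert (Hp : 0 < th ^ n0) by (apply pow_lt; lra).
assert (Hk : th ^ n0 * (M / m) < 1).
{ apply Rmult_lt_reg_l with (/ th ^ n0). now apply Rinv_0_lt_compat.
  rewrite <- Rmult_assoc, Rinv_l; lra. }
set (k := th ^ n0 * (M / m)) in *.
destruct (lasota_yorke n0) as [Cn [HCn HLY]].
assert (HM : 0 < M) by (pose proof (hle 0); lra).
(* The solution of [k C + Cn M = C], stable under repetition of the step. *)
set (C := Cn * M / (1 - k)).
assert (HC0 : 0 <= C).
{ apply Rmult_le_pos; [apply Rmult_le_pos; lra | left; apply Rinv_0_lt_compat; lra]. }
assert (HC : k * C + Cn * M = C) by (unfold C; field; lra).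
assert (Hk0 : 0 <= k) by (unfold k; apply Rmult_le_pos; lra).
assert (Hstep : forall u A w, hol alpha A u -> (forall t, 0 <= u t <= w * h t) ->
   hol alpha (k * A + Cn * M * w) (Nat.iter n0 L u)).
{ intros u A w Hu Hw s t.
  assert (Hw0 : 0 <= w) by (specialize (Hw 0); specialize (hle 0); nra).
  eapply Rle_trans.
  - apply (HLY u A (w * M) Hu). intros x. specialize (Hw x). specialize (hle x).
    rewrite Rabs_pos_eq by lra. nra.
  - apply Rmult_le_compat_r; [left; apply Rpower_pos|].
    pose proof (hol_ge0 _ _ _ Hu) as HA. pose proof (iter_1_le n0 s) as H1.
    assert (th ^ n0 * A * Nat.iter n0 L (fun _ => 1) s <= th ^ n0 * A * (M / m)).
    { apply Rmult_le_compat_l; [apply Rmult_le_pos; lra | exact H1]. }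
    unfold k. lra. }
exists n0, k, C. repeat split; try assumption.
- destruct n0; [|lia]. exfalso. unfold k in Hk. simpl in Hk. lra.
- intros u A w j Hu Hw Hj.
  assert (Hw0 : 0 <= w) by (specialize (Hw 0); specialize (hle 0); nra).
  pose proof (hol_ge0 _ _ _ Hu) as HA.
  induction j as [|j IH]; [lia|].
  destruct j as [|j].
  + rewrite Nat.mul_1_l. eapply hol_weaken. { now apply Hstep with (w := w). }
    assert (Cn * M <= C) by nra. nra.
  + replace (S (S j) * n0)%nat with (n0 + S j * n0)%nat by lia.
    rewrite Nat.iter_add. eapply hol_weaken.
    { apply Hstep. apply IH; lia. apply iter_between. exact Hw. }
    assert (0 <= k * A) by (apply Rmult_le_pos; lra).
    assert (k * (k * A) <= k * A) by nra.
    assert (k * C * w + Cn * M * w = C * w) by (rewrite <- HC at 2; ring).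
    lra.
Qed.

(** A truncated cosine is periodic by construction, lives on the arc of radius [del] about [p], and
    has a Hoelder constant independent of [del] and [p]. *)
Definition bump (del p t : R) : R := Rmax 0 (cos (2 * PI * (t - p)) - cos (2 * PI * del)).

Lemma bump_per (del p : R) : per (bump del p).
Proof. intros t. unfold bump. now rewrite (cos_per p t). Qed.

Lemma bump_hol (del p : R) : hol alpha (2 * PI + 2) (bump del p).
Proof.
intros s t. eapply Rle_trans; [|apply (cos_hol p)]. unfold bump.
set (x := cos (2 * PI * (s - p))). set (y := cos (2 * PI * (t - p))). set (z := cos (2 * PI * del)).
unfold Rmax. repeat destruct Rle_dec; unfold Rabs; repeat destruct Rcase_abs; lra.
Qed.

Lemma bump_ge0 (del p t : R) : 0 <= bump del p t.
Proof. apply Rmax_l. Qed.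

Lemma bump_le2 (del p t : R) : bump del p t <= 2.
Proof.
unfold bump. pose proof (COS_bound (2 * PI * (t - p))). pose proof (COS_bound (2 * PI * del)).
apply Rmax_lub; lra.
Qed.

Lemma bump_center (del p : R) : 0 < del < / 2 -> 0 < bump del p p.
Proof.
intros H. unfold bump. rewrite Rminus_diag, Rmult_0_r, cos_0.
eapply Rlt_le_trans; [|apply Rmax_r]. pose proof PI_RGT_0.
assert (cos (2 * PI * del) < cos 0) by (apply cos_decreasing_1; nra).
rewrite cos_0 in *. lra.
Qed.

Lemma bump_support (del p t : R) : 0 < del < / 2 -> 0 < bump del p t ->
  exists k, Rabs (t + IZR k - p) < del.
Proof.
intros H Hb. pose proof PI_RGT_0 as HPI.
assert (Hc : cos (2 * PI * del) < cos (2 * PI * (t - p))).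
{ unfold bump, Rmax in Hb. destruct Rle_dec; lra. }
(* The shift by one half selects the representative of [t - p] in [[-1/2, 1/2)], where the cosine is
   monotone in the absolute value. *)
destruct (base_Int_part (t - p + / 2)) as [H1 H2].
exists (- Int_part (t - p + / 2))%Z. rewrite opp_IZR.
set (k := IZR (Int_part (t - p + / 2))) in *.
set (x := t + - k - p). assert (Hx : - / 2 <= x < / 2) by (unfold x; lra).
assert (Hcx : cos (2 * PI * (t - p)) = cos (2 * PI * Rabs x)).
{ transitivity (cos (2 * PI * x)).
  - pose proof (per_Z _ (Int_part (t - p + / 2)) x (cos_per 0)) as E. simpl in E. fold k in E.
    replace (2 * PI * x) with (2 * PI * (x - 0)) by ring. rewrite <- E. f_equal. unfold x. ring.
  - unfold Rabs. destruct Rcase_abs; [|reflexivity].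
    rewrite <- cos_neg. f_equal. ring. }
rewrite Hcx in Hc. apply Rnot_le_lt. intros Hle. apply (Rlt_not_le _ _ Hc).
assert (Rabs x <= / 2) by (apply Rabs_le; lra).
apply cos_decr_1; nra.
Qed.

(** A positive lower bound reached at time [N] is turned into a multiple of [h], and fixedness of
    [h] preserves it at all later times. *)
Lemma eventually_ge_fix (b : R -> R) (A : R) : per b -> hol alpha A b ->
  (forall t, 0 <= b t) -> (exists t, 0 < b t) ->
  exists N c, 0 < c /\ forall n, (N <= n)%nat -> forall t, c * h t <= Nat.iter n L b t.
Proof.
intros Hp Hh H0 Ht. destruct (KR b A Hp Hh H0 Ht) as [N HN].
destruct (iter_hol N b A Hp Hh) as [A' HA'].
destruct (per_hol_min alpha A' (Nat.iter N L b)) as [x Hx]; [lra|now apply iter_per|exact HA'|].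
specialize (HN x). set (y := Nat.iter N L b x) in *.
assert (HM : 0 < M) by (pose proof (hle 0); lra).
exists N, (y / M). split; [now apply Rdiv_lt_0_compat|].
intros n Hn t. replace n with ((n - N) + N)%nat by lia. rewrite Nat.iter_add.
pose proof (iter_le (n - N) (fun s => y / M * h s) (Nat.iter N L b)) as H.
rewrite iter_scal, iter_fix in H. apply H. intros s. eapply Rle_trans; [|apply Hx].
apply Rle_trans with (y / M * M).
- apply Rmult_le_compat_l; [left; now apply Rdiv_lt_0_compat | apply hle].
- right. unfold y. field. lra.
Qed.

Lemma eventually_ge_fix_unif (A : R) : 0 <= A ->
  exists N c, 0 < c /\ forall u, per u -> hol alpha A u -> (forall t, 0 <= u t) ->
    (exists t0, h t0 / 2 <= u t0) ->
    forall n, (N <= n)%nat -> forall t, c * h t <= Nat.iter n L u t.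
Proof.
intros HA.
destruct (Rpower_small alpha (m / 4 / (A + 1))) as [d1 [Hd1 Hs]].
{ lra. } { apply Rdiv_lt_0_compat; lra. }
(* A point of the bump's support is within [del] of the grid point, which is within [del] of the
   given point; hence [2 * del <= d1]. The [/ 4] keeps [del] below one half. *)
set (del := Rmin (d1 / 2) (/ 4)).
assert (Hdel : 0 < del < / 2 /\ 2 * del <= d1).
{ unfold del. pose proof (Rmin_l (d1 / 2) (/ 4)). pose proof (Rmin_r (d1 / 2) (/ 4)).
  repeat split; try lra. apply Rmin_glb_lt; lra. }
destruct (INR_unbounded (/ del)) as [K HK].
assert (HK0 : 0 < INR K) by (apply Rlt_trans with (/ del); [apply Rinv_0_lt_compat; lra | exact HK]).
assert (HKd : / INR K <= del).
{ rewrite <- (Rinv_inv del). apply Rinv_le_contravar; [apply Rinv_0_lt_compat; lra | lra]. }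
assert (HN : exists N c, 0 < c /\ forall j, (j <= K)%nat -> forall n, (N <= n)%nat ->
   forall t, c * h t <= Nat.iter n L (bump del (INR j / INR K)) t).
{ assert (Hj : forall j, exists N c, 0 < c /\ forall n, (N <= n)%nat ->
     forall t, c * h t <= Nat.iter n L (bump del (INR j / INR K)) t).
  { intros j. apply (eventually_ge_fix _ (2 * PI + 2)).
    - apply bump_per. - apply bump_hol. - apply bump_ge0.
    - exists (INR j / INR K). now apply bump_center. }
  (* The induction runs over the number of bumps, while the mesh [/ INR K] stays fixed. *)
  clear HK HK0 HKd. generalize K at 1 as J. intros J. induction J as [|J [N [c [Hc H]]]].
  - destruct (Hj 0%nat) as [N [c [Hc H]]]. exists N, c. split; [exact Hc|].
    intros j Hj0. replace j with 0%nat by lia. exact H.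
  - destruct (Hj (S J)) as [N' [c' [Hc' H']]].
    exists (Nat.max N N'), (Rmin c c'). split; [now apply Rmin_glb_lt|].
    intros j Hj0 n Hn t. specialize (hle t).
    destruct (Nat.eq_dec j (S J)) as [->|E].
    + eapply Rle_trans; [|apply H'; lia]. apply Rmult_le_compat_r; [lra|apply Rmin_r].
    + eapply Rle_trans; [|apply H; lia]. apply Rmult_le_compat_r; [lra|apply Rmin_l]. }
destruct HN as [N [c [Hc HN]]].
exists N, (m / 8 * c). split; [apply Rmult_lt_0_compat; lra|].
intros u Hp Hu H0 [t0 Ht0] n Hn t.
destruct (per_frac u t0 Hp) as [t1 [Ht1 [Hut _]]].
destruct (nfloor_ex (t1 * INR K)) as [j [Hj1 Hj2]]; [nra|].
assert (HjK : (j <= K)%nat) by (apply INR_le; nra).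
specialize (HN j HjK n Hn t).
(* Near the point [u] drops from [m / 2] to no less than [m / 4], and a bump is at most 2. *)
assert (Hge : forall s, m / 8 * bump del (INR j / INR K) s <= u s).
{ intros s. destruct (Rle_dec (bump del (INR j / INR K) s) 0) as [Hz|Hnz].
  - specialize (H0 s). nra.
  - destruct (bump_support del (INR j / INR K) s) as [k Hk]; [lra|lra|].
    rewrite <- (per_Z u k s Hp). set (s' := s + IZR k) in *.
    assert (Hd2 : Rabs (t1 - INR j / INR K) <= del).
    { assert (Hq : INR j / INR K * INR K = INR j) by (field; lra).
      assert (/ INR K * INR K = 1) by (field; lra).
      rewrite Rabs_pos_eq. nra. nra. }
    assert (Hd3 : Rabs (s' - t1) < 2 * del).
    { replace (s' - t1) with ((s' - INR j / INR K) - (t1 - INR j / INR K)) by ring.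
      eapply Rle_lt_trans; [apply Rabs_triang|]. rewrite Rabs_Ropp. lra. }
    assert (Hus : m / 4 <= u s').
    { destruct (Req_dec s' t1) as [->|E]. { specialize (hle t0). lra. }
      specialize (Hu s' t1). pose proof (Rle_abs (- (u s' - u t1))) as H1. rewrite Rabs_Ropp in H1.
      assert (H2 : Rpower (Rabs (s' - t1)) alpha < m / 4 / (A + 1)).
      { apply Hs; [apply Rabs_pos_lt; lra | lra]. }
      assert (m / 4 / (A + 1) * (A + 1) = m / 4) by (field; lra).
      pose proof (Rpower_pos (Rabs (s' - t1)) alpha).
      specialize (hle t0). nra. }
    pose proof (bump_le2 del (INR j / INR K) s). nra. }
pose proof (iter_le n _ _ Hge t) as H1. rewrite iter_scal in H1. simpl in H1. nra.
Qed.

(** The Hoelder constant and the width are coupled by the fixed ratio [K], so that the class of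
    admissible functions is mapped into itself with [w] replaced by [lam * w] and the step can be
    repeated. *)
Lemma contraction_step : exists N K lam, (1 <= N)%nat /\ 0 < K /\ 0 < lam < 1 /\
  forall u w, per u -> hol alpha (K * w) u -> (forall t, 0 <= u t <= w * h t) ->
  exists a, hol alpha (K * (lam * w)) (fun t => Nat.iter N L u t - a * h t) /\
    forall t, 0 <= Nat.iter N L u t - a * h t <= lam * w * h t.
Proof.
destruct lasota_yorke_unif as [n0 [k [C [Hn0 [Hk [HC HLY]]]]]].
pose proof (hol_ge0 _ _ _ hhol) as HAh.
(* Large enough that the additive terms [C] and [Ah], the latter from subtracting a multiple of [h],
   leave a factor [(1 + k) / 2 < 1]. *)
set (K := 2 * (C + Ah + 1) / (1 - k)).
assert (HK : 0 < K) by (apply Rdiv_lt_0_compat; lra).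
assert (HK1 : k * K + C + Ah <= (1 + k) / 2 * K).
{ assert (K * (1 - k) = 2 * (C + Ah + 1)) by (unfold K; field; lra). lra. }
destruct (eventually_ge_fix_unif K) as [N0 [c0 [Hc0 HD]]]; [lra|].
(* With [c <= 1/2] one has [lam >= 1/2], which also covers the case where the upper bound is
   halved. *)
set (c := Rmin c0 (/ 2)).
assert (Hc : 0 < c <= / 2 /\ c <= c0).
{ unfold c. repeat split; [apply Rmin_glb_lt; lra | apply Rmin_r | apply Rmin_l]. }
set (lam := Rmax (1 - c) ((1 + k) / 2)).
assert (Hlam : / 2 <= lam < 1 /\ 1 - c <= lam /\ (1 + k) / 2 <= lam).
{ unfold lam. pose proof (Rmax_l (1 - c) ((1 + k) / 2)). pose proof (Rmax_r (1 - c) ((1 + k) / 2)).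
  repeat split; try lra. apply Rmax_lub_lt; lra. }
(* A positive multiple of [n0], as [lasota_yorke_unif] requires, and at least [N0]. *)
set (N := (S N0 * n0)%nat). assert (HNN : (N0 <= N)%nat) by (unfold N; nia).
exists N, K, lam. split; [unfold N; nia|]. split; [exact HK|]. split; [lra|].
intros u w Hp Hu Hb.
assert (Hw : 0 <= w) by (specialize (Hb 0); specialize (hle 0); nra).
assert (Hhol : hol alpha (k * (K * w) + C * w) (Nat.iter N L u)) by (apply HLY; [exact Hu|exact Hb|lia]).
assert (HKw : (k * K + C + Ah) * w <= (1 + k) / 2 * K * w) by (apply Rmult_le_compat_r; assumption).
assert (HKl : (1 + k) / 2 * (K * w) <= lam * (K * w)).
{ apply Rmult_le_compat_r; [apply Rmult_le_pos; lra | lra]. }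
(* The first case divides by [w]; the degenerate width 0 goes to the second. *)
destruct (classic (exists t0, w * h t0 / 2 <= u t0 /\ 0 < w)) as [[t0 [Ht0 Hw1]]|Hno].
- exists (c * w). split.
  + apply (hol_ext alpha _ (fun t => 1 * Nat.iter N L u t + (- (c * w)) * h t)). { intros; ring. }
    eapply hol_weaken. { apply hol_lin; [exact Hhol|exact hhol]. }
    rewrite Rabs_R1, Rabs_Ropp, (Rabs_pos_eq (c * w)) by (apply Rmult_le_pos; lra).
    assert (c * w * Ah <= w * Ah) by (apply Rmult_le_compat_r; nra). lra.
  + intros t. pose proof (iter_between N w u Hb t) as [_ H1].
    assert (Hiw : 0 < / w) by now apply Rinv_0_lt_compat.
    assert (H2 : c0 * h t <= Nat.iter N L (fun t => / w * u t) t).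
    { apply HD; [| | | |exact HNN].
      - intros s. now rewrite Hp.
      - eapply hol_weaken. { apply hol_scal. exact Hu. }
        rewrite Rabs_pos_eq by lra. right. field. lra.
      - intros s. apply Rmult_le_pos; [lra|apply Hb].
      - exists t0. apply Rmult_le_reg_l with w; [exact Hw1|].
        rewrite <- Rmult_assoc, Rinv_r; lra. }
    rewrite iter_scal in H2.
    assert (H3 : w * (c0 * h t) <= w * (/ w * Nat.iter N L u t)) by (apply Rmult_le_compat_l; lra).
    rewrite <- (Rmult_assoc w (/ w)), Rinv_r, Rmult_1_l in H3 by lra.
    specialize (hle t).
    assert (0 <= w * h t) by (apply Rmult_le_pos; lra).
    assert (c * (w * h t) <= c0 * (w * h t)) by (apply Rmult_le_compat_r; lra).
    assert ((1 - c) * (w * h t) <= lam * (w * h t)) by (apply Rmult_le_compat_r; lra).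
    lra.
- assert (Hhalf : forall t, 0 <= u t <= w / 2 * h t).
  { intros t. specialize (Hb t). split; [lra|]. apply Rnot_lt_le. intros Hlt.
    destruct (Req_dec w 0) as [E|E]. { rewrite E in *. lra. }
    apply Hno. exists t. lra. }
  exists 0. split.
  + apply (hol_ext alpha _ (Nat.iter N L u)). { intros; ring. }
    eapply hol_weaken; [exact Hhol|].
    assert (0 <= Ah * w) by now apply Rmult_le_pos. lra.
  + intros t. pose proof (iter_between N (w / 2) u Hhalf t) as H1. specialize (hle t).
    assert (/ 2 * (w * h t) <= lam * (w * h t)).
    { apply Rmult_le_compat_r; [apply Rmult_le_pos; lra|lra]. }
    lra.
Qed.

(** Extends [contraction_step] from functions between 0 and [w * h] to arbitrary ones, by adding a
    multiple of [h], and from multiples of [N] to all exponents, by applying the leftover iterates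
    last. *)
Lemma decay : exists rho C, 0 < rho < 1 /\ 0 <= C /\
  forall u A B n, per u -> hol alpha A u -> (forall t, Rabs (u t) <= B) ->
  exists a, hol alpha (C * rho ^ n * (A + B)) (fun t => Nat.iter n L u t - a * h t) /\
    forall t, Rabs (Nat.iter n L u t - a * h t) <= C * rho ^ n * (A + B).
Proof.
destruct contraction_step as [N [K [lam [HN [HK [Hlam Hstep]]]]]].
assert (Hiter : forall u w, per u -> hol alpha (K * w) u -> (forall t, 0 <= u t <= w * h t) ->
  forall j, exists a, hol alpha (K * (lam ^ j * w)) (fun t => Nat.iter (j * N) L u t - a * h t) /\
    forall t, 0 <= Nat.iter (j * N) L u t - a * h t <= lam ^ j * w * h t).
{ intros u w Hp Hu Hb j. induction j as [|j [a [IH1 IH2]]].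
  - exists 0. simpl. split.
    + apply (hol_ext alpha _ u); [intros; ring|]. now rewrite Rmult_1_l.
    + intros t. specialize (Hb t). lra.
  - destruct (Hstep (fun t => Nat.iter (j * N) L u t - a * h t) (lam ^ j * w)) as [a' [H1 H2]].
    + intros t. rewrite hper. now rewrite (iter_per (j * N) u Hp t).
    + exact IH1.
    + exact IH2.
    + exists (a + a'). simpl (S j * N)%nat. rewrite iter_sub_fix, <- Nat.iter_add in H1, H2.
      split.
      * apply (hol_ext alpha _ (fun t => Nat.iter (N + j * N) L u t - a * h t - a' * h t)); [intros; ring|].
        simpl (lam ^ S j). rewrite Rmult_assoc. exact H1.
      * intros t. specialize (H2 t). simpl (lam ^ S j). lra. }
(* Fewer than [N] iterates remain after the whole blocks; the sum of their constants serves for all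
   of them. *)
assert (HCm : exists Cm, 0 <= Cm /\ forall i, (i < N)%nat -> forall u A B, hol alpha A u ->
   (forall t, Rabs (u t) <= B) -> forall s t, Rabs (Nat.iter i L u s - Nat.iter i L u t) <=
    (th ^ i * A * Nat.iter i L (fun _ => 1) s + Cm * B) * Rpower (Rabs (s - t)) alpha).
{ clear HN Hstep Hiter. induction N as [|N [Cm [HCm IH]]].
  - exists 0. split; [lra|]. intros; lia.
  - destruct (lasota_yorke N) as [Cn [HCn H]]. exists (Cm + Cn). split; [lra|].
    intros i Hi u A B Hu HB s t.
    assert (0 <= B) by (pose proof (HB 0); pose proof (Rabs_pos (u 0)); lra).
    destruct (Nat.eq_dec i N) as [->|E].
    + eapply Rle_trans. now apply H. apply Rmult_le_compat_r; [left; apply Rpower_pos|]. nra.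
    + eapply Rle_trans. { apply IH; [lia|exact Hu|exact HB]. }
      apply Rmult_le_compat_r; [left; apply Rpower_pos|]. nra. }
destruct HCm as [Cm [HCm HLY]].
pose proof M_over_m as HMm. assert (HM : 0 < M) by (pose proof (hle 0); lra).
pose proof (hol_ge0 _ _ _ hhol) as HAh.
assert (HNR : 0 < INR N) by (apply lt_0_INR; lia).
(* The rate per single iterate: [rho ^ N = lam]. *)
set (rho := Rpower lam (/ INR N)).
assert (HrN : rho ^ N = lam).
{ unfold rho. rewrite <- Rpower_pow by apply Rpower_pos. rewrite Rpower_mult, Rinv_l by lra.
  apply Rpower_1. lra. }
assert (Hrho : 0 < rho < 1).
{ split; [apply Rpower_pos|]. apply Rnot_le_lt. intros H.
  pose proof (pow_R1_Rle rho N H). lra. }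
set (D := 2 / m + (1 + Ah / m) / K).
assert (Him : 0 < / m) by now apply Rinv_0_lt_compat.
assert (HiK : 0 < / K) by now apply Rinv_0_lt_compat.
assert (HAm : 0 <= Ah / m) by (apply Rmult_le_pos; lra).
assert (HD : 0 <= D).
{ unfold D. apply Rplus_le_le_0_compat; apply Rmult_le_pos; lra. }
(* The first two terms bound the Hoelder constant after the leftover iterates, the last one bounds
   the supremum. *)
set (Q := K * (M / m) + Cm * M + M).
assert (HQ : 0 <= Q) by (unfold Q; repeat apply Rplus_le_le_0_compat; try apply Rmult_le_pos; lra).
exists rho, (Q * D / lam). split; [exact Hrho|]. split.
{ apply Rmult_le_pos; [now apply Rmult_le_pos | left; apply Rinv_0_lt_compat; lra]. }
intros u A B n Hp Hu HB.
pose proof (hol_ge0 _ _ _ Hu) as HA.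
assert (HB0 : 0 <= B) by (pose proof (HB 0); pose proof (Rabs_pos (u 0)); lra).
(* Adding [B / m * h >= B] makes [u] nonnegative; the double sign matches [iter_sub_fix]. *)
set (u0 := fun t => u t - (- (B / m)) * h t).
assert (HBm : 0 <= B / m) by (apply Rmult_le_pos; lra).
assert (HBm1 : B / m * m = B) by (field; lra).
(* The first term ensures [u0 <= w * h], the second that [K * w] is a Hoelder constant of [u0]. *)
set (w := 2 * B / m + (A + B / m * Ah) / K).
assert (Hw0 : 0 <= w).
{ unfold w. repeat (apply Rplus_le_le_0_compat || apply Rmult_le_pos); lra. }
destruct (Hiter u0 w) with (j := (n / N)%nat) as [a [Ha1 Ha2]].
{ intros t. unfold u0. now rewrite Hp, hper. }
{ apply (hol_ext alpha _ (fun t => 1 * u t + B / m * h t)). { intros; unfold u0; ring. }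
  eapply hol_weaken. { apply hol_lin; [exact Hu|exact hhol]. }
  rewrite Rabs_R1, Rabs_pos_eq by exact HBm.
  replace (K * w) with (K * (2 * B / m) + (A + B / m * Ah)) by (unfold w; field; lra).
  assert (0 <= K * (2 * B / m)) by (repeat apply Rmult_le_pos; lra). lra. }
{ intros t. unfold u0. specialize (HB t). specialize (hle t).
  pose proof (Rle_abs (u t)). pose proof (Rle_abs (- u t)) as H1. rewrite Rabs_Ropp in H1.
  assert (HBh : B <= B / m * h t).
  { rewrite <- HBm1 at 1. apply Rmult_le_compat_l; lra. }
  split; [lra|].
  assert (2 * B / m * h t <= w * h t).
  { apply Rmult_le_compat_r; [lra|]. unfold w.
    assert (0 <= (A + B / m * Ah) / K); [|lra].
    apply Rmult_le_pos; [|lra]. apply Rplus_le_le_0_compat; [lra|now apply Rmult_le_pos]. }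
  replace (2 * B / m * h t) with (B / m * h t + B / m * h t) in * by (field; lra). lra. }
set (j := (n / N)%nat) in *. set (i := (n mod N)%nat).
assert (Hn : n = (i + j * N)%nat).
{ unfold i, j. rewrite (Nat.div_mod n N) at 1 by lia. lia. }
assert (Hi : (i < N)%nat) by (apply Nat.mod_upper_bound; lia).
set (v := fun t => Nat.iter (j * N) L u0 t - a * h t) in *.
assert (Hv : Nat.iter i L v = fun t => Nat.iter n L u t - (a - B / m) * h t).
{ unfold v. rewrite iter_sub_fix, <- Nat.iter_add, <- Hn. unfold u0. rewrite iter_sub_fix.
  apply functional_extensionality; intros; ring. }
assert (Hlj : 0 < lam ^ j) by (apply pow_lt; lra).
(* Rounding [n] down to a multiple of [N] loses at most one factor [rho ^ N = lam]. *)
assert (Hlr : lam ^ j <= rho ^ n / lam).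
{ apply Rmult_le_reg_r with lam; [lra|]. unfold Rdiv. rewrite Rmult_assoc, Rinv_l, Rmult_1_r by lra.
  rewrite Hn, pow_add, Nat.mul_comm, pow_mult, HrN, Rmult_comm.
  apply Rmult_le_compat_r; [lra|]. rewrite <- HrN.
  replace N with (i + (N - i))%nat by lia. rewrite pow_add.
  assert (0 < rho ^ i) by (apply pow_lt; lra).
  assert (rho ^ (N - i) <= 1).
  { rewrite <- (pow1 (N - i)). apply pow_incr. lra. }
  nra. }
assert (Hw : w <= D * (A + B)).
{ unfold w, D. assert (E : B / m * Ah = Ah / m * B) by (field; lra). rewrite E.
  assert (2 * B / m <= 2 / m * (A + B)).
  { unfold Rdiv. nra. }
  assert ((A + Ah / m * B) / K <= (1 + Ah / m) / K * (A + B)).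
  { unfold Rdiv at 1 3. replace ((1 + Ah / m) * / K * (A + B)) with ((1 + Ah / m) * (A + B) * / K) by ring.
    apply Rmult_le_compat_r; [lra|]. nra. }
  lra. }
assert (Hfin : lam ^ j * w * Q <= Q * D / lam * rho ^ n * (A + B)).
{ apply Rle_trans with (rho ^ n / lam * (D * (A + B)) * Q).
  - apply Rmult_le_compat_r; [exact HQ|]. apply Rmult_le_compat; lra.
  - right. field. lra. }
assert (Hljw : 0 <= lam ^ j * w) by (apply Rmult_le_pos; lra).
assert (Hmul : forall x y, x <= y -> lam ^ j * w * x <= lam ^ j * w * y).
{ intros x y Hxy. now apply Rmult_le_compat_l. }
assert (HQ1 : 0 <= K * (M / m)) by (apply Rmult_le_pos; lra).
assert (HQ2 : 0 <= Cm * M) by (apply Rmult_le_pos; lra).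
exists (a - B / m). rewrite <- Hv. split.
- intros s t. eapply Rle_trans.
  + apply (HLY i Hi v (K * (lam ^ j * w)) (lam ^ j * w * M) Ha1).
    intros x. specialize (Ha2 x). specialize (hle x). fold (v x) in Ha2.
    rewrite Rabs_pos_eq by lra. assert (lam ^ j * w * h x <= lam ^ j * w * M) by now apply Hmul. lra.
  + apply Rmult_le_compat_r; [left; apply Rpower_pos|].
    eapply Rle_trans; [|exact Hfin].
    assert (H1 : th ^ i * Nat.iter i L (fun _ => 1) s <= M / m).
    { pose proof th_lt1. pose proof (iter_1_le i s).
      assert (0 <= Nat.iter i L (fun _ => 1) s) by (apply iter_ge0; intros; lra).
      assert (th ^ i <= 1) by (rewrite <- (pow1 i); apply pow_incr; lra).
      assert (0 < th ^ i) by (apply pow_lt; lra). nra. }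
    apply Rle_trans with (lam ^ j * w * (K * (th ^ i * Nat.iter i L (fun _ => 1) s) + Cm * M)).
    { right. ring. }
    apply Hmul. unfold Q. assert (K * (th ^ i * Nat.iter i L (fun _ => 1) s) <= K * (M / m)) by
      (apply Rmult_le_compat_l; lra). lra.
- intros t. pose proof (iter_between i (lam ^ j * w) v Ha2 t) as H1.
  rewrite Hv in H1. cbv beta in H1. rewrite Rabs_pos_eq by lra.
  eapply Rle_trans; [apply H1|]. eapply Rle_trans; [|exact Hfin]. apply Hmul.
  specialize (hle t). unfold Q. lra.
Qed.

(** The coefficient [a] in [decay] varies with [n]. Applying [L - 1], which annihilates [h], removes
    it and leaves summable increments. *)
Lemma increments_decay : exists rho C, 0 < rho < 1 /\ 0 <= C /\
  forall u A B n, per u -> hol alpha A u -> (forall t, Rabs (u t) <= B) ->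
  hol alpha (C * rho ^ n * (A + B)) (fun t => Nat.iter (S n) L u t - Nat.iter n L u t) /\
    forall t, Rabs (Nat.iter (S n) L u t - Nat.iter n L u t) <= C * rho ^ n * (A + B).
Proof.
destruct decay as [rho [C [Hrho [HC H]]]].
destruct (lasota_yorke 1) as [C1 [HC1 HLY]].
assert (HFB : 0 <= FB) by (specialize (F0 0); specialize (F1 0); lra).
exists rho, ((FB + C1 + 1) * C). split; [exact Hrho|]. split; [apply Rmult_le_pos; lra|].
intros u A B n Hp Hu HB. destruct (H u A B n Hp Hu HB) as [a [H1 H2]].
set (e := fun t => Nat.iter n L u t - a * h t) in *.
set (E := C * rho ^ n * (A + B)) in *.
assert (HE : forall t, Nat.iter (S n) L u t - Nat.iter n L u t = L e t - e t).
{ intros t. pose proof (iter_sub_fix 1 a (Nat.iter n L u)) as H3. simpl in H3.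
  unfold e. rewrite H3. simpl. ring. }
assert (HE0 : 0 <= E) by apply (hol_ge0 _ _ _ H1).
replace ((FB + C1 + 1) * C * rho ^ n * (A + B)) with ((FB + C1) * E + E) by (unfold E; ring).
split.
- intros s t. rewrite !HE. pose proof (HLY e E E H1 H2 s t) as H3. specialize (H1 s t).
  simpl in H3.
  replace (L e s - e s - (L e t - e t)) with ((L e s - L e t) - (e s - e t)) by ring.
  eapply Rle_trans; [apply Rabs_triang|]. rewrite Rabs_Ropp, Rmult_plus_distr_r.
  apply Rplus_le_compat; [|exact H1]. eapply Rle_trans; [exact H3|].
  apply Rmult_le_compat_r; [left; apply Rpower_pos|].
  pose proof th_lt1. assert (HL : 0 <= L (fun _ => 1) s <= FB).
  { split. apply (iter_ge0 1); intros; lra. eapply Rle_trans; [apply Rle_abs|].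
    rewrite <- (Rmult_1_r FB). apply rop_abs_le. intros; rewrite Rabs_R1; lra. }
  rewrite Rmult_1_r.
  assert (E * (th * L (fun _ => 1) s) <= E * FB) by (apply Rmult_le_compat_l; nra). lra.
- intros t. rewrite HE. unfold Rminus. eapply Rle_trans; [apply Rabs_triang|].
  rewrite Rabs_Ropp. apply Rplus_le_compat; [|apply H2].
  eapply Rle_trans; [apply rop_abs_le; exact H2|]. nra.
Qed.

End Contraction.

End RealOperator.

(** * Identities in modules *)

Section LinearCombinations.
Context {K : Ring} {V : ModuleSpace K}.

(** Syntax for proof by reflection: normalising both sides to coefficient lists over a common list
    of atoms reduces a vector identity to scalar ones. *)
Inductive mexp : Type :=
  | MAtom (i : nat)
  | MZero
  | MPlus (a b : mexp)
  | MOpp (a : mexp)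
  | MScal (c : K) (a : mexp).

Fixpoint meval (vs : list V) (e : mexp) : V :=
  match e with
  | MAtom i => nth i vs zero
  | MZero => zero
  | MPlus a b => plus (meval vs a) (meval vs b)
  | MOpp a => opp (meval vs a)
  | MScal c a => scal c (meval vs a)
  end.

Fixpoint ladd (p q : list K) : list K :=
  match p, q with
  | nil, _ => q
  | _, nil => p
  | x :: p', y :: q' => plus x y :: ladd p' q'
  end.

Fixpoint mnorm (e : mexp) : list K :=
  match e with
  | MAtom i => repeat zero i ++ one :: nil
  | MZero => nil
  | MPlus a b => ladd (mnorm a) (mnorm b)
  | MOpp a => map opp (mnorm a)
  | MScal c a => map (mult c) (mnorm a)
  end.

Fixpoint lcomb (p : list K) (vs : list V) : V :=
  match p, vs with
  | x :: p', v :: vs' => plus (scal x v) (lcomb p' vs')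
  | _, _ => zero
  end.

(** Normal forms may differ in length, so missing coefficients count as zero. As a recursive
    proposition it unfolds under [simpl] to a conjunction of scalar equations; the inner [fix] is
    there because the recursion is on [p]. *)
Fixpoint coeffs_eq (p q : list K) : Prop :=
  match p, q with
  | nil, nil => True
  | x :: p', y :: q' => x = y /\ coeffs_eq p' q'
  | x :: p', nil => x = zero /\ coeffs_eq p' nil
  | nil, y :: q' => zero = y /\ (fix leq0 q := match q with nil => True | y :: q' => zero = y /\ leq0 q' end) q'
  end.

Lemma lcomb_ladd (p q : list K) (vs : list V) :
  lcomb (ladd p q) vs = plus (lcomb p vs) (lcomb q vs).
Proof.
revert q vs. induction p as [|x p IH]; intros q vs.
- cbn [lcomb map ladd repeat app nth mnorm meval]. now rewrite plus_zero_l.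
- destruct q as [|y q].
  + cbn [ladd]. destruct vs; cbn [lcomb map ladd repeat app nth mnorm meval]; now rewrite plus_zero_r.
  + destruct vs as [|v vs]; cbn [lcomb map ladd repeat app nth mnorm meval]; [now rewrite plus_zero_r|].
    rewrite IH, scal_distr_r, <- !plus_assoc. f_equal.
    rewrite !plus_assoc. f_equal. apply plus_comm.
Qed.

Lemma lcomb_opp (p : list K) (vs : list V) : lcomb (map opp p) vs = opp (lcomb p vs).
Proof.
revert vs. induction p as [|x p IH]; intros [|v vs]; cbn [lcomb map ladd repeat app nth mnorm meval]; try (symmetry; exact (@opp_zero V)).
rewrite IH, scal_opp_l. symmetry. exact (@opp_plus V _ _).
Qed.

Lemma lcomb_scal (c : K) (p : list K) (vs : list V) :
  lcomb (map (mult c) p) vs = scal c (lcomb p vs).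
Proof.
revert vs. induction p as [|x p IH]; intros [|v vs]; cbn [lcomb map ladd repeat app nth mnorm meval]; try (symmetry; apply scal_zero_r).
now rewrite IH, scal_distr_l, scal_assoc.
Qed.

Lemma lcomb_atom (i : nat) (vs : list V) :
  lcomb (repeat zero i ++ one :: nil) vs = nth i vs zero.
Proof.
revert vs. induction i as [|i IH]; intros [|v vs]; cbn [lcomb map ladd repeat app nth mnorm meval]; try reflexivity.
- destruct vs; now rewrite scal_one, plus_zero_r.
- now rewrite IH, scal_zero_l, plus_zero_l.
Qed.

Lemma meval_norm (vs : list V) (e : mexp) : meval vs e = lcomb (mnorm e) vs.
Proof.
induction e as [i| |a IHa b IHb|a IHa|c a IHa]; cbn [lcomb map ladd repeat app nth mnorm meval].
- symmetry. apply lcomb_atom.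
- destruct vs; reflexivity.
- now rewrite IHa, IHb, lcomb_ladd.
- now rewrite IHa, lcomb_opp.
- now rewrite IHa, lcomb_scal.
Qed.

Lemma lcomb_coeffs_eq_nil (q : list K) (vs : list V) : coeffs_eq nil q -> lcomb q vs = zero.
Proof.
revert vs. induction q as [|y q IH]; intros vs H; [destruct vs; reflexivity|].
destruct vs as [|v vs]; [reflexivity|]. destruct H as [<- H]. cbn [lcomb map ladd repeat app nth mnorm meval].
rewrite scal_zero_l, plus_zero_l. apply IH. destruct q; exact H.
Qed.

Lemma lcomb_coeffs_eq (p q : list K) (vs : list V) : coeffs_eq p q -> lcomb p vs = lcomb q vs.
Proof.
revert q vs. induction p as [|x p IH]; intros q vs H.
- rewrite (lcomb_coeffs_eq_nil q vs H). destruct vs; reflexivity.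
- destruct q as [|y q].
  + destruct H as [-> H]. destruct vs as [|v vs]; [reflexivity|]. cbn [lcomb map ladd repeat app nth mnorm meval].
    rewrite (IH nil vs H), scal_zero_l, plus_zero_l. destruct vs; reflexivity.
  + destruct H as [-> H]. destruct vs as [|v vs]; [reflexivity|]. cbn [lcomb map ladd repeat app nth mnorm meval]. now rewrite (IH q vs H).
Qed.

Lemma meval_eq (vs : list V) (a b : mexp) :
  coeffs_eq (mnorm a) (mnorm b) -> meval vs a = meval vs b.
Proof. intros H. rewrite !meval_norm. now apply lcomb_coeffs_eq. Qed.

End LinearCombinations.

Ltac m_index v vs :=
  match vs with
  | v :: _ => constr:(O)
  | _ :: ?vs' => let i := m_index v vs' in constr:(S i)
  end.

Ltac m_atoms e vs :=
  match e with
  | plus ?a ?b => let vs' := m_atoms a vs in m_atoms b vs'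
  | minus ?a ?b => let vs' := m_atoms a vs in m_atoms b vs'
  | opp ?a => m_atoms a vs
  | scal _ ?a => m_atoms a vs
  | zero => vs
  | ?v => match vs with
          | context [v :: _] => vs
          | _ => constr:(v :: vs)
          end
  end.

Ltac m_reify K e vs :=
  match e with
  | plus ?a ?b => let x := m_reify K a vs in let y := m_reify K b vs in
      constr:(@MPlus K x y)
  | minus ?a ?b => let x := m_reify K a vs in let y := m_reify K b vs in
      constr:(@MPlus K x (@MOpp K y))
  | opp ?a => let x := m_reify K a vs in constr:(@MOpp K x)
  | scal ?c ?a => let x := m_reify K a vs in constr:(@MScal K c x)
  | zero => constr:(@MZero K)
  | ?v => let i := m_index v vs in constr:(@MAtom K i)
  end.

(* Decides equalities between linear combinations in a module over [K],
   leaving the equalities of coefficients as subgoals. *)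
Ltac module_eq K V :=
  match goal with |- @eq _ ?a ?b =>
    let vs := m_atoms a (@nil V) in
    let vs := m_atoms b vs in
    let x := m_reify K a vs in
    let y := m_reify K b vs in
    change (@meval K V vs x = @meval K V vs y);
    apply meval_eq; simpl; repeat split
  end.

Ltac cring := match goal with |- @eq _ ?a ?b => change (@eq C a b) end;
  unfold mult, plus, opp, zero, one; simpl; ring.

(** * Vanishing of a contour integral in a normed space that need not be complete *)

Section RealIntegral.
Context {V : NormedModule R_AbsRing}.

(** The fundamental theorem of calculus for finite sums: each cell errs by at most [K] times mesh
    times length, and no limit in [V] is taken. *)
Lemma Riemann_sum_telescope (f Phi : R -> V) (K : R) :
  (forall x xi y, x <= xi <= y ->
    norm (minus (minus (Phi y) (Phi x)) (scal (y - x) (f xi))) <= K * (y - x) ^ 2) ->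
  0 <= K -> forall ptd : SF_seq, pointed_subdiv ptd ->
  norm (minus (minus (Phi (seq.last (SF_h ptd) (SF_lx ptd))) (Phi (SF_h ptd))) (Riemann_sum f ptd))
   <= K * seq_step (SF_lx ptd) * (seq.last (SF_h ptd) (SF_lx ptd) - SF_h ptd).
Proof.
intros Hf HK ptd. apply (SF_cons_ind (fun ptd => pointed_subdiv ptd ->
  norm (minus (minus (Phi (seq.last (SF_h ptd) (SF_lx ptd))) (Phi (SF_h ptd))) (Riemann_sum f ptd))
   <= K * seq_step (SF_lx ptd) * (seq.last (SF_h ptd) (SF_lx ptd) - SF_h ptd))); clear ptd.
- intros x _. simpl. rewrite Rminus_diag, Rmult_0_r.
  replace (minus (minus (Phi x) (Phi x)) (Riemann_sum f (SF_nil x))) with (zero : V).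
  rewrite norm_zero. lra.
  change (Riemann_sum f (SF_nil x)) with (zero : V). module_eq R_Ring V; rring.
- intros [x xi] s IH Hs. specialize (IH (ptd_cons _ _ Hs)).
  assert (Hx : x <= xi <= SF_h s).
  { assert (H0 : (0 < SF_size (SF_cons (x, xi) s))%nat) by (rewrite SF_size_cons; lia).
    exact (Hs 0%nat H0). }
  rewrite Riemann_sum_cons.
  change (SF_lx (SF_cons (x, xi) s)) with (x :: SF_lx s).
  change (SF_h (SF_cons (x, xi) s)) with x.
  change (fst (x, xi)) with x. change (snd (x, xi)) with xi.
  change (seq.last x (x :: SF_lx s)) with (seq.last (SF_h s) (SF_lx s)).
  set (l := seq.last (SF_h s) (SF_lx s)) in *. set (h := SF_h s) in *.
  change (seq_step (x :: SF_lx s)) with (Rmax (Rabs (h - x)) (seq_step (SF_lx s))).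
  rewrite Rabs_pos_eq by lra. set (st := seq_step (SF_lx s)) in *.
  replace (minus (minus (Phi l) (Phi x)) (plus (scal (h - x) (f xi)) (Riemann_sum f s)))
   with (plus (minus (minus (Phi h) (Phi x)) (scal (h - x) (f xi)))
              (minus (minus (Phi l) (Phi h)) (Riemann_sum f s)))
   by (module_eq R_Ring V; rring).
  eapply Rle_trans; [apply norm_triangle|].
  specialize (Hf x xi h Hx).
  pose proof (Rmax_l (h - x) st). pose proof (Rmax_r (h - x) st).
  set (mx := Rmax (h - x) st) in *.
  assert (Hl : 0 <= l - h).
  { pose proof (ptd_sort _ (ptd_cons _ _ Hs)) as Hsort.
    pose proof (sorted_last (SF_lx s) 0 Hsort ltac:(rewrite SF_size_lx; lia) h) as H1.
    change (h <= l) in H1. lra. }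
  assert (K * (h - x) ^ 2 <= K * (mx * (h - x))) by (apply Rmult_le_compat_l; nra).
  assert (K * (st * (l - h)) <= K * (mx * (l - h))) by (apply Rmult_le_compat_l; nra).
  lra.
Qed.

(* [D] is both the [s]-derivative of [g] and the [x]-derivative of [Phi]. So the [s]-derivative of a
   Riemann sum of [g s] telescopes up to the mesh, and the sum stays close to its value [0] at [s = 0]. *)
Lemma is_RInt_homotopic_zero (a b C1 C2 : R) (g D Phi : R -> R -> V) :
  a <= b -> 0 <= C1 -> 0 <= C2 ->
  (forall s s' x, 0 <= s <= 1 -> 0 <= s' <= 1 ->
    norm (minus (minus (g s' x) (g s x)) (scal (s' - s) (D s x))) <= C1 * (s' - s) ^ 2) ->
  (forall s x xi y, 0 <= s <= 1 -> x <= xi <= y ->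
    norm (minus (minus (Phi s y) (Phi s x)) (scal (y - x) (D s xi))) <= C2 * (y - x) ^ 2) ->
  (forall s, Phi s b = Phi s a) -> (forall x, g 0 x = zero) ->
  is_RInt (g 1) a b zero.
Proof.
intros Hab HC1 HC2 H1 H2 Hper H0.
apply filterlim_locally. intros [eps Heps].
assert (Hd : 0 < eps / (C2 * (b - a) + 1)).
{ apply Rdiv_lt_0_compat; [lra|]. assert (0 <= C2 * (b - a)) by (apply Rmult_le_pos; lra). lra. }
exists (mkposreal _ Hd). intros ptd Hst [Hptd [Hh Hl]]. cbn [pos] in *.
rewrite Rmin_left in Hh by lra. rewrite Rmax_right in Hl by lra.
set (del := seq_step (SF_lx ptd)) in *.
change (del < eps / (C2 * (b - a) + 1)) in Hst.
assert (Hdel : 0 <= del) by apply seq_step_ge_0.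
set (A := fun s => Riemann_sum (g s) ptd : V).
(* The primitive [Phi s] takes equal values at the two ends, so only the telescoping error
   survives. *)
assert (HD : forall s, 0 <= s <= 1 -> norm (Riemann_sum (D s) ptd) <= C2 * del * (b - a)).
{ intros s Hs.
  pose proof (Riemann_sum_telescope (D s) (Phi s) C2 (fun x xi y => H2 s x xi y Hs) HC2 ptd Hptd) as H.
  rewrite Hl, Hh, Hper in H. replace (norm (Riemann_sum (D s) ptd)) with
    (norm (minus (minus (Phi s a) (Phi s a)) (Riemann_sum (D s) ptd))); [exact H|].
  rewrite <- (norm_opp (Riemann_sum (D s) ptd)). apply f_equal.
  module_eq R_Ring V; rring. }
assert (Hstep : forall s s', 0 <= s <= 1 -> 0 <= s' <= 1 ->
  norm (minus (A s') (A s)) <= C1 * (s' - s) ^ 2 * (b - a) + Rabs (s' - s) * (C2 * del * (b - a))).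
{ intros s s' Hs Hs'.
  replace (minus (A s') (A s)) with
    (plus (Riemann_sum (fun x => minus (minus (g s' x) (g s x)) (scal (s' - s) (D s x))) ptd : V)
       (scal (s' - s) (Riemann_sum (D s) ptd : V))).
  2:{ transitivity (plus (minus (minus (A s') (A s)) (scal (s' - s) (Riemann_sum (D s) ptd : V)))
                      (scal (s' - s) (Riemann_sum (D s) ptd : V))); [|module_eq R_Ring V; rring].
      apply (f_equal (fun v : V => plus v (scal (s' - s) (Riemann_sum (D s) ptd : V)))).
      etransitivity; [exact (Riemann_sum_minus (V := V) _ _ ptd)|].
      apply f_equal2; [exact (Riemann_sum_minus (V := V) (g s') (g s) ptd)
                      |exact (Riemann_sum_scal (V := V) _ _ ptd)]. }
  eapply Rle_trans; [apply norm_triangle|]. apply Rplus_le_compat.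
  - eapply Rle_trans.
    + apply (Riemann_sum_norm _ (fun _ => C1 * (s' - s) ^ 2) ptd Hptd). intros x _. now apply H1.
    + rewrite Riemann_sum_const, Hl, Hh. right. unfold scal; simpl. unfold mult; simpl. ring.
  - eapply Rle_trans; [exact (norm_scal (V := V) (s' - s) _)|]. apply Rmult_le_compat_l; [apply Rabs_pos|now apply HD]. }
assert (HA0 : A 0 = zero).
{ unfold A. replace (g 0) with (fun _ : R => zero : V) by (apply functional_extensionality; intros; now rewrite H0).
  rewrite Riemann_sum_const. apply (scal_zero_r (V := V)). }
(* Over [n + 1] equal steps in [s] the quadratic errors add up to [C1 (b - a) / (n + 1)], which is
   negligible, while the linear terms add up to the stated bound. *)
assert (HA1 : norm (A 1) <= C2 * del * (b - a)).
{ assert (Hn : forall n, norm (A 1) <= C1 * (b - a) * / INR (S n) + C2 * del * (b - a)).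
  { intros n. set (q := / INR (S n)).
    assert (HS : 0 < INR (S n)) by (apply lt_0_INR; lia).
    assert (Hq : 0 < q) by now apply Rinv_0_lt_compat.
    assert (HSq : INR (S n) * q = 1) by (unfold q; apply Rinv_r; lra).
    assert (Hj : forall j, (j <= S n)%nat ->
      norm (A (INR j * q)) <= INR j * (C1 * q ^ 2 * (b - a) + q * (C2 * del * (b - a)))).
    { induction j as [|j IH]; intros Hj.
      - simpl. rewrite !Rmult_0_l, HA0, norm_zero. lra.
      - specialize (IH ltac:(lia)).
        assert (Hj0 : 0 <= INR j) by apply pos_INR.
        assert (Hjn : INR (S j) <= INR (S n)) by now apply le_INR.
        assert (Hjq : INR (S j) * q <= 1) by (rewrite <- HSq; apply Rmult_le_compat_r; lra).
        rewrite S_INR in *.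
        assert (Hs := Hstep (INR j * q) ((INR j + 1) * q) ltac:(nra) ltac:(nra)).
        replace ((INR j + 1) * q - INR j * q) with q in Hs by ring.
        rewrite (Rabs_pos_eq q) in Hs by lra.
        replace (A ((INR j + 1) * q)) with
          (plus (minus (A ((INR j + 1) * q)) (A (INR j * q))) (A (INR j * q)))
          by (module_eq R_Ring V; rring).
        eapply Rle_trans; [apply norm_triangle|]. lra. }
    specialize (Hj (S n) (le_n _)). rewrite HSq in Hj.
    eapply Rle_trans; [exact Hj|]. right.
    replace (INR (S n) * (C1 * q ^ 2 * (b - a) + q * (C2 * del * (b - a))))
      with ((INR (S n) * q) * (C1 * q * (b - a) + (C2 * del * (b - a)))) by ring.
    rewrite HSq. ring. }
  apply Rnot_lt_le. intros Hlt.
  set (c := norm (A 1) - C2 * del * (b - a)) in *. assert (Hc : 0 < c) by (unfold c; lra).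
  assert (HCb : 0 <= C1 * (b - a)) by (apply Rmult_le_pos; lra).
  destruct (INR_unbounded (C1 * (b - a) / c)) as [n Hn1].
  specialize (Hn n). assert (HS : INR n < INR (S n)) by (apply lt_INR; lia).
  pose proof (pos_INR n).
  assert (C1 * (b - a) * / INR (S n) < c).
  { apply Rmult_lt_reg_r with (INR (S n)); [lra|]. rewrite Rmult_assoc, Rinv_l, Rmult_1_r by lra.
    assert (C1 * (b - a) / c * c = C1 * (b - a)) by (field; lra). nra. }
  unfold c in *. lra. }
apply norm_compat1.
(* [is_RInt] multiplies its Riemann sums by [sign (b - a)], of absolute value at most 1. *)
apply Rle_lt_trans with (norm (scal (sign (b - a)) (A 1))).
{ right. apply f_equal. unfold A. module_eq R_Ring V; rring. }
eapply Rle_lt_trans; [exact (norm_scal (V := V) (sign (b - a)) (A 1))|].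
assert (Hsg : abs (sign (b - a)) <= 1).
{ unfold abs; simpl. unfold sign. destruct total_order_T as [[?|?]|?];
  unfold Rabs; destruct Rcase_abs; lra. }
pose proof (norm_ge_0 (A 1)).
apply Rle_lt_trans with (norm (A 1)); [nra|].
eapply Rle_lt_trans; [exact HA1|].
assert (HX : 0 <= C2 * (b - a)) by (apply Rmult_le_pos; lra).
assert (eps / (C2 * (b - a) + 1) * (C2 * (b - a) + 1) = eps) by (field; lra).
nra.
Qed.

End RealIntegral.

(** * Power-convergent operators and their Riesz projection *)

Section Operators.
Context {E : NormedModule C_AbsRing}.
Implicit Types (T P Q W : bounded_op E) (u v x : E) (z c : C).

Local Notation add := (@plus (NormedModule.AbelianMonoid C_AbsRing E)).

Local Notation sub := (@minus (NormedModule.AbelianGroup C_AbsRing E)).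
Local Notation smul := (@scal (AbsRing.Ring C_AbsRing) (NormedModule.ModuleSpace C_AbsRing E)).

Lemma bopD T u v : T (add u v) = add (T u) (T v).
Proof. apply (linear_plus _ (bop_linear E T)). Qed.

Lemma bopZ T (a : C_AbsRing) u : T (smul a u) = smul a (T u).
Proof. apply (linear_scal _ (bop_linear E T)). Qed.

Lemma bopN T u : T (opp u) = opp (T u).
Proof. apply (linear_opp _ _ (bop_linear E T)). Qed.

Lemma bop0 T : T zero = zero.
Proof. apply (linear_zero _ (bop_linear E T)). Qed.

Lemma bopB T u v : T (sub u v) = sub (T u) (T v).
Proof. unfold minus. rewrite bopD, bopN. reflexivity. Qed.

Lemma bop_bound T (M : R) u : opnorm E T <= M -> norm (T u) <= M * norm u.
Proof.
intros H. eapply Rle_trans; [apply opnorm_ub|].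
apply Rmult_le_compat_r; [apply norm_ge_0 | exact H].
Qed.

Lemma normD u v : norm (add u v) <= norm u + norm v.
Proof. apply norm_triangle. Qed.

Lemma normB u v : norm (sub u v) <= norm u + norm v.
Proof. unfold minus. eapply Rle_trans; [apply norm_triangle|]. rewrite norm_opp. lra. Qed.

Lemma normBC u v : norm (sub u v) = norm (sub v u).
Proof. rewrite <- norm_opp. apply f_equal. module_eq C_Ring E; cring. Qed.

Lemma norm_as_minus x u v : x = sub u v -> norm x <= norm u + norm v.
Proof. intros ->. apply normB. Qed.

Lemma norm_as_plus x u v : x = add u v -> norm x <= norm u + norm v.
Proof. intros ->. apply normD. Qed.

Lemma normZ (a : C_AbsRing) u : norm (smul a u) <= Cmod a * norm u.
Proof. exact (norm_scal a u). Qed.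

Lemma geom_small (c rho eps : R) : 0 <= rho < 1 -> 0 < eps -> exists n, c * rho ^ n < eps.
Proof.
intros Hr He. pose proof (Rabs_pos c). pose proof (Rle_abs c).
destruct (pow_lt_1_zero rho) with (y := eps / (Rabs c + 1)) as [N HN].
- rewrite Rabs_pos_eq; lra.
- apply Rdiv_lt_0_compat; lra.
- exists N. specialize (HN N (le_n N)). rewrite Rabs_pos_eq in HN by (apply pow_le; lra).
  assert (0 <= rho ^ N) by (apply pow_le; lra).
  assert (eps / (Rabs c + 1) * (Rabs c + 1) = eps) by (field; lra). nra.
Qed.

Lemma norm_geom_eq u v (c rho : R) : 0 <= rho < 1 ->
  (forall n, norm (sub u v) <= c * rho ^ n) -> u = v.
Proof.
intros Hr H. assert (H0 : sub u v = zero).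
{ apply norm_eq_zero. apply Rle_antisym; [|apply norm_ge_0].
  apply Rnot_lt_le. intros Hlt. destruct (geom_small c rho _ Hr Hlt) as [n Hn].
  specialize (H n). lra. }
transitivity (add (sub u v) v); [module_eq C_Ring E; cring|].
rewrite H0. apply plus_zero_l.
Qed.

(** Completeness for geometric sequences only. The stated rate for the limit lets linearity,
    boundedness and operator identities be checked through [norm_geom_eq]. *)
Definition fast_complete (E : NormedModule C_AbsRing) : Prop :=
  forall (u : nat -> E) (D rho : R), 0 <= rho < 1 -> 0 <= D ->
  (forall n, norm (minus (u (S n)) (u n)) <= D * rho ^ n) ->
  exists l, forall n, norm (minus (u n) l) <= D / (1 - rho) * rho ^ n.

Context (HE : fast_complete E).

(** The limit is taken at each vector separately; the rate, proportional to [norm u], makes it a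
    bounded operator and a limit in operator norm. *)
Lemma bop_limit (Sn : nat -> bounded_op E) (D rho : R) : 0 <= rho < 1 -> 0 <= D ->
  (forall n u, norm (sub (Sn (S n) u) (Sn n u)) <= D * rho ^ n * norm u) ->
  exists P, forall n u, norm (sub (Sn n u) (P u)) <= D / (1 - rho) * rho ^ n * norm u.
Proof.
intros Hr HD H.
assert (Hl : forall u, exists l, forall n, norm (sub (Sn n u) l) <= D / (1 - rho) * rho ^ n * norm u).
{ intros u. destruct (HE (fun n => Sn n u) (D * norm u) rho Hr) as [l Hl].
  - apply Rmult_le_pos; [exact HD|apply norm_ge_0].
  - intros n. specialize (H n u). lra.
  - exists l. intros n. specialize (Hl n).
    replace (D / (1 - rho) * rho ^ n * norm u) with (D * norm u / (1 - rho) * rho ^ n)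
      by (field; lra). exact Hl. }
set (p := fun u => proj1_sig (constructive_indefinite_description _ (Hl u))).
assert (Hp : forall u n, norm (sub (Sn n u) (p u)) <= D / (1 - rho) * rho ^ n * norm u)
  by (intros u; exact (proj2_sig (constructive_indefinite_description _ (Hl u)))).
set (B := D / (1 - rho)) in *.
assert (HB : 0 <= B) by (apply Rmult_le_pos; [lra|left; apply Rinv_0_lt_compat; lra]).
assert (Hlin : is_linear p).
{ split.
  - intros u v. apply (norm_geom_eq _ _ (B * (norm (add u v) + norm u + norm v)) rho Hr).
    intros n. pose proof (Hp (add u v) n) as H1. pose proof (Hp u n) as H2. pose proof (Hp v n) as H3.
    rewrite bopD in H1.
    eapply Rle_trans; [apply (norm_as_minus _ (add (sub (Sn n u) (p u)) (sub (Sn n v) (p v)))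
         (sub (add (Sn n u) (Sn n v)) (p (add u v)))); module_eq C_Ring E; cring|]. pose proof (normD (sub (Sn n u) (p u)) (sub (Sn n v) (p v))).
    lra.
  - intros k u. apply (norm_geom_eq _ _ (B * (norm (smul k u) + Cmod k * norm u)) rho Hr).
    intros n. pose proof (Hp (smul k u) n) as H1. pose proof (Hp u n) as H2.
    rewrite bopZ in H1.
    eapply Rle_trans; [apply (norm_as_minus _ (smul k (sub (Sn n u) (p u))) (sub (smul k (Sn n u)) (p (smul k u)))); module_eq C_Ring E; cring|]. pose proof (normZ k (sub (Sn n u) (p u))) as H3.
    assert (Cmod k * norm (sub (Sn n u) (p u)) <= Cmod k * (B * rho ^ n * norm u))
      by (apply Rmult_le_compat_l; [apply Cmod_ge_0 | exact H2]).
    lra.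
  - exists (opnorm E (Sn 0%nat) + B + 1). pose proof (opnorm_ge0 E (Sn 0%nat)). split; [lra|].
    intros u. specialize (Hp u 0%nat). simpl in Hp.
    eapply Rle_trans; [apply (norm_as_minus _ (Sn 0%nat u) (sub (Sn 0%nat u) (p u))); module_eq C_Ring E; cring|]. pose proof (opnorm_ub E (Sn 0%nat) u). pose proof (norm_ge_0 u).
    lra. }
exists (Build_bounded_op E p Hlin). intros n u. apply Hp.
Qed.

Lemma bop_pow_comm T n u : bop_pow E T n (T u) = T (bop_pow E T n u).
Proof. induction n as [|n IH]; [reflexivity|]. simpl. now rewrite IH. Qed.

(** [W] is the sum of the powers of [K]. The constant [D] allows for [K] of norm above 1 whose
    powers still decay. *)
Lemma neumann (K : bounded_op E) (D kappa : R) : 0 <= kappa < 1 -> 0 <= D ->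
  (forall n u, norm (bop_pow E K n u) <= D * kappa ^ n * norm u) ->
  exists W, forall u, W (sub u (K u)) = u /\ sub (W u) (K (W u)) = u.
Proof.
intros Hk HD H.
set (Sn := fix Sn n := match n with O => bop_zero E | S n => bop_plus E (Sn n) (bop_pow E K n) end).
destruct (bop_limit Sn D kappa Hk HD) as [W HW].
{ intros n u. replace (sub (Sn (S n) u) (Sn n u)) with (bop_pow E K n u). apply H.
  simpl. module_eq C_Ring E; cring. }
set (B := D / (1 - kappa)) in *.
assert (HB : 0 <= B) by (apply Rmult_le_pos; [lra|left; apply Rinv_0_lt_compat; lra]).
assert (H1 : forall n u, Sn n (sub u (K u)) = sub u (bop_pow E K n u)).
{ induction n as [|n IH]; intros u; simpl.
  - module_eq C_Ring E; cring.
  - rewrite IH, bopB, bop_pow_comm. module_eq C_Ring E; cring. }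
assert (H2 : forall n u, sub (Sn n u) (K (Sn n u)) = sub u (bop_pow E K n u)).
{ induction n as [|n IH]; intros u; simpl.
  - rewrite bop0. module_eq C_Ring E; cring.
  - rewrite bopD.
    replace (sub (add (Sn n u) (bop_pow E K n u)) (add (K (Sn n u)) (K (bop_pow E K n u))))
     with (add (sub (Sn n u) (K (Sn n u))) (sub (bop_pow E K n u) (K (bop_pow E K n u))))
     by (module_eq C_Ring E; cring).
    rewrite IH. module_eq C_Ring E; cring. }
exists W. intros u. split.
- apply (norm_geom_eq _ _ (B * norm (sub u (K u)) + D * norm u) kappa Hk). intros n.
  specialize (HW n (sub u (K u))). rewrite H1 in HW. specialize (H n u).
  replace (sub (W (sub u (K u))) u) with
    (opp (add (sub (sub u (bop_pow E K n u)) (W (sub u (K u)))) (bop_pow E K n u)))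
    by (module_eq C_Ring E; cring).
  rewrite norm_opp. eapply Rle_trans; [apply normD|]. lra.
- apply (norm_geom_eq _ _ (B * norm u + opnorm E K * (B * norm u) + D * norm u) kappa Hk). intros n.
  specialize (HW n u). specialize (H n u). specialize (H2 n u).
  pose proof (opnorm_ub E K (sub (Sn n u) (W u))) as H3. rewrite bopB in H3.
  pose proof (opnorm_ge0 E K) as H4.
  assert (opnorm E K * norm (sub (Sn n u) (W u)) <= opnorm E K * (B * kappa ^ n * norm u))
    by now apply Rmult_le_compat_l.
  eapply Rle_trans; [apply (norm_as_minus _ (sub (sub (K (Sn n u)) (K (W u))) (sub (Sn n u) (W u)))
      (sub u (sub (Sn n u) (K (Sn n u))))); module_eq C_Ring E; cring|].
  rewrite H2.
  pose proof (normB (sub (K (Sn n u)) (K (W u))) (sub (Sn n u) (W u))).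
  replace (sub u (sub u (bop_pow E K n u))) with (bop_pow E K n u) by (module_eq C_Ring E; cring).
  lra.
Qed.

Section Projection.
Context (T : bounded_op E) (D rho : R) (Hrho : 0 < rho < 1) (HD : 0 <= D).
Context (HT : forall n u, norm (sub (bop_pow E T (S n) u) (bop_pow E T n u)) <= D * rho ^ n * norm u).

(** [T^(n+1) u] approximates both [P u] and [T (P u)], and likewise [P (T u)]. Since [P] keeps every
    fixed vector of [T], idempotence follows. *)
Lemma power_limit : exists P (B : R), 0 <= B /\
  (forall n u, norm (sub (bop_pow E T n u) (P u)) <= B * rho ^ n * norm u) /\
  (forall u, T (P u) = P u) /\ (forall u, P (T u) = P u) /\ (forall u, P (P u) = P u) /\
  (forall u, T u = u -> P u = u).
Proof.
destruct (bop_limit (bop_pow E T) D rho) as [P HP]; [lra|exact HD|exact HT|].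
set (B := D / (1 - rho)) in *.
assert (HB : 0 <= B) by (apply Rmult_le_pos; [lra|left; apply Rinv_0_lt_compat; lra]).
assert (Hfix : forall u, T u = u -> P u = u).
{ intros u Hu. apply (norm_geom_eq _ _ (B * norm u) rho); [lra|]. intros n. specialize (HP n u).
  assert (Hn : bop_pow E T n u = u).
  { clear HP. induction n as [|n IH]; [reflexivity|]. simpl. now rewrite IH. }
  rewrite Hn in HP. rewrite normBC. lra. }
assert (HTP : forall u, T (P u) = P u).
{ intros u. apply (norm_geom_eq _ _ (B * norm u + opnorm E T * (B * norm u)) rho); [lra|]. intros n.
  pose proof (HP n u) as H1. pose proof (HP (S n) u) as H2.
  pose proof (opnorm_ub E T (sub (bop_pow E T n u) (P u))) as H3. rewrite bopB in H3.
  pose proof (opnorm_ge0 E T) as H4.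
  assert (opnorm E T * norm (sub (bop_pow E T n u) (P u)) <= opnorm E T * (B * rho ^ n * norm u))
    by now apply Rmult_le_compat_l.
  simpl in H2.
  eapply Rle_trans; [apply (norm_as_minus _ (sub (T (bop_pow E T n u)) (P u))
    (sub (T (bop_pow E T n u)) (T (P u)))); module_eq C_Ring E; cring|].
  assert (B * (rho * rho ^ n) * norm u <= B * rho ^ n * norm u).
  { pose proof (norm_ge_0 u). assert (0 <= rho ^ n) by (apply pow_le; lra).
    apply Rmult_le_compat_r; [assumption|]. apply Rmult_le_compat_l; [assumption|]. nra. }
  lra. }
assert (HPT : forall u, P (T u) = P u).
{ intros u. apply (norm_geom_eq _ _ (B * norm u + B * norm (T u)) rho); [lra|]. intros n.
  pose proof (HP n (T u)) as H1. pose proof (HP (S n) u) as H2. rewrite bop_pow_comm in H1. simpl in H2.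
  eapply Rle_trans; [apply (norm_as_minus _ (sub (T (bop_pow E T n u)) (P u)) (sub (T (bop_pow E T n u)) (P (T u)))); module_eq C_Ring E; cring|].
  assert (B * (rho * rho ^ n) * norm u <= B * rho ^ n * norm u).
  { pose proof (norm_ge_0 u). assert (0 <= rho ^ n) by (apply pow_le; lra).
    apply Rmult_le_compat_r; [assumption|]. apply Rmult_le_compat_l; [assumption|]. nra. }
  lra. }
exists P, B. repeat split; try assumption.
intros u. apply Hfix, HTP.
Qed.

End Projection.

(** * The regular part of the resolvent *)

Section Spectral.
Context (L P : bounded_op E) (R0 B rho : R) (HR0 : 0 < R0) (Hrho : 0 < rho < 1) (HB : 0 <= B).
Context (HP : forall n u, norm (sub (smul (RtoC (/ R0 ^ n)) (bop_pow E L n u)) (P u)) <= B * rho ^ n * norm u).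
Context (LP : forall u, L (P u) = smul (RtoC R0) (P u)).
Context (PL : forall u, P (L u) = smul (RtoC R0) (P u)).
Context (PP : forall u, P (P u) = P u).

(* [Q] is the value at [z] of the regular part of the resolvent of [L] at [R0]. *)
Definition is_regular_part z (Q : bounded_op E) : Prop :=
  forall u, Q (sub (smul z u) (L u)) = sub u (P u) /\
    sub (smul z (Q u)) (L (Q u)) = sub u (P u) /\ P (Q u) = zero /\ Q (P u) = zero.

Lemma P_pow n u : P (bop_pow E L n u) = smul (RtoC (R0 ^ n)) (P u).
Proof.
induction n as [|n IH]; simpl.
- symmetry. exact (scal_one (P u)).
- rewrite PL, IH, RtoC_mult. module_eq C_Ring E; cring.
Qed.

(** Subtracting [R0 P] removes the eigenvalue: for [n >= 1] the n-th power of [L - R0 P] is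
    [L^n - R0^n P], of size [(rho R0)^n]. So the Neumann series of [K = (L - R0 P) / z] converges
    even at [z = R0], and [Q] is its sum composed with [(1 - P) / z]. *)
Lemma regular_part_exists z : rho * R0 < Cmod z -> exists Q, is_regular_part z Q.
Proof.
intros Hz. assert (Hz0 : 0 < Cmod z) by (assert (0 < rho * R0) by (apply Rmult_lt_0_compat; lra); lra).
assert (Hzn : z <> 0) by (intros ->; rewrite Cmod_0 in Hz0; lra).
set (K := bop_scal E (/ z)%C (bop_plus E L (bop_opp E (bop_scal E (RtoC R0) P)))).
assert (HK : forall u, K u = smul (/ z)%C (sub (L u) (smul (RtoC R0) (P u)))) by reflexivity.
assert (Hpow : forall n, exists c, Cmod c = (/ Cmod z) ^ (S n) /\ forall u,
  bop_pow E K (S n) u = smul c (sub (bop_pow E L (S n) u) (smul (RtoC (R0 ^ (S n))) (P u)))).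
{ induction n as [|n [c [Hc IH]]].
  - exists (/ z)%C. split; [rewrite Cmod_inv by exact Hzn; ring|]. intros u. simpl.
    rewrite Rmult_1_r. apply HK.
  - exists (/ z * c)%C. split; [rewrite Cmod_mult, Cmod_inv, Hc by exact Hzn; reflexivity|].
    intros u. change (bop_pow E K (S (S n)) u) with (K (bop_pow E K (S n) u)).
    rewrite IH, HK. rewrite !bopZ, !bopB, !bopZ, LP, PP, P_pow.
    change (bop_pow E L (S (S n)) u) with (L (bop_pow E L (S n) u)).
    change (R0 ^ S (S n)) with (R0 * R0 ^ S n). rewrite RtoC_mult. module_eq C_Ring E; cring. }
set (kappa := rho * R0 / Cmod z).
assert (Hiz : 0 < / Cmod z) by now apply Rinv_0_lt_compat.
assert (Hk : 0 <= kappa < 1).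
{ unfold kappa. split; [repeat apply Rmult_le_pos; lra|].
  apply Rmult_lt_reg_r with (Cmod z); [lra|]. unfold Rdiv. rewrite Rmult_assoc, Rinv_l; lra. }
(* The extra 1 accounts for the power 0, to which the formula for [n >= 1] does not apply. *)
destruct (neumann K (B + 1) kappa Hk) as [W HW]; [lra| |].
{ intros [|n] u.
  - simpl. pose proof (norm_ge_0 u). assert (0 <= B * norm u) by now apply Rmult_le_pos. lra.
  - destruct (Hpow n) as [c [Hc Hn]]. rewrite Hn.
    assert (HRn : 0 < R0 ^ S n) by now apply pow_lt.
    replace (sub (bop_pow E L (S n) u) (smul (RtoC (R0 ^ S n)) (P u))) with
      (smul (RtoC (R0 ^ S n)) (sub (smul (RtoC (/ R0 ^ S n)) (bop_pow E L (S n) u)) (P u))).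
    2:{ rewrite RtoC_inv by lra.
        assert (HRc : RtoC (R0 ^ S n) <> 0) by (intros H; apply RtoC_inj in H; lra).
        module_eq C_Ring E; cbn [bop_pow]; try cring.
        match goal with |- @eq _ ?a ?b => change (@eq C a b) end.
        unfold mult, plus, opp, zero, one; cbn -[pow Cinv]. field. exact HRc. }
    eapply Rle_trans; [apply normZ|]. rewrite Hc.
    eapply Rle_trans; [apply Rmult_le_compat_l; [apply pow_le; lra|apply normZ]|].
    rewrite Cmod_R, Rabs_pos_eq by lra.
    apply Rle_trans with ((/ Cmod z) ^ S n * (R0 ^ S n * (B * rho ^ S n * norm u))).
    + apply Rmult_le_compat_l; [apply pow_le; lra|].
      apply Rmult_le_compat_l; [lra|]. apply HP.
    + unfold kappa, Rdiv. rewrite !Rpow_mult_distr.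
      assert (0 <= rho ^ S n * R0 ^ S n * (/ Cmod z) ^ S n * norm u).
      { assert (Hx : forall x : R, 0 <= x -> 0 <= x ^ S n) by (intros; now apply pow_le).
        pose proof (norm_ge_0 u). pose proof (Hx rho ltac:(lra)). pose proof (Hx R0 ltac:(lra)).
        pose proof (Hx (/ Cmod z) ltac:(lra)).
        apply Rmult_le_pos; [apply Rmult_le_pos; [apply Rmult_le_pos|]|]; assumption. }
      lra. }
assert (HPW : forall u, P (W u) = P u).
{ intros u. destruct (HW u) as [_ H].
  assert (HPK : P (K (W u)) = zero).
  { rewrite HK, bopZ, bopB, bopZ, PL, PP. module_eq C_Ring E; cring. }
  rewrite <- H at 2. rewrite bopB, HPK. module_eq C_Ring E; cring. }
assert (HWP : forall u, W (P u) = P u).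
{ intros u. destruct (HW (P u)) as [H _].
  assert (HKP : K (P u) = zero).
  { rewrite HK, LP, PP. module_eq C_Ring E; cring. }
  rewrite HKP in H. rewrite <- H at 2. f_equal. module_eq C_Ring E; cring. }
exists (bop_scal E (/ z)%C (bop_comp E W (bop_plus E (bop_id E) (bop_opp E P)))).
intros u.
change (
  smul (/ z)%C (W (sub (sub (smul z u) (L u)) (P (sub (smul z u) (L u))))) = sub u (P u) /\
  sub (smul z (smul (/ z)%C (W (sub u (P u))))) (L (smul (/ z)%C (W (sub u (P u))))) = sub u (P u) /\
  P (smul (/ z)%C (W (sub u (P u)))) = zero /\
  smul (/ z)%C (W (sub (P u) (P (P u)))) = zero).
assert (Hcf : forall x, smul (/ z)%C (smul z x) = x).
{ intros x. module_eq C_Ring E.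
  match goal with |- @eq _ ?a ?b => change (@eq C a b) end.
  unfold mult, one; simpl. field. exact Hzn. }
assert (Hcf' : forall x, smul z (smul (/ z)%C x) = x).
{ intros x. module_eq C_Ring E.
  match goal with |- @eq _ ?a ?b => change (@eq C a b) end.
  unfold mult, one; simpl. field. exact Hzn. }
repeat split.
- transitivity (smul (/ z)%C (W (smul z (sub (sub u (K u)) (P u))))).
  + f_equal. f_equal. rewrite HK, bopB, bopZ, PL.
    replace (sub (sub u (smul (/ z)%C (sub (L u) (smul (RtoC R0) (P u))))) (P u)) with
     (sub (sub u (P u)) (smul (/ z)%C (sub (L u) (smul (RtoC R0) (P u))))) by (module_eq C_Ring E; cring).
    transitivity (sub (smul z (sub u (P u))) (smul z (smul (/ z)%C (sub (L u) (smul (RtoC R0) (P u)))))).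
    * rewrite Hcf'. module_eq C_Ring E; cring.
    * module_eq C_Ring E; cring.
  + rewrite bopZ, Hcf, bopB, HWP. now rewrite (proj1 (HW u)).
- rewrite bopZ. destruct (HW (sub u (P u))) as [_ H].
  assert (Hw : P (W (sub u (P u))) = zero) by (rewrite HPW, bopB, PP; module_eq C_Ring E; cring).
  set (w := W (sub u (P u))) in *. transitivity (sub w (K w)); [|exact H].
  rewrite HK, Hw, Hcf'. module_eq C_Ring E; cring.
- rewrite bopZ, HPW, bopB, PP. module_eq C_Ring E; cring.
- rewrite PP. replace (sub (P u) (P u)) with (zero : E) by (module_eq C_Ring E; cring).
  rewrite bop0. module_eq C_Ring E; cring.
Qed.

Lemma inverse_of_regular_part z Q : z <> RtoC R0 -> is_regular_part z Q ->
  is_inverse E (bop_plus E (bop_scal E (/ (z - R0))%C P) Q) (shifted E L z).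
Proof.
intros Hz HQ. assert (Hz' : (z - R0)%C <> 0).
{ intros H. apply Hz. replace z with ((z - R0) + R0)%C by ring. rewrite H. ring. }
assert (Hcf : forall x, smul (/ (z - R0))%C (sub (smul z x) (smul (RtoC R0) x)) = x).
{ intros x. module_eq C_Ring E.
  match goal with |- @eq _ ?a ?b => change (@eq C a b) end.
  unfold mult, one, plus, opp; simpl. field. exact Hz'. }
split; apply bop_ext; intros u.
- change (add (smul (/ (z - R0))%C (P (sub (smul z u) (L u)))) (Q (sub (smul z u) (L u))) = u).
  rewrite (proj1 (HQ u)), bopB, bopZ, PL, Hcf. module_eq C_Ring E; cring.
- change (sub (smul z (add (smul (/ (z - R0))%C (P u)) (Q u))) (L (add (smul (/ (z - R0))%C (P u)) (Q u))) = u).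
  rewrite bopD, bopZ, LP. destruct (HQ u) as [_ [H _]].
  transitivity (add (smul (/ (z - R0))%C (sub (smul z (P u)) (smul (RtoC R0) (P u))))
    (sub (smul z (Q u)) (L (Q u)))); [module_eq C_Ring E; cring|].
  rewrite H, Hcf. module_eq C_Ring E; cring.
Qed.

Lemma inverse_unique (S1 S2 A : bounded_op E) : is_inverse E S1 A -> is_inverse E S2 A -> S1 = S2.
Proof.
intros [H1 _] [_ H2]. apply bop_ext. intros u.
pose proof (f_equal (fun T : bounded_op E => T (S2 u)) H1) as H3. simpl in H3.
pose proof (f_equal (fun T : bounded_op E => T u) H2) as H4. simpl in H4.
rewrite H4 in H3. exact H3.
Qed.

Lemma resolvent_regular_part z Q : z <> RtoC R0 -> is_regular_part z Q ->
  resolvent E L z = bop_plus E (bop_scal E (/ (z - R0))%C P) Q.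
Proof.
intros Hz HQ. pose proof (inverse_of_regular_part z Q Hz HQ) as H.
apply (inverse_unique _ _ (shifted E L z)); [|exact H].
apply (epsilon_spec (inhabits (bop_zero E)) (fun S => is_inverse E S (shifted E L z))). eauto.
Qed.

(** An isolating disc can reach points with [|z| <= rho R0], beyond the Neumann series. There the
    given resolvent, which commutes with [P], is cut down by [1 - P]. *)
Lemma regular_part_of_inverse z S : is_inverse E S (shifted E L z) ->
  is_regular_part z (bop_comp E S (bop_plus E (bop_id E) (bop_opp E P))).
Proof.
intros [H1 H2].
assert (HS1 : forall u, S (sub (smul z u) (L u)) = u).
{ intros u. exact (f_equal (fun T : bounded_op E => T u) H1). }
assert (HS2 : forall u, sub (smul z (S u)) (L (S u)) = u).
{ intros u. exact (f_equal (fun T : bounded_op E => T u) H2). }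
assert (HPS : forall u, P (S u) = S (P u)).
{ intros u. rewrite <- (HS1 (P (S u))). f_equal.
  transitivity (P (sub (smul z (S u)) (L (S u)))); [|now rewrite HS2].
  rewrite bopB, bopZ, LP, PL. reflexivity. }
intros u.
change (S (sub (sub (smul z u) (L u)) (P (sub (smul z u) (L u)))) = sub u (P u) /\
  sub (smul z (S (sub u (P u)))) (L (S (sub u (P u)))) = sub u (P u) /\
  P (S (sub u (P u))) = zero /\ S (sub (P u) (P (P u))) = zero).
repeat split.
- rewrite <- (HS1 (sub u (P u))). f_equal. rewrite !bopB, bopZ, PL, LP. module_eq C_Ring E; cring.
- apply HS2.
- rewrite HPS, bopB, PP. replace (sub (P u) (P u)) with (zero : E) by (module_eq C_Ring E; cring).
  apply bop0.
- rewrite PP. replace (sub (P u) (P u)) with (zero : E) by (module_eq C_Ring E; cring).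
  apply bop0.
Qed.

Lemma Cmod_sub_ge z c : Cmod c - Cmod (z - c)%C <= Cmod z.
Proof.
pose proof (Cmod_triangle z (c - z)%C) as H.
replace (z + (c - z))%C with c in H by ring.
rewrite <- (Cmod_opp (z - c)). replace (- (z - c))%C with (c - z)%C by ring. lra.
Qed.

Lemma Cmod_R0 : Cmod (RtoC R0) = R0.
Proof. rewrite Cmod_R. apply Rabs_pos_eq. lra. Qed.

Lemma isolating_radius_exists : exists r, isolating_radius E L R0 r.
Proof.
(* Half the distance from [R0] to the circle of radius [rho * R0]. *)
exists (R0 * (1 - rho) / 2).
assert (H : 0 < R0 * (1 - rho)) by (apply Rmult_lt_0_compat; lra).
split; [lra|]. intros z [Hz1 Hz2].
pose proof (Cmod_sub_ge z (RtoC R0)) as H1. rewrite Cmod_R0 in H1.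
destruct (regular_part_exists z) as [Q HQ]; [lra|].
eexists. apply (inverse_of_regular_part z Q); [|exact HQ].
intros ->. replace (R0 - R0)%C with (RtoC 0) in Hz1 by ring. rewrite Cmod_0 in Hz1. lra.
Qed.

Lemma regular_part_on_disc r : isolating_radius E L R0 r ->
  forall z, Cmod (z - R0)%C <= r -> exists Q, is_regular_part z Q.
Proof.
intros [Hr H] z Hz. destruct (Req_dec (Cmod (z - R0)%C) 0) as [H0|H0].
- apply Cmod_eq_0 in H0. replace z with (RtoC R0).
  + apply regular_part_exists. rewrite Cmod_R0.
    assert (0 < (1 - rho) * R0) by (apply Rmult_lt_0_compat; lra). lra.
  + replace z with ((z - R0) + R0)%C by ring. rewrite H0. ring.
- pose proof (Cmod_ge_0 (z - R0)%C).
  destruct (H z) as [S HS]; [lra|]. eexists. exact (regular_part_of_inverse z S HS).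
Qed.

(** The resolvent identity survives the cut by [1 - P] because [P (Q u)] and [Q' (P u)] vanish; it
    thus also holds at the centre, where no resolvent exists. *)
Lemma regular_part_identity z c Q Q' : is_regular_part z Q -> is_regular_part c Q' ->
  forall u, sub (Q u) (Q' u) = smul (c - z)%C (Q' (Q u)).
Proof.
intros H H' u. destruct (H u) as [_ [H1 [H2 _]]].
destruct (H' (Q u)) as [H3 _]. destruct (H' u) as [_ [_ [_ H4]]].
rewrite H2 in H3.
assert (H5 : Q' u = Q' (sub (smul z (Q u)) (L (Q u)))).
{ rewrite H1, bopB, H4. module_eq C_Ring E; cring. }
assert (H6 : Q u = Q' (sub (smul c (Q u)) (L (Q u)))).
{ rewrite H3. module_eq C_Ring E; cring. }
rewrite H6 at 1. rewrite H5, !bopB, !bopZ. module_eq C_Ring E; cring.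
Qed.

(** * Estimates on the circle *)

Lemma Cmod_le_sum z : Cmod z <= Rabs (fst z) + Rabs (snd z).
Proof.
unfold Cmod. pose proof (Rabs_pos (fst z)). pose proof (Rabs_pos (snd z)).
rewrite <- (sqrt_pow2 (Rabs (fst z) + Rabs (snd z))) by lra.
apply sqrt_le_1_alt. rewrite <- (pow2_abs (fst z)), <- (pow2_abs (snd z)). nra.
Qed.

Lemma Cmod_Cexpi (x : R) : Cmod (Cexpi x) = 1.
Proof.
unfold Cmod, Cexpi. simpl fst. simpl snd. rewrite <- sqrt_1. f_equal.
pose proof (sin2_cos2 x) as H. unfold Rsqr in H. simpl. lra.
Qed.

Lemma sin_cos_increment (x y : R) :
  exists a b, sin y - sin x = cos a * (y - x) /\ cos y - cos x = - sin b * (y - x) /\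
    Rabs (a - x) <= Rabs (y - x) /\ Rabs (b - x) <= Rabs (y - x).
Proof.
destruct (MVT_gen sin x y cos) as [a [Ha1 Ha2]].
{ intros; apply is_derive_Reals, derivable_pt_lim_sin. } { intros; apply continuity_sin. }
destruct (MVT_gen cos x y (fun t : R => - sin t)) as [b [Hb1 Hb2]].
{ intros; apply is_derive_Reals, derivable_pt_lim_cos. } { intros; apply continuity_cos. }
exists a, b. repeat split; try assumption.
- unfold Rmin, Rmax in *. destruct (Rle_dec x y); unfold Rabs; repeat destruct Rcase_abs; lra.
- unfold Rmin, Rmax in *. destruct (Rle_dec x y); unfold Rabs; repeat destruct Rcase_abs; lra.
Qed.

Lemma Rabs_mult_le1 (a b : R) : -1 <= a <= 1 -> Rabs (a * b) <= Rabs b.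
Proof.
intros H. rewrite Rabs_mult. pose proof (Rabs_pos b).
assert (Rabs a <= 1) by (apply Rabs_le; lra). nra.
Qed.

Lemma Cexpi_lipschitz (x y : R) : Cmod (Cexpi y - Cexpi x)%C <= 2 * Rabs (y - x).
Proof.
eapply Rle_trans; [apply Cmod_le_sum|]. simpl.
destruct (sin_cos_increment x y) as [a [b [H1 [H2 _]]]].
change (Rabs (cos y - cos x) + Rabs (sin y - sin x) <= 2 * Rabs (y - x)).
rewrite H1, H2.
pose proof (COS_bound a). pose proof (SIN_bound b).
pose proof (Rabs_mult_le1 (cos a) (y - x) ltac:(lra)).
pose proof (Rabs_mult_le1 (- sin b) (y - x) ltac:(lra)). lra.
Qed.

Lemma Cexpi_taylor (x y : R) :
  Cmod (Cexpi y - Cexpi x - Ci * RtoC (y - x) * Cexpi x)%C <= 2 * (y - x) ^ 2.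
Proof.
eapply Rle_trans; [apply Cmod_le_sum|].
destruct (sin_cos_increment x y) as [a [b [H1 [H2 [H3 H4]]]]].
replace (fst (Cexpi y - Cexpi x - Ci * RtoC (y - x) * Cexpi x)%C) with ((cos y - cos x) + (y - x) * sin x)
  by (simpl; ring).
replace (snd (Cexpi y - Cexpi x - Ci * RtoC (y - x) * Cexpi x)%C) with ((sin y - sin x) - (y - x) * cos x)
  by (simpl; ring).
rewrite H1, H2.
replace (- sin b * (y - x) + (y - x) * sin x) with ((y - x) * (sin x - sin b)) by ring.
replace (cos a * (y - x) - (y - x) * cos x) with ((y - x) * (cos a - cos x)) by ring.
rewrite !Rabs_mult. rewrite <- (pow2_abs (y - x)).
pose proof (Rabs_pos (y - x)).
assert (H5 : Rabs (cos a - cos x) <= Rabs (a - x)) by apply Rabs_cos_diff.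
assert (H6 : Rabs (sin x - sin b) <= Rabs (b - x)).
{ destruct (sin_cos_increment x b) as [c [_ [H7 _]]]. rewrite Rabs_minus_sym, H7.
  pose proof (COS_bound c). apply Rabs_mult_le1. lra. }
nra.
Qed.

Lemma Cexpi_reduce (x : R) : exists y, 0 <= y <= 2 * PI /\ Cexpi y = Cexpi x.
Proof.
pose proof PI_RGT_0 as HPI.
destruct (base_Int_part (x / (2 * PI))) as [H1 H2].
set (k := Int_part (x / (2 * PI))) in *.
assert (Hx : x / (2 * PI) * (2 * PI) = x) by (field; lra).
exists (x - 2 * PI * IZR k). split; [nra|].
unfold Cexpi. f_equal.
- pose proof (per_Z _ k (x / (2 * PI) - IZR k) (cos_per 0)) as H. cbv beta in H.
  rewrite !Rminus_0_r in H. replace (x / (2 * PI) - IZR k + IZR k) with (x / (2 * PI)) in H by ring.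
  replace (2 * PI * (x / (2 * PI))) with x in H by (field; lra). rewrite H. f_equal. field. lra.
(* A shift by a quarter period turns the cosine into the sine. *)
- pose proof (per_Z _ k (x / (2 * PI) - IZR k) (cos_per (/ 4))) as H. cbv beta in H.
  replace (2 * PI * (x / (2 * PI) - IZR k + IZR k - / 4)) with (- (PI / 2 - x)) in H by (field; lra).
  replace (2 * PI * (x / (2 * PI) - IZR k - / 4)) with (- (PI / 2 - (x - 2 * PI * IZR k))) in H by (field; lra).
  rewrite !cos_neg, !cos_shift in H. now symmetry.
Qed.

Section Contour.
Context (r : R) (Hr : 0 < r) (q : C -> bounded_op E).
Context (Hq : forall z, Cmod (z - R0)%C <= r -> is_regular_part z (q z)).

(** [s] is the homotopy parameter, from the centre at 0 to the full circle at 1; [x] is the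
    angle. *)
Definition polar (s x : R) : C := (RtoC R0 + RtoC s * RtoC r * Cexpi x)%C.

Lemma polar_dist (s x : R) : 0 <= s -> Cmod (polar s x - R0)%C = s * r.
Proof.
intros Hs. replace (polar s x - R0)%C with (RtoC s * RtoC r * Cexpi x)%C by (unfold polar; ring).
rewrite !Cmod_mult, !Cmod_R, Cmod_Cexpi, !Rabs_pos_eq by lra. ring.
Qed.

Lemma polar_regular (s x : R) : 0 <= s <= 1 -> is_regular_part (polar s x) (q (polar s x)).
Proof. intros Hs. apply Hq. rewrite polar_dist by lra. nra. Qed.

Lemma polar_near (s x a b : R) : 0 <= a <= 1 ->
  Cmod (polar a b - polar s x)%C <= r * (Rabs (s - a) + 2 * Rabs (x - b)).
Proof.
intros Ha. replace (polar a b - polar s x)%C with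
  (RtoC r * (RtoC (a - s) * Cexpi x + RtoC a * (Cexpi b - Cexpi x)))%C
  by (unfold polar; rewrite RtoC_minus; ring).
rewrite Cmod_mult, Cmod_R, Rabs_pos_eq by lra. apply Rmult_le_compat_l; [lra|].
eapply Rle_trans; [apply Cmod_triangle|]. rewrite !Cmod_mult, !Cmod_R, Cmod_Cexpi.
rewrite (Rabs_pos_eq a) by lra. rewrite (Rabs_minus_sym s a), (Rabs_minus_sym x b).
pose proof (Cexpi_lipschitz x b). pose proof (Cmod_ge_0 (Cexpi b - Cexpi x)%C). nra.
Qed.

(** By the resolvent identity the norm at [z] is at most the norm at [c] plus half of itself, and
    the half is absorbed. *)
Lemma regular_part_local_bound z c : Cmod (z - R0)%C <= r -> Cmod (c - R0)%C <= r ->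
  Cmod (c - z)%C * opnorm E (q c) <= / 2 -> opnorm E (q z) <= 2 * opnorm E (q c).
Proof.
intros Hz Hc H. pose proof (opnorm_ge0 E (q z)) as H0. pose proof (opnorm_ge0 E (q c)) as H0'.
assert (H1 : opnorm E (q z) <= opnorm E (q c) + Cmod (c - z)%C * opnorm E (q c) * opnorm E (q z)).
{ apply opnorm_le. intros u Hu.
  pose proof (regular_part_identity z c _ _ (Hq z Hz) (Hq c Hc) u) as Hid.
  eapply Rle_trans; [apply (norm_as_plus _ (q c u) (smul (c - z)%C (q c (q z u))))|].
  { rewrite <- Hid. module_eq C_Ring E; cring. }
  apply Rplus_le_compat; [now apply opnorm_ub1|].
  eapply Rle_trans; [apply normZ|]. rewrite Rmult_assoc. apply Rmult_le_compat_l; [apply Cmod_ge_0|].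
  eapply Rle_trans; [apply opnorm_ub|]. apply Rmult_le_compat_l; [exact H0'|now apply opnorm_ub1]. }
nra.
Qed.

(** The family [q] is merely chosen point by point. The local bound holds on a neighbourhood whose
    size depends on the centre, and compactness of the parameter rectangle makes it uniform. *)
Lemma regular_part_bounded : exists N, 0 <= N /\ forall s x : R, 0 <= s <= 1 -> opnorm E (q (polar s x)) <= N.
Proof.
set (o := fun a b => opnorm E (q (polar a b))).
assert (Ho : forall a b, 0 <= o a b) by (intros; apply opnorm_ge0).
(* Parameters closer than this move the point by at most [3 r] times the gauge, which gives the
   product [1/2] needed for the local bound. A gauge bounded below by [d] also bounds the norm at
   the centre by [/ d]. *)
assert (Hdel : forall a b, 0 < / (6 * (r + 1) * (o a b + 1))).
{ intros a b. specialize (Ho a b). apply Rinv_0_lt_compat. nra. }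
destruct (compactness_value_2d 0 1 0 (2 * PI) (fun a b => mkposreal _ (Hdel a b))) as [[d Hd] H].
cbn [pos] in H. assert (Hid : 0 < / d) by now apply Rinv_0_lt_compat.
exists (2 * / d). split; [lra|]. intros s x Hs.
destruct (Cexpi_reduce x) as [y [Hy Hxy]].
replace (polar s x) with (polar s y) by (unfold polar; now rewrite Hxy).
apply NNPP. intros Hn. apply (H s y Hs Hy). intros [a [b [Ha [Hb [H1 [H2 H3]]]]]]. apply Hn.
specialize (Ho a b).
assert (Hoab : o a b + 1 <= / d).
{ assert (H4 : 0 < 6 * (r + 1) * (o a b + 1)) by nra.
  apply Rle_trans with (6 * (r + 1) * (o a b + 1)); [nra|].
  rewrite <- (Rinv_inv (6 * (r + 1) * (o a b + 1))). apply Rinv_le_contravar; assumption. }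
apply Rle_trans with (2 * o a b); [|lra].
apply regular_part_local_bound.
- rewrite polar_dist by lra. nra.
- rewrite polar_dist by lra. nra.
- fold (o a b). pose proof (polar_near s y a b Ha) as H4.
  set (dl := / (6 * (r + 1) * (o a b + 1))) in *.
  assert (H5 : dl * (6 * (r + 1) * (o a b + 1)) = 1) by (unfold dl; apply Rinv_l; nra).
  assert (Hdl : 0 < dl) by apply Hdel.
  assert (H6 : r * (Rabs (s - a) + 2 * Rabs (y - b)) <= (r + 1) * (3 * dl)) by nra.
  apply Rle_trans with ((r + 1) * (3 * dl) * (o a b + 1)); [|lra].
  apply Rmult_le_compat; try lra. apply Cmod_ge_0.
Qed.

Context (N : R) (HN0 : 0 <= N) (HN : forall s x : R, 0 <= s <= 1 -> opnorm E (q (polar s x)) <= N).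

(* [w = s r e^(ix)]: [g] is [w Q / (2 pi)], and [Dg] is at once the derivative of [g] in [s] and of [Phi] in [x],
   as [Q' = - Q^2]. *)
Let g (s x : R) : bounded_op E :=
  bop_scal E (RtoC (/ (2 * PI)) * (RtoC s * RtoC r * Cexpi x))%C (q (polar s x)).
Let Phi (s x : R) : bounded_op E :=
  bop_scal E (RtoC (/ (2 * PI)) * (- Ci * RtoC r * Cexpi x))%C (q (polar s x)).
Let Dg (s x : R) : bounded_op E :=
  bop_scal E (RtoC (/ (2 * PI)) * (RtoC r * Cexpi x))%C
    (bop_plus E (q (polar s x))
       (bop_opp E (bop_scal E (RtoC s * RtoC r * Cexpi x)%C (bop_comp E (q (polar s x)) (q (polar s x)))))).

Lemma inv_2PI : 0 < / (2 * PI) <= 1.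
Proof.
assert (H : 1 <= 2 * PI) by (pose proof PI2_1; lra).
split; [apply Rinv_0_lt_compat; lra|]. rewrite <- Rinv_1. apply Rinv_le_contravar; lra.
Qed.

Lemma q_bound (s x : R) u : 0 <= s <= 1 -> norm (q (polar s x) u) <= N * norm u.
Proof. intros Hs. apply bop_bound. now apply HN. Qed.

(** Exact expansions in place of Taylor's formula. After substitution every increment is expressed
    by [Q Q' u] and [Q Q Q' u], with the remainder carrying the square of the displacement. *)
Lemma regular_increment (s x s' x' : R) u : 0 <= s <= 1 -> 0 <= s' <= 1 ->
  let d := (polar s' x' - polar s x)%C in
  let Q := q (polar s x) in let Q' := q (polar s' x') in
  Q' u = sub (Q u) (smul d (Q (Q' u))) /\
  Q (Q u) = add (Q (Q' u)) (smul d (Q (Q (Q' u)))).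
Proof.
intros Hs Hs' d Q Q'.
assert (H := regular_part_identity _ _ _ _ (polar_regular s' x' Hs') (polar_regular s x Hs) u).
fold Q Q' in H.
assert (H1 : Q' u = sub (Q u) (smul d (Q (Q' u)))).
{ transitivity (add (Q u) (sub (Q' u) (Q u))); [module_eq C_Ring E; cring|].
  rewrite H. unfold d. module_eq C_Ring E; cring. }
split; [exact H1|].
rewrite H1 at 1. rewrite bopB, bopZ. module_eq C_Ring E; cring.
Qed.

Lemma quad_bound (s x s' x' : R) u (w : C) : 0 <= s <= 1 -> 0 <= s' <= 1 -> norm u <= 1 -> Cmod w <= r ->
  norm (sub (smul w (q (polar s x) (q (polar s x) (q (polar s' x') u)))) (q (polar s x) (q (polar s' x') u)))
   <= r * N ^ 3 + N ^ 2.
Proof.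
intros Hs Hs' Hu Hw. pose proof (norm_ge_0 u) as Hu0.
pose proof (q_bound s' x' u Hs') as H1. set (a := q (polar s' x') u) in *.
pose proof (q_bound s x a Hs) as H2. set (b := q (polar s x) a) in *.
pose proof (q_bound s x b Hs) as H3. set (c := q (polar s x) b) in *.
assert (H4 : norm a <= N) by nra.
assert (H5 : norm b <= N ^ 2) by (simpl; nra).
assert (H6 : norm c <= N ^ 3) by (simpl in *; nra).
eapply Rle_trans; [apply normB|]. apply Rplus_le_compat; [|exact H5].
eapply Rle_trans; [apply normZ|]. apply Rmult_le_compat; [apply Cmod_ge_0|apply norm_ge_0|exact Hw|exact H6].
Qed.

Lemma contour_radial (s s' x : R) : 0 <= s <= 1 -> 0 <= s' <= 1 ->
  norm (V := restrict_scalars (BL E)) (minus (minus (g s' x : restrict_scalars (BL E)) (g s x))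
    (scal (s' - s) (Dg s x : restrict_scalars (BL E)))) <= r ^ 2 * (r * N ^ 3 + N ^ 2) * (s' - s) ^ 2.
Proof.
intros Hs Hs'. apply opnorm_le. intros u Hu.
set (k := RtoC (/ (2 * PI))). set (e := Cexpi x).
set (Q := q (polar s x)). set (Q' := q (polar s' x)). set (w := (RtoC s * RtoC r * e)%C).
change (norm (sub (sub (smul (k * (RtoC s' * RtoC r * e))%C (Q' u)) (smul (k * w)%C (Q u)))
  (smul (RtoC (s' - s)) (smul (k * (RtoC r * e))%C (add (Q u) (opp (smul w (Q (Q u)))))))) <=
  r ^ 2 * (r * N ^ 3 + N ^ 2) * (s' - s) ^ 2).
destruct (regular_increment s x s' x u Hs Hs') as [H1 H2]. fold Q Q' in H1, H2.
replace (polar s' x - polar s x)%C with (RtoC (s' - s) * RtoC r * e)%C in H1, H2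
  by (unfold polar; rewrite RtoC_minus; fold e; ring).
set (Y := sub (smul w (Q (Q (Q' u)))) (Q (Q' u))).
assert (HY : norm Y <= r * N ^ 3 + N ^ 2).
{ apply quad_bound; try assumption. unfold w, e. rewrite !Cmod_mult, !Cmod_R, Cmod_Cexpi, !Rabs_pos_eq by lra. nra. }
replace (sub (sub (smul (k * (RtoC s' * RtoC r * e))%C (Q' u)) (smul (k * w)%C (Q u)))
  (smul (RtoC (s' - s)) (smul (k * (RtoC r * e))%C (add (Q u) (opp (smul w (Q (Q u))))))))
 with (smul (k * ((RtoC (s' - s) * RtoC r * e) * (RtoC (s' - s) * RtoC r * e)))%C Y).
2:{ unfold Y. clear HY Y. set (y2 := Q (Q' u)) in *. set (y1 := Q y2) in *.
    rewrite H2, H1. unfold w. rewrite !RtoC_minus. module_eq C_Ring E; cring. }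
eapply Rle_trans; [apply normZ|].
unfold k, e. rewrite !Cmod_mult, !Cmod_R, Cmod_Cexpi. pose proof inv_2PI.
rewrite (Rabs_pos_eq (/ (2 * PI))), (Rabs_pos_eq r) by lra.
replace (/ (2 * PI) * (Rabs (s' - s) * r * 1 * (Rabs (s' - s) * r * 1)) * norm Y)
 with (/ (2 * PI) * (r ^ 2 * Rabs (s' - s) ^ 2 * norm Y)) by ring.
rewrite pow2_abs.
assert (Hx : 0 <= r ^ 2 * (s' - s) ^ 2) by (apply Rmult_le_pos; apply pow2_ge_0).
assert (r ^ 2 * (s' - s) ^ 2 * norm Y <= r ^ 2 * (s' - s) ^ 2 * (r * N ^ 3 + N ^ 2)) by now apply Rmult_le_compat_l.
pose proof (norm_ge_0 Y).
assert (0 <= r ^ 2 * (s' - s) ^ 2 * norm Y) by now apply Rmult_le_pos.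
nra.
Qed.

Lemma contour_angular_centered (s xi y : R) u : 0 <= s <= 1 -> norm u <= 1 ->
  norm (sub (sub (Phi s y u) (Phi s xi u)) (smul (RtoC (y - xi)) (Dg s xi u))) <=
  (2 * r * (N + r * N ^ 2) + 4 * r ^ 2 * (r * N ^ 3 + N ^ 2)) * (y - xi) ^ 2.
Proof.
intros Hs Hu. pose proof (norm_ge_0 u) as Hu0.
set (k := RtoC (/ (2 * PI))). set (e := Cexpi xi). set (del := (Cexpi y - e)%C).
set (Q := q (polar s xi)). set (Q' := q (polar s y)). set (w := (RtoC s * RtoC r * e)%C).
change (norm (sub (sub (smul (k * (- Ci * RtoC r * Cexpi y))%C (Q' u)) (smul (k * (- Ci * RtoC r * e))%C (Q u)))
  (smul (RtoC (y - xi)) (smul (k * (RtoC r * e))%C (add (Q u) (opp (smul w (Q (Q u)))))))) <=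
  (2 * r * (N + r * N ^ 2) + 4 * r ^ 2 * (r * N ^ 3 + N ^ 2)) * (y - xi) ^ 2).
replace (Cexpi y) with (e + del)%C by (unfold del; ring).
destruct (regular_increment s xi s y u Hs Hs) as [H1 H2]. fold Q Q' in H1, H2.
replace (polar s y - polar s xi)%C with (RtoC s * RtoC r * del)%C in H1, H2
  by (unfold polar, del, e; ring).
assert (Hw : Cmod w <= r).
{ unfold w, e. rewrite !Cmod_mult, !Cmod_R, Cmod_Cexpi, !Rabs_pos_eq by lra. nra. }
set (Y := sub (smul w (Q (Q (Q' u)))) (Q (Q' u))).
assert (HY : norm Y <= r * N ^ 3 + N ^ 2) by now apply quad_bound.
set (Z := sub (Q u) (smul w (Q (Q u)))).
assert (HZ : norm Z <= N + r * N ^ 2).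
{ pose proof (q_bound s xi u Hs) as H3. pose proof (q_bound s xi (Q u) Hs) as H4. fold Q in H3, H4.
  assert (H5 : norm (Q u) <= N) by nra.
  assert (H6 : norm (Q (Q u)) <= N ^ 2) by (simpl; nra).
  eapply Rle_trans; [apply normB|]. apply Rplus_le_compat; [exact H5|].
  eapply Rle_trans; [apply normZ|]. apply Rmult_le_compat; [apply Cmod_ge_0|apply norm_ge_0|exact Hw|exact H6]. }
(* The remainder splits into the Taylor error of the exponential acting on [Z] and the squared
   displacement acting on [Y]; they give the two summands of the constant. *)
eapply Rle_trans; [apply (norm_as_plus _
  (smul (k * (- Ci * RtoC r * (del - Ci * RtoC (y - xi) * e)))%C Z)
  (smul (k * (- Ci * RtoC r * (RtoC s * RtoC r * (del * del))))%C Y))|].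
{ unfold Y, Z. clear HY HZ Y Z. set (y2 := Q (Q' u)) in *. set (y1 := Q y2) in *.
  rewrite H2, H1. unfold w.
  module_eq C_Ring E; match goal with |- @eq _ ?a ?b => change (@eq C a b) end;
  unfold mult, plus, opp, zero, one; simpl; try ring.
  all: apply injective_projections; simpl; ring. }
pose proof inv_2PI as Hk.
assert (Hd1 : Cmod (del - Ci * RtoC (y - xi) * e)%C <= 2 * (y - xi) ^ 2) by apply Cexpi_taylor.
assert (Hd2 : Cmod del <= 2 * Rabs (y - xi)) by apply Cexpi_lipschitz.
assert (HCi : Cmod (- Ci)%C = 1).
{ rewrite Cmod_opp. unfold Cmod, Ci. simpl fst. simpl snd.
  replace (0 ^ 2 + 1 ^ 2) with 1 by ring. apply sqrt_1. }
rewrite Rmult_plus_distr_r. apply Rplus_le_compat; (eapply Rle_trans; [apply normZ|]); unfold k;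
  rewrite !Cmod_mult, HCi, !Cmod_R, (Rabs_pos_eq (/ (2 * PI))), (Rabs_pos_eq r) by lra.
- set (m := Cmod (del - Ci * RtoC (y - xi) * e)%C) in *.
  assert (0 <= m) by apply Cmod_ge_0. pose proof (norm_ge_0 Z).
  assert (H3 : m * norm Z <= 2 * (y - xi) ^ 2 * (N + r * N ^ 2)) by (apply Rmult_le_compat; assumption).
  assert (H4 : 0 <= m * norm Z) by now apply Rmult_le_pos.
  assert (H5 : r * (m * norm Z) <= r * (2 * (y - xi) ^ 2 * (N + r * N ^ 2))) by (apply Rmult_le_compat_l; lra).
  assert (H6 : 0 <= r * (m * norm Z)) by (apply Rmult_le_pos; lra).
  apply Rle_trans with (/ (2 * PI) * (r * (m * norm Z))); [right; ring|]. nra.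
- rewrite (Rabs_pos_eq s) by lra. set (m := Cmod del) in *.
  assert (0 <= m) by apply Cmod_ge_0. pose proof (norm_ge_0 Y).
  assert (Hm : m * m <= 4 * (y - xi) ^ 2).
  { rewrite <- (pow2_abs (y - xi)). pose proof (Rabs_pos (y - xi)). nra. }
  assert (H3 : m * m * norm Y <= 4 * (y - xi) ^ 2 * (r * N ^ 3 + N ^ 2)).
  { apply Rmult_le_compat; [apply Rmult_le_pos| | |]; assumption. }
  assert (H4 : 0 <= m * m * norm Y) by (apply Rmult_le_pos; [apply Rmult_le_pos|]; assumption).
  assert (H5 : r ^ 2 * (m * m * norm Y) <= r ^ 2 * (4 * (y - xi) ^ 2 * (r * N ^ 3 + N ^ 2))).
  { apply Rmult_le_compat_l; [apply pow2_ge_0|exact H3]. }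
  assert (H6 : 0 <= r ^ 2 * (m * m * norm Y)) by (apply Rmult_le_pos; [apply pow2_ge_0|exact H4]).
  apply Rle_trans with ((/ (2 * PI) * s) * (r ^ 2 * (m * m * norm Y))); [right; ring|].
  assert (0 <= / (2 * PI) * s <= 1) by nra. nra.
Qed.

(** The estimate centred at the tag is subtracted at both ends. As the tag lies between them, the
    two squares add up to at most [(y - x)^2] and the constant is unchanged. *)
Lemma contour_angular (s x xi y : R) : 0 <= s <= 1 -> x <= xi <= y ->
  norm (V := restrict_scalars (BL E)) (minus (minus (Phi s y : restrict_scalars (BL E)) (Phi s x))
    (scal (y - x) (Dg s xi : restrict_scalars (BL E)))) <=
  (2 * r * (N + r * N ^ 2) + 4 * r ^ 2 * (r * N ^ 3 + N ^ 2)) * (y - x) ^ 2.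
Proof.
intros Hs Hx. apply opnorm_le. intros u Hu.
change (norm (sub (sub (Phi s y u) (Phi s x u)) (smul (RtoC (y - x)) (Dg s xi u))) <=
  (2 * r * (N + r * N ^ 2) + 4 * r ^ 2 * (r * N ^ 3 + N ^ 2)) * (y - x) ^ 2).
pose proof (contour_angular_centered s xi y u Hs Hu) as H1.
pose proof (contour_angular_centered s xi x u Hs Hu) as H2.
set (C2 := 2 * r * (N + r * N ^ 2) + 4 * r ^ 2 * (r * N ^ 3 + N ^ 2)) in *.
assert (HC2 : 0 <= C2).
{ unfold C2. repeat (apply Rplus_le_le_0_compat || apply Rmult_le_pos || lra). }
eapply Rle_trans; [apply (norm_as_minus _
  (sub (sub (Phi s y u) (Phi s xi u)) (smul (RtoC (y - xi)) (Dg s xi u)))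
  (sub (sub (Phi s x u) (Phi s xi u)) (smul (RtoC (x - xi)) (Dg s xi u))))|].
{ set (a := Phi s y u). set (b := Phi s x u). set (c := Phi s xi u). set (d := Dg s xi u).
  rewrite !RtoC_minus. module_eq C_Ring E; cring. }
assert (C2 * ((y - xi) ^ 2 + (x - xi) ^ 2) <= C2 * (y - x) ^ 2) by (apply Rmult_le_compat_l; nra).
lra.
Qed.

Lemma contour_zero : is_RInt (V := restrict_scalars (BL E)) (g 1) 0 (2 * PI) zero.
Proof.
pose proof PI_RGT_0.
assert (0 <= N ^ 2) by (apply pow_le; lra). assert (0 <= N ^ 3) by (apply pow_le; lra).
assert (0 <= r ^ 2) by (apply pow_le; lra).
apply (is_RInt_homotopic_zero (V := restrict_scalars (BL E)) 0 (2 * PI) (r ^ 2 * (r * N ^ 3 + N ^ 2))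
  (2 * r * (N + r * N ^ 2) + 4 * r ^ 2 * (r * N ^ 3 + N ^ 2)) g Dg Phi); try lra.
- apply Rmult_le_pos; [assumption|]. apply Rplus_le_le_0_compat; [apply Rmult_le_pos; lra|assumption].
- repeat (apply Rplus_le_le_0_compat || apply Rmult_le_pos || lra).
- exact contour_radial.
- exact contour_angular.
- intros s. unfold Phi, polar. replace (Cexpi (2 * PI)) with (Cexpi 0); [reflexivity|].
  unfold Cexpi. now rewrite cos_0, sin_0, cos_2PI, sin_2PI.
- intros x. apply bop_ext. intros u. unfold g.
  change (smul (RtoC (/ (2 * PI)) * (RtoC 0 * RtoC r * Cexpi x))%C (q (polar 0 x) u) = zero).
  set (v := q (polar 0 x) u). module_eq C_Ring E; cring.
Qed.

Lemma contour_resolvent : is_circle_integral E L R0 r P.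
Proof.
pose proof PI_RGT_0 as HPI.
set (V := restrict_scalars (BL E)).
set (k := RtoC (/ (2 * PI))).
(* On the circle [dz / (2 pi i (z - R0))] equals [d theta / (2 pi)], so the singular part of the
   resolvent has a constant integrand. *)
assert (H1 := is_RInt_const (V := V) 0 (2 * PI) (bop_scal E k P)).
assert (H2 := is_RInt_plus (V := V) _ _ _ _ _ _ H1 contour_zero).
assert (HPe : (P : V) = plus (scal (2 * PI - 0) (bop_scal E k P : V)) (zero : V)).
{ apply bop_ext. intros u.
    change (P u = add (smul (RtoC (2 * PI - 0)) (smul k (P u))) zero).
    unfold k. rewrite Rminus_0_r. set (v := P u).
    assert (Hk : (RtoC (2 * PI) * RtoC (/ (2 * PI)))%C = 1).
    { rewrite <- RtoC_mult. f_equal. field. lra. }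
    module_eq C_Ring E. match goal with |- @eq _ ?a ?b => change (@eq C a b) end.
    unfold mult, plus, one; simpl. rewrite Cmult_1_r. symmetry. exact Hk. }
unfold is_circle_integral.
refine (eq_rect_r (fun w : V => is_RInt (V := V) _ 0 (2 * PI) w) _ HPe).
refine (is_RInt_ext (V := V) _ _ 0 (2 * PI) _ _ H2). intros x _.
apply bop_ext. intros u.
assert (Hne : (RtoC R0 + RtoC r * Cexpi x)%C <> RtoC R0).
{ intros H. assert (H0 : Cmod (polar 1 x - R0)%C = 1 * r) by (apply polar_dist; lra).
  unfold polar in H0. replace (RtoC R0 + RtoC 1 * RtoC r * Cexpi x)%C with (RtoC R0 + RtoC r * Cexpi x)%C in H0 by ring.
  rewrite H in H0. replace (R0 - R0)%C with (RtoC 0) in H0 by ring. rewrite Cmod_0 in H0. lra. }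
assert (Hreg := polar_regular 1 x ltac:(lra)).
assert (Epol : polar 1 x = (RtoC R0 + RtoC r * Cexpi x)%C) by (unfold polar; ring).
rewrite Epol in Hreg.
change (add (smul k (P u)) (smul (k * (RtoC 1 * RtoC r * Cexpi x))%C (q (polar 1 x) u)) =
  smul (/ (2 * PI * Ci) * (Ci * r * Cexpi x))%C (resolvent E L (RtoC R0 + RtoC r * Cexpi x)%C u)).
rewrite Epol, (resolvent_regular_part _ _ Hne Hreg).
change (bop_plus E (bop_scal E (/ (RtoC R0 + RtoC r * Cexpi x - R0))%C P) (q (RtoC R0 + RtoC r * Cexpi x)%C) u)
 with (add (smul (/ (RtoC R0 + RtoC r * Cexpi x - R0))%C (P u)) (q (RtoC R0 + RtoC r * Cexpi x)%C u)).
set (a := P u). set (b := q (RtoC R0 + RtoC r * Cexpi x)%C u).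
assert (He : Cexpi x <> 0).
{ intros H. pose proof (Cmod_Cexpi x) as H0. rewrite H, Cmod_0 in H0. lra. }
assert (Hrc : RtoC r <> 0) by (intros H; apply RtoC_inj in H; lra).
assert (HCi : Ci <> 0) by (intros H; injection H; lra).
assert (HPc : RtoC PI <> 0) by (intros H; apply RtoC_inj in H; lra).
assert (H2c : RtoC 2 <> 0) by (intros H; apply RtoC_inj in H; lra).
assert (Hk : k = (/ (2 * PI))%C).
{ unfold k. rewrite RtoC_inv, RtoC_mult by lra. reflexivity. }
replace (RtoC R0 + RtoC r * Cexpi x - R0)%C with (RtoC r * Cexpi x)%C by ring.
assert (E1 : (/ (2 * PI * Ci) * (Ci * r * Cexpi x) * / (RtoC r * Cexpi x))%C = k).
{ rewrite Hk. field. repeat split; assumption. }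
assert (E2 : (/ (2 * PI * Ci) * (Ci * r * Cexpi x))%C = (k * (RtoC 1 * RtoC r * Cexpi x))%C).
{ rewrite Hk. field. repeat split; assumption. }
transitivity (add (smul (/ (2 * PI * Ci) * (Ci * r * Cexpi x) * / (RtoC r * Cexpi x))%C a)
  (smul (k * (RtoC 1 * RtoC r * Cexpi x))%C b)).
- now rewrite E1.
- rewrite E2. module_eq C_Ring E; cring.
Qed.

End Contour.

Lemma spectral_projection (h : E) : h <> zero -> L h = smul (RtoC R0) h ->
  is_spectral_projection E L R0 P.
Proof.
intros Hh Hev.
assert (Hpow : forall n u, L u = smul (RtoC R0) u -> bop_pow E L n u = smul (RtoC (R0 ^ n)) u).
{ intros n u Hu. induction n as [|n IH]; simpl.
  - symmetry. exact (scal_one u).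
  - rewrite IH, bopZ, Hu, RtoC_mult. module_eq C_Ring E; cring. }
split; [split; [|split]|split].
- intros [S [HS _]]. apply Hh.
  pose proof (f_equal (fun T : bounded_op E => T h) HS) as H.
  change (S (sub (smul (RtoC R0) h) (L h)) = h) in H. rewrite Hev in H. rewrite <- H.
  replace (sub (smul (RtoC R0) h) (smul (RtoC R0) h)) with (zero : E) by (module_eq C_Ring E; cring).
  apply bop0.
- apply isolating_radius_exists.
- intros r Hr.
  assert (Hex : forall z, exists Q, Cmod (z - R0)%C <= r -> is_regular_part z Q).
  { intros z. destruct (Rle_dec (Cmod (z - R0)%C) r) as [H|H].
    - destruct (regular_part_on_disc r Hr z H) as [Q HQ]. now exists Q.
    - exists (bop_id E). intros H'. now elim H. }
  set (q := fun z => proj1_sig (constructive_indefinite_description _ (Hex z))).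
  assert (Hq : forall z, Cmod (z - R0)%C <= r -> is_regular_part z (q z))
    by (intros z; exact (proj2_sig (constructive_indefinite_description _ (Hex z)))).
  destruct Hr as [Hr _].
  destruct (regular_part_bounded r Hr q Hq) as [N [HN0 HN]].
  exact (contour_resolvent r Hr q Hq N HN0 HN).
- exists h. split; [exact Hh|exact Hev].
- intros u. split.
  + intros Hu. exists u. symmetry. apply (norm_geom_eq _ _ (B * norm u) rho); [lra|]. intros n.
    specialize (HP n u). rewrite (Hpow n u Hu) in HP.
    assert (HRn : 0 < R0 ^ n) by now apply pow_lt.
    replace (smul (RtoC (/ R0 ^ n)) (smul (RtoC (R0 ^ n)) u)) with u in HP.
    * rewrite normBC. lra.
    * transitivity (smul (RtoC (/ R0 ^ n * R0 ^ n)) u).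
      -- rewrite Rinv_l by lra. symmetry. exact (scal_one u).
      -- rewrite RtoC_mult. module_eq C_Ring E; cring.
  + intros [v ->]. apply LP.
Qed.

End Spectral.
End Operators.

Lemma bop_pow_scal {E : NormedModule C_AbsRing} (L : bounded_op E) (a : R) (n : nat) (u : E) :
  bop_pow E (bop_scal E (RtoC a) L) n u = scal (RtoC (a ^ n) : C_AbsRing) (bop_pow E L n u).
Proof.
induction n as [|n IH]; simpl.
- symmetry. exact (scal_one u).
- rewrite IH, bopZ, RtoC_mult. exact (scal_assoc (RtoC a : C_AbsRing) (RtoC (a ^ n)) _).
Qed.

Lemma spectral_decomposition {E : NormedModule C_AbsRing} (HE : fast_complete E)
  (L : bounded_op E) (R0 D rho : R) (h : E) : 0 < R0 -> 0 < rho < 1 -> 0 <= D ->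
  (forall n u, norm (minus (bop_pow E (bop_scal E (RtoC (/ R0)) L) (S n) u)
     (bop_pow E (bop_scal E (RtoC (/ R0)) L) n u)) <= D * rho ^ n * norm u) ->
  h <> zero -> L h = scal (RtoC R0 : C_AbsRing) h ->
  exists P c, 0 <= c /\ is_spectral_projection E L R0 P /\
    forall n u, norm (minus (scal (RtoC (/ R0 ^ n) : C_AbsRing) (bop_pow E L n u)) (P u)) <= c * rho ^ n * norm u.
Proof.
intros HR0 Hrho HD HT Hh Hev.
destruct (power_limit HE (bop_scal E (RtoC (/ R0)) L) D rho Hrho HD HT)
  as [P [c [Hc [HP [HTP [HPT [HPP _]]]]]]].
assert (HP' : forall n u, norm (minus (scal (RtoC (/ R0 ^ n) : C_AbsRing) (bop_pow E L n u)) (P u))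
   <= c * rho ^ n * norm u).
{ intros n u. specialize (HP n u). rewrite bop_pow_scal in HP.
  replace ((/ R0) ^ n) with (/ R0 ^ n) in HP by (symmetry; apply pow_inv). exact HP. }
assert (Hcancel : forall x : E, scal (RtoC R0 : C_AbsRing) (scal (RtoC (/ R0) : C_AbsRing) x) = x).
{ intros x. transitivity (scal (RtoC (R0 * / R0) : C_AbsRing) x).
  - rewrite RtoC_mult. exact (scal_assoc (RtoC R0 : C_AbsRing) (RtoC (/ R0)) x).
  - rewrite Rinv_r by lra. exact (scal_one x). }
exists P, c. split; [exact Hc|]. split; [|exact HP'].
apply (spectral_projection HE L P R0 c rho HR0 Hrho Hc HP') with (h := h); try assumption.
- intros u. rewrite <- (HTP u) at 2.
  change (L (P u) = scal (RtoC R0 : C_AbsRing) (scal (RtoC (/ R0) : C_AbsRing) (L (P u)))).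
  now rewrite Hcancel.
- intros u. rewrite <- (HPT u).
  change (P (L u) = scal (RtoC R0 : C_AbsRing) (P (scal (RtoC (/ R0) : C_AbsRing) (L u)))).
  now rewrite bopZ, Hcancel.
Qed.

Lemma filterlim_geom {V : NormedModule C_AbsRing} (x : nat -> V) (y : V) (c rho : R) :
  0 < rho < 1 -> 0 <= c -> (forall n, norm (minus (x n) y) <= c * rho ^ n) ->
  filterlim x eventually (locally y).
Proof.
intros Hr Hc H. apply filterlim_locally. intros [eps Heps].
destruct (geom_small c rho eps) as [N HN]; [lra|exact Heps|].
exists N. intros n Hn. apply norm_compat1. eapply Rle_lt_trans; [apply H|].
eapply Rle_lt_trans; [|exact HN]. apply Rmult_le_compat_l; [exact Hc|].
replace n with (N + (n - N))%nat by lia. rewrite pow_add.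
assert (0 < rho ^ N) by (apply pow_lt; lra).
assert (rho ^ (n - N) <= 1) by (rewrite <- (pow1 (n - N)); apply pow_incr; lra).
nra.
Qed.

Lemma geom_cauchy {E : NormedModule C_AbsRing} (u : nat -> E) (D rho : R) : 0 <= rho < 1 -> 0 <= D ->
  (forall n, norm (minus (u (S n)) (u n)) <= D * rho ^ n) ->
  forall n m, (n <= m)%nat -> norm (minus (u m) (u n)) <= D / (1 - rho) * rho ^ n.
Proof.
intros Hr HD H n m Hnm.
(* The factor [1 - rho ^ k] records the exact partial geometric sum, which closes the induction. *)
assert (H1 : forall k, norm (minus (u (k + n)%nat) (u n)) <= D / (1 - rho) * rho ^ n * (1 - rho ^ k)).
{ induction k as [|k IH].
  - simpl. replace (minus (u n) (u n)) with (zero : E) by (module_eq C_Ring E; cring).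
    rewrite norm_zero. lra.
  - eapply Rle_trans; [apply (norm_as_plus _ (minus (u (S k + n)%nat) (u (k + n)%nat)) (minus (u (k + n)%nat) (u n)));
      module_eq C_Ring E; cring|].
    specialize (H (k + n)%nat). change (S k + n)%nat with (S (k + n)).
    apply Rle_trans with (D * rho ^ (k + n) + D / (1 - rho) * rho ^ n * (1 - rho ^ k)); [lra|].
    right. rewrite pow_add. simpl. field. lra. }
specialize (H1 (m - n)%nat). replace (m - n + n)%nat with m in H1 by lia.
eapply Rle_trans; [exact H1|].
assert (0 <= D / (1 - rho) * rho ^ n).
{ apply Rmult_le_pos; [apply Rmult_le_pos; [lra|left; apply Rinv_0_lt_compat; lra]|apply pow_le; lra]. }
assert (0 <= rho ^ (m - n)) by (apply pow_le; lra). nra.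
Qed.

Lemma Rabs_Re_le (z : C) : Rabs (Re z) <= Cmod z.
Proof. eapply Rle_trans; [apply Rmax_l|apply Rmax_Cmod]. Qed.

Lemma Rabs_Im_le (z : C) : Rabs (Im z) <= Cmod z.
Proof. eapply Rle_trans; [apply Rmax_r|apply Rmax_Cmod]. Qed.

Lemma Cmod_le_Re_Im (z : C) : Cmod z <= Rabs (Re z) + Rabs (Im z).
Proof. apply Cmod_le_sum. Qed.

(** * Completeness of the Hoelder space *)

Section Holder.
Context (alpha : R) (Ha : 0 < alpha <= 1).

Lemma holder_continuous (M : R) (l : R -> C) :
  (forall s t, s <> t -> Cmod (l s - l t)%C <= M * Rpower (Rabs (s - t)) alpha) ->
  forall t, continuous l t.
Proof.
intros H t.
assert (HM : forall s t, Cmod (l s - l t)%C <= M * Rpower (Rabs (s - t)) alpha).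
{ intros s t'. destruct (Req_dec s t') as [->|E]; [|now apply H].
  replace (l t' - l t')%C with (RtoC 0) by ring. rewrite Cmod_0.
  assert (H01 : 0 <= M * Rpower (Rabs (1 - 0)) alpha).
  { eapply Rle_trans; [apply Cmod_ge_0|]. apply (H 1 0). lra. }
  pose proof (Rpower_pos (Rabs (1 - 0)) alpha). pose proof (Rpower_pos (Rabs (t' - t')) alpha).
  apply Rmult_le_pos; [nra|lra]. }
assert (H1 : continuous (fun s => Re (l s)) t).
{ apply continuity_pt_filterlim. apply (hol_continuous alpha M); [lra|].
  intros x y. eapply Rle_trans; [|apply HM]. exact (Rabs_Re_le (l x - l y)%C). }
assert (H2 : continuous (fun s => Im (l s)) t).
{ apply continuity_pt_filterlim. apply (hol_continuous alpha M); [lra|].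
  intros x y. eapply Rle_trans; [|apply HM]. exact (Rabs_Im_le (l x - l y)%C). }
apply continuous_ext with (fun s => (Re (l s), Im (l s))).
{ intros s. now destruct (l s). }
apply (continuous_comp_2 (fun s => Re (l s)) (fun s => Im (l s)) (fun x y => (x, y)) t H1 H2).
apply continuous_ext with (fun p => p); [now intros [x y]|apply continuous_id].
Qed.

Lemma holder_of_fun (l : R -> C) (M : R) : (forall t, l (t + 1) = l t) ->
  (forall s t, s <> t -> Cmod (l s - l t)%C <= M * Rpower (Rabs (s - t)) alpha) ->
  exists u : holder alpha, forall t, u t = l t.
Proof.
intros Hp HM.
exists (Build_holder alpha (Build_CT l Hp (holder_continuous M l HM)) (ex_intro _ M HM)).
reflexivity.
Qed.

Lemma holder_norm_eval (u : holder alpha) (s t x : R) : s <> t ->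
  Cmod (u s - u t)%C / Rpower (Rabs (s - t)) alpha + Cmod (u x) <= holder_norm alpha u.
Proof.
intros Hst. apply Rplus_le_compat; [|apply sup_norm_ub].
pose proof (Rpower_pos (Rabs (s - t)) alpha) as Hp.
apply Rmult_le_reg_r with (Rpower (Rabs (s - t)) alpha); [exact Hp|].
unfold Rdiv. rewrite Rmult_assoc, Rinv_l, Rmult_1_r by lra. now apply holder_seminorm_ub.
Qed.

(** A sum of two suprema is one supremum over triples. In this form the estimate passes to a
    pointwise limit with the exact constant required by [fast_complete]. *)
Lemma holder_norm_le_eval (u : holder alpha) (b : R) :
  (forall s t x, s <> t -> Cmod (u s - u t)%C / Rpower (Rabs (s - t)) alpha + Cmod (u x) <= b) ->
  holder_norm alpha u <= b.
Proof.
intros H. unfold holder_norm.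
assert (H1 : forall x, holder_seminorm alpha u <= b - Cmod (u x)).
{ intros x. apply holder_seminorm_le. intros s t Hst. specialize (H s t x Hst).
  pose proof (Rpower_pos (Rabs (s - t)) alpha) as Hp.
  apply Rmult_le_reg_r with (/ Rpower (Rabs (s - t)) alpha); [now apply Rinv_0_lt_compat|].
  rewrite (Rmult_assoc (b - Cmod (u x))), Rinv_r, Rmult_1_r by lra. unfold Rdiv in H. lra. }
assert (H2 : sup_norm u <= b - holder_seminorm alpha u).
{ apply sup_norm_le. intros t. specialize (H1 t). lra. }
lra.
Qed.

Lemma HolderSpace_minus (u v : HolderSpace alpha) (t : R) :
  (minus u v : holder alpha) t = ((u : holder alpha) t - (v : holder alpha) t)%C.
Proof.
change ((u : holder alpha) t + (- (1)) * (v : holder alpha) t = (u : holder alpha) t - (v : holder alpha) t)%C.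
ring.
Qed.

Lemma C_complete (a : nat -> C) (b : nat -> R) :
  (forall n m, (n <= m)%nat -> Cmod (a m - a n)%C <= b n) ->
  (forall eps, 0 < eps -> exists n, b n < eps) ->
  exists l, forall eps, 0 < eps -> exists N, forall n, (N <= n)%nat -> Cmod (a n - l)%C < eps.
Proof.
intros H Hb.
assert (Hc : forall (p : C -> R), (forall z w, p (z - w)%C = p z - p w) -> (forall z, Rabs (p z) <= Cmod z) ->
  exists l, Un_cv (fun n => p (a n)) l).
{ intros p Hp1 Hp2. destruct (Rcomplete.R_complete (fun n => p (a n))) as [l Hl]; [|now exists l].
  intros eps Heps. destruct (Hb (eps / 2)) as [N HN]; [lra|]. exists N. intros n m Hn Hm.
  unfold Rdist. pose proof (H N n Hn) as H1. pose proof (H N m Hm) as H2.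
  pose proof (Hp2 (a n - a N)%C) as H3. pose proof (Hp2 (a m - a N)%C) as H4. rewrite Hp1 in H3, H4.
  replace (p (a n) - p (a m)) with ((p (a n) - p (a N)) - (p (a m) - p (a N))) by ring.
  eapply Rle_lt_trans; [apply Rabs_triang|]. rewrite Rabs_Ropp. lra. }
destruct (Hc Re) as [x Hx]; [reflexivity|apply Rabs_Re_le|].
destruct (Hc Im) as [y Hy]; [reflexivity|apply Rabs_Im_le|].
exists (x, y). intros eps Heps.
destruct (Hx (eps / 2)) as [N1 H1]; [lra|]. destruct (Hy (eps / 2)) as [N2 H2]; [lra|].
exists (Nat.max N1 N2). intros n Hn.
specialize (H1 n ltac:(lia)). specialize (H2 n ltac:(lia)). unfold Rdist in *.
eapply Rle_lt_trans; [apply Cmod_le_sum|].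
change (Rabs (Re (a n) - x) + Rabs (Im (a n) - y) < eps). lra.
Qed.

Lemma HolderSpace_complete : fast_complete (HolderSpace alpha).
Proof.
intros u D rho Hr HD H.
set (b := fun n => D / (1 - rho) * rho ^ n).
assert (Hb : forall eps, 0 < eps -> exists n, b n < eps) by (intros; now apply geom_small).
assert (Hnm : forall n m, (n <= m)%nat -> forall s t x, s <> t ->
  Cmod ((u m : holder alpha) s - (u n : holder alpha) s - ((u m : holder alpha) t - (u n : holder alpha) t))%C
    / Rpower (Rabs (s - t)) alpha + Cmod ((u m : holder alpha) x - (u n : holder alpha) x)%C <= b n).
{ intros n m Hnm s t x Hst. rewrite <- !HolderSpace_minus.
  eapply Rle_trans; [now apply holder_norm_eval|]. exact (geom_cauchy u D rho Hr HD H n m Hnm). }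
assert (Hlim : forall t, exists l, forall eps, 0 < eps -> exists N, forall n, (N <= n)%nat ->
  Cmod ((u n : holder alpha) t - l)%C < eps).
{ intros t. apply (C_complete (fun n => (u n : holder alpha) t) b); [|exact Hb].
  intros n m Hle. specialize (Hnm n m Hle 1 0 t ltac:(lra)).
  eapply Rle_trans; [|exact Hnm].
  match goal with |- ?x <= ?y + ?x => assert (0 <= y); [|lra] end.
  apply Rmult_le_pos; [apply Cmod_ge_0|left; apply Rinv_0_lt_compat, Rpower_pos]. }
set (l := fun t => proj1_sig (constructive_indefinite_description _ (Hlim t))).
assert (Hl : forall t eps, 0 < eps -> exists N, forall n, (N <= n)%nat ->
  Cmod ((u n : holder alpha) t - l t)%C < eps)
  by (intros t; exact (proj2_sig (constructive_indefinite_description _ (Hlim t)))).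
assert (Hest : forall n s t x, s <> t ->
  Cmod ((u n : holder alpha) s - l s - ((u n : holder alpha) t - l t))%C / Rpower (Rabs (s - t)) alpha
  + Cmod ((u n : holder alpha) x - l x)%C <= b n).
{ intros n s t x Hst. apply Rnot_lt_le. intros Hlt.
  set (om := Rpower (Rabs (s - t)) alpha) in *. assert (Hom : 0 < om) by apply Rpower_pos.
  assert (Hio : 0 < / om) by now apply Rinv_0_lt_compat.
  set (X := Cmod ((u n : holder alpha) s - l s - ((u n : holder alpha) t - l t))%C / om
    + Cmod ((u n : holder alpha) x - l x)%C) in *.
  (* Replacing the limit by a late term costs [eps] at [s] and at [t], each divided by [om], and
     once at [x]. *)
  set (eps := (X - b n) / (2 * / om + 1)).
  assert (He : 0 < eps) by (apply Rdiv_lt_0_compat; lra).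
  destruct (Hl s eps He) as [N1 H1]. destruct (Hl t eps He) as [N2 H2]. destruct (Hl x eps He) as [N3 H3].
  set (m := Nat.max n (Nat.max N1 (Nat.max N2 N3))).
  specialize (H1 m ltac:(lia)). specialize (H2 m ltac:(lia)). specialize (H3 m ltac:(lia)).
  specialize (Hnm n m ltac:(lia) s t x Hst). fold om in Hnm.
  set (us := (u n : holder alpha) s) in *. set (ut := (u n : holder alpha) t) in *. set (ux := (u n : holder alpha) x) in *.
  set (vs := (u m : holder alpha) s) in *. set (vt := (u m : holder alpha) t) in *. set (vx := (u m : holder alpha) x) in *.
  assert (H4 : Cmod (us - l s - (ut - l t))%C <= Cmod (vs - us - (vt - ut))%C + (Cmod (vs - l s)%C + Cmod (vt - l t)%C)).
  { replace (us - l s - (ut - l t))%C with (- (vs - us - (vt - ut)) + ((vs - l s) + - (vt - l t)))%C by ring.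
    eapply Rle_trans; [apply Cmod_triangle|]. rewrite Cmod_opp. apply Rplus_le_compat_l.
    eapply Rle_trans; [apply Cmod_triangle|]. rewrite Cmod_opp. lra. }
  assert (H5 : Cmod (ux - l x)%C <= Cmod (vx - ux)%C + Cmod (vx - l x)%C).
  { replace (ux - l x)%C with (- (vx - ux) + (vx - l x))%C by ring.
    eapply Rle_trans; [apply Cmod_triangle|]. rewrite Cmod_opp. lra. }
  assert (H6 : Cmod (us - l s - (ut - l t))%C / om <=
    (Cmod (vs - us - (vt - ut))%C + 2 * eps) / om).
  { apply Rmult_le_compat_r; lra. }
  assert (H7 : eps * (2 * / om + 1) = X - b n) by (unfold eps; field; lra).
  unfold X, Rdiv in *. lra. }
assert (Hlper : forall t, l (t + 1) = l t).
{ intros t. assert (H0 : (l (t + 1)%R - l t)%C = 0).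
  { apply Cmod_eq_0. apply Rle_antisym; [|apply Cmod_ge_0]. apply Rnot_lt_le. intros Hlt.
    destruct (Hl t (Cmod (l (t + 1)%R - l t)%C / 2)) as [N1 H1]; [lra|].
    destruct (Hl (t + 1) (Cmod (l (t + 1)%R - l t)%C / 2)) as [N2 H2]; [lra|].
    specialize (H1 (Nat.max N1 N2) ltac:(lia)). specialize (H2 (Nat.max N1 N2) ltac:(lia)).
    rewrite ct_periodic in H2. set (v := (u (Nat.max N1 N2) : holder alpha) t) in *.
    assert (H3 : Cmod (l (t + 1)%R - l t)%C <= Cmod (v - l (t + 1)%R)%C + Cmod (v - l t)%C).
    { replace (l (t + 1)%R - l t)%C with (- (v - l (t + 1)%R) + (v - l t))%C by ring.
      eapply Rle_trans; [apply Cmod_triangle|]. rewrite Cmod_opp. lra. }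
    lra. }
  replace (l (t + 1)%R) with (l t + (l (t + 1)%R - l t))%C by ring. rewrite H0. ring. }
destruct (holder_of_fun l (holder_seminorm alpha (u 0%nat) + b 0%nat) Hlper) as [w Hw].
{ intros s t Hst. specialize (Hest 0%nat s t 0 Hst).
  pose proof (holder_seminorm_ub alpha (u 0%nat) s t Hst) as H1.
  set (om := Rpower (Rabs (s - t)) alpha) in *. assert (Hom : 0 < om) by apply Rpower_pos.
  set (us := (u 0%nat : holder alpha) s) in *. set (ut := (u 0%nat : holder alpha) t) in *.
  replace (l s - l t)%C with ((us - ut) + - (us - l s - (ut - l t)))%C by ring.
  eapply Rle_trans; [apply Cmod_triangle|]. rewrite Cmod_opp, Rmult_plus_distr_r.
  apply Rplus_le_compat; [exact H1|].
  assert (H2 : Cmod (us - l s - (ut - l t))%C / om <= b 0%nat).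
  { pose proof (Cmod_ge_0 ((u 0%nat : holder alpha) 0 - l 0)%C). lra. }
  replace (Cmod (us - l s - (ut - l t))%C) with (Cmod (us - l s - (ut - l t))%C / om * om) by (field; lra).
  apply Rmult_le_compat_r; lra. }
exists w. intros n. change (holder_norm alpha (minus (u n : HolderSpace alpha) (w : HolderSpace alpha)) <= b n).
apply holder_norm_le_eval. intros s t x Hst. rewrite !HolderSpace_minus, !Hw. now apply Hest.
Qed.

End Holder.

(** * The growth rate as a limit of roots *)

Lemma Re_sum_n (a : nat -> C) (n : nat) : Re (sum_n a n) = sum_n (fun i => Re (a i)) n.
Proof.
induction n as [|n IH]; [now rewrite !sum_O|]. rewrite !sum_Sn, <- IH. reflexivity.
Qed.

Lemma Im_sum_n (a : nat -> C) (n : nat) : Im (sum_n a n) = sum_n (fun i => Im (a i)) n.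
Proof.
induction n as [|n IH]; [now rewrite !sum_O|]. rewrite !sum_Sn, <- IH. reflexivity.
Qed.

Lemma is_lim_seq_root (c R0 : R) : 0 < c -> 0 < R0 ->
  is_lim_seq (fun n => Rpower (c * R0 ^ n) (/ INR n)) R0.
Proof.
intros Hc HR.
apply (is_lim_seq_ext_loc (fun n => exp (ln c * / INR n) * R0)).
- exists 1%nat. intros n Hn. assert (Hn0 : 0 < INR n) by (apply lt_0_INR; lia).
  unfold Rpower. rewrite ln_mult by (try apply pow_lt; lra).
  rewrite <- Rpower_pow by exact HR. unfold Rpower at 1. rewrite ln_exp.
  replace (/ INR n * (ln c + INR n * ln R0)) with (ln c * / INR n + ln R0) by (field; lra).
  now rewrite exp_plus, exp_ln.
- replace (Finite R0) with (Rbar_mult (Finite (exp (ln c * 0))) (Finite R0)).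
  2:{ simpl. f_equal. rewrite Rmult_0_r, exp_0. ring. }
  apply (is_lim_seq_scal_r _ R0 (Finite (exp (ln c * 0)))).
  apply (is_lim_seq_continuous (fun x => exp (ln c * x)) (fun n => / INR n) 0).
  + apply derivable_continuous_pt. reg.
  + apply (is_lim_seq_inv INR p_infty); [apply is_lim_seq_INR|discriminate].
Qed.

(** Existence of the limit comes from squeezing between two root sequences rather than from
    submultiplicativity. *)
Lemma growth_rate_eq (T : CT -> CT) (c1 c2 R0 : R) : 0 < c1 -> 0 < R0 ->
  (forall n t, c1 * R0 ^ n <= Re (Nat.iter n T (CT_const 1) t) <= c2 * R0 ^ n) ->
  growth_rate T = R0.
Proof.
intros Hc HR H.
assert (Hc2 : 0 < c2) by (specialize (H 0%nat 0); simpl in H; lra).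
unfold growth_rate.
replace R0 with (real (Finite R0)) by reflexivity. f_equal. apply is_lim_seq_unique.
apply (is_lim_seq_le_le_loc (fun n => Rpower (c1 * R0 ^ n) (/ INR n)) _ (fun n => Rpower (c2 * R0 ^ n) (/ INR n))).
- exists 1%nat. intros n Hn. assert (Hn0 : 0 < INR n) by (apply lt_0_INR; lia).
  assert (HRn : 0 < R0 ^ n) by now apply pow_lt.
  assert (H1 : c1 * R0 ^ n <= max_CT (Nat.iter n T (CT_const 1)) <= c2 * R0 ^ n).
  { split.
    - eapply Rle_trans; [apply (H n 0)|]. apply (supR_ub _ (c2 * R0 ^ n)); [|now exists 0].
      intros y [t ->]. apply H.
    - apply supR_le; [now exists (Re (Nat.iter n T (CT_const 1) 0)), 0|]. intros y [t ->]. apply H. }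
  set (x := max_CT _) in *.
  assert (0 < c1 * R0 ^ n) by now apply Rmult_lt_0_compat.
  unfold nth_root. destruct (Rle_dec x 0) as [Hx|Hx]; [lra|].
  assert (Hin : 0 <= / INR n) by (left; now apply Rinv_0_lt_compat).
  split; apply Rle_Rpower_l; lra.
- now apply is_lim_seq_root.
- now apply is_lim_seq_root.
Qed.

(** * The transfer operator on complex functions *)

Section TransferOperator.
Context (d : nat) (alpha : R) (f : holder alpha).
Context (Hd : (2 <= d)%nat) (Ha : 0 < alpha <= 1).
Context (Hf : forall t : R, Cnonneg (f t)) (Hkr : krein (transfer d f)).

Notation F := (fun t => Re (f t)).
Notation L := (transfer_holder alpha d f).

Lemma weight_real (t : R) : f t = RtoC (F t).
Proof. destruct (Hf t) as [_ H]. destruct (f t) as [a b]. simpl in *. now subst b. Qed.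

Lemma Re_per (u : CT) : per (fun t => Re (u t)).
Proof. intros t. now rewrite ct_periodic. Qed.

Lemma Im_per (u : CT) : per (fun t => Im (u t)).
Proof. intros t. now rewrite ct_periodic. Qed.

Lemma holder_seminorm_ub_all (u : holder alpha) (s t : R) :
  Cmod (u s - u t)%C <= holder_seminorm alpha u * Rpower (Rabs (s - t)) alpha.
Proof.
destruct (Req_dec s t) as [->|E]; [|now apply holder_seminorm_ub].
replace (u t - u t)%C with (RtoC 0) by ring. rewrite Cmod_0.
apply Rmult_le_pos; [apply holder_seminorm_ge0|left; apply Rpower_pos].
Qed.

Lemma Re_hol (u : holder alpha) : hol alpha (holder_seminorm alpha u) (fun t => Re (u t)).
Proof.
intros s t. eapply Rle_trans; [|apply holder_seminorm_ub_all]. exact (Rabs_Re_le (u s - u t)%C).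
Qed.

Lemma Im_hol (u : holder alpha) : hol alpha (holder_seminorm alpha u) (fun t => Im (u t)).
Proof.
intros s t. eapply Rle_trans; [|apply holder_seminorm_ub_all]. exact (Rabs_Im_le (u s - u t)%C).
Qed.

Lemma Re_bounded (u : CT) (t : R) : Rabs (Re (u t)) <= sup_norm u.
Proof. eapply Rle_trans; [apply Rabs_Re_le|apply sup_norm_ub]. Qed.

Lemma Im_bounded (u : CT) (t : R) : Rabs (Im (u t)) <= sup_norm u.
Proof. eapply Rle_trans; [apply Rabs_Im_le|apply sup_norm_ub]. Qed.

(** A real weight lets the operator act separately on real and imaginary parts, which carries the
    real theory over to complex functions. *)
Lemma Re_transfer (u : CT) (t : R) : Re (transfer d f u t) = rop d F (fun t => Re (u t)) t.
Proof.
cbn [ct_fun transfer]. unfold transfer_fun, rop, branch.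
rewrite re_scal_l, Re_sum_n. f_equal. apply sum_n_ext. intros i.
rewrite weight_real. apply re_scal_l.
Qed.

Lemma Im_transfer (u : CT) (t : R) : Im (transfer d f u t) = rop d F (fun t => Im (u t)) t.
Proof.
cbn [ct_fun transfer]. unfold transfer_fun, rop, branch.
rewrite im_scal_l, Im_sum_n. f_equal. apply sum_n_ext. intros i.
rewrite weight_real. apply im_scal_l.
Qed.

Lemma Re_iter_transfer (n : nat) (u : CT) (t : R) :
  Re (Nat.iter n (transfer d f) u t) = Nat.iter n (rop d F) (fun t => Re (u t)) t.
Proof.
revert t. induction n as [|n IH]; intros t; [reflexivity|].
cbn [Nat.iter nat_rect]. rewrite Re_transfer. f_equal.
apply functional_extensionality. exact IH.
Qed.

Lemma weight_ge0 (t : R) : 0 <= F t.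
Proof. apply Hf. Qed.

Lemma weight_le (t : R) : F t <= sup_norm f.
Proof. eapply Rle_trans; [apply Rle_abs|apply Re_bounded]. Qed.

Lemma krein_real (u : R -> R) (A : R) : per u -> hol alpha A u ->
  (forall t, 0 <= u t) -> (exists t, 0 < u t) ->
  exists n, forall t, 0 < Nat.iter n (rop d F) u t.
Proof.
intros Hp Hh H0 [t0 Ht0].
destruct (holder_of_fun alpha Ha (fun t => RtoC (u t)) A) as [w Hw].
{ intros t. now rewrite Hp. }
{ intros s t _. rewrite <- RtoC_minus, Cmod_R. apply Hh. }
destruct (Hkr w) as [n Hn].
- intros t. rewrite Hw. split; [apply H0|reflexivity].
- exists t0. rewrite Hw. split; [exact Ht0|reflexivity].
- exists n. intros t. destruct (Hn t) as [H _]. rewrite Re_iter_transfer in H.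
  replace (fun t => Re (w t)) with u in H; [exact H|].
  apply functional_extensionality. intros s. now rewrite Hw.
Qed.

Lemma rop_normalized (a : R) (u : R -> R) :
  rop d (fun t => a * F t) u = fun t => a * rop d F u t.
Proof.
apply functional_extensionality. intros t. unfold rop.
transitivity (/ INR d * (a * sum_n (fun i => F (branch d i t) * u (branch d i t)) (d - 1)
  + 0 * sum_n (fun i => F (branch d i t) * u (branch d i t)) (d - 1))); [|ring].
rewrite <- sum_n_lin. f_equal. apply sum_n_ext. intros i. rring.
Qed.

Lemma iter_normalized (a : R) (n : nat) (u : R -> R) (t : R) :
  Nat.iter n (rop d (fun t => a * F t)) u t = a ^ n * Nat.iter n (rop d F) u t.
Proof.
revert t. induction n as [|n IH]; intros t; [simpl; ring|].
change (rop d (fun t => a * F t) (Nat.iter n (rop d (fun t => a * F t)) u) t =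
  a * a ^ n * rop d F (Nat.iter n (rop d F) u) t).
rewrite rop_normalized, (functional_extensionality _ _ IH), rop_scal. ring.
Qed.

Lemma Re_bop_pow (a : R) (n : nat) (u : HolderSpace alpha) (t : R) :
  Re ((bop_pow (HolderSpace alpha) (bop_scal (HolderSpace alpha) (RtoC a) L) n u : holder alpha) t) =
  Nat.iter n (rop d (fun t => a * F t)) (fun t => Re ((u : holder alpha) t)) t.
Proof.
revert t. induction n as [|n IH]; intros t; [reflexivity|].
set (T := bop_scal (HolderSpace alpha) (RtoC a) L) in *.
change (Re (RtoC a * transfer d f (bop_pow (HolderSpace alpha) T n u : holder alpha) t)%C =
  rop d (fun t => a * F t) (Nat.iter n (rop d (fun t => a * F t)) (fun t => Re ((u : holder alpha) t))) t).
rewrite rop_normalized, re_scal_l, Re_transfer. f_equal. f_equal. apply functional_extensionality. exact IH.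
Qed.

Lemma Im_bop_pow (a : R) (n : nat) (u : HolderSpace alpha) (t : R) :
  Im ((bop_pow (HolderSpace alpha) (bop_scal (HolderSpace alpha) (RtoC a) L) n u : holder alpha) t) =
  Nat.iter n (rop d (fun t => a * F t)) (fun t => Im ((u : holder alpha) t)) t.
Proof.
revert t. induction n as [|n IH]; intros t; [reflexivity|].
set (T := bop_scal (HolderSpace alpha) (RtoC a) L) in *.
change (Im (RtoC a * transfer d f (bop_pow (HolderSpace alpha) T n u : holder alpha) t)%C =
  rop d (fun t => a * F t) (Nat.iter n (rop d (fun t => a * F t)) (fun t => Im ((u : holder alpha) t))) t).
rewrite rop_normalized, im_scal_l, Im_transfer. f_equal. f_equal. apply functional_extensionality. exact IH.
Qed.

Lemma transfer_increments (R0 Ah m M : R) (h : R -> R) : 0 < R0 -> per h -> hol alpha Ah h ->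
  0 < m -> (forall t, m <= h t <= M) -> (forall t, rop d F h t = R0 * h t) ->
  exists rho D, 0 < rho < 1 /\ 0 <= D /\ forall n (u : HolderSpace alpha),
    let T := bop_scal (HolderSpace alpha) (RtoC (/ R0)) L in
    norm (minus (bop_pow _ T (S n) u) (bop_pow _ T n u)) <= D * rho ^ n * norm u.
Proof.
intros HR0 Hp Hh Hm Hle Heig.
assert (Hi : 0 < / R0) by now apply Rinv_0_lt_compat.
destruct (increments_decay d alpha (Rabs (/ R0) * holder_seminorm alpha f) (/ R0 * sup_norm f) (fun t => / R0 * F t))
  with (h := h) (Ah := Ah) (m := m) (M := M) as [rho [D [Hrho [HD H]]]]; try assumption.
- intros t. apply Rmult_le_pos; [lra|apply weight_ge0].
- intros t. apply Rmult_le_compat_l; [lra|apply weight_le].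
- intros t. f_equal. apply (Re_per f).
- apply (hol_scal alpha _ _ (fun t => Re (f t))), Re_hol.
- intros u A Hup Huh Hu0 Hut. destruct (krein_real u A Hup Huh Hu0 Hut) as [n Hn].
  exists n. intros t. rewrite iter_normalized. apply Rmult_lt_0_compat; [now apply pow_lt|apply Hn].
- rewrite rop_normalized. apply functional_extensionality. intros t. rewrite Heig. field. lra.
(* The real and the imaginary part each contribute to the seminorm and to the sup norm. *)
- exists rho, (4 * D). split; [exact Hrho|]. split; [lra|]. intros n u T.
  set (w := minus (bop_pow _ T (S n) u) (bop_pow _ T n u)).
  change (holder_norm alpha (w : holder alpha) <= 4 * D * rho ^ n * holder_norm alpha u).
  assert (HwR : forall t, Re ((w : holder alpha) t) =
    Nat.iter (S n) (rop d (fun t => / R0 * F t)) (fun t => Re ((u : holder alpha) t)) t -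
    Nat.iter n (rop d (fun t => / R0 * F t)) (fun t => Re ((u : holder alpha) t)) t).
  { intros t. unfold w. rewrite HolderSpace_minus, <- !Re_bop_pow. reflexivity. }
  assert (HwI : forall t, Im ((w : holder alpha) t) =
    Nat.iter (S n) (rop d (fun t => / R0 * F t)) (fun t => Im ((u : holder alpha) t)) t -
    Nat.iter n (rop d (fun t => / R0 * F t)) (fun t => Im ((u : holder alpha) t)) t).
  { intros t. unfold w. rewrite HolderSpace_minus, <- !Im_bop_pow. reflexivity. }
  destruct (H _ _ _ n (Re_per (u : holder alpha)) (Re_hol u) (Re_bounded (u : holder alpha))) as [H1 H2].
  destruct (H _ _ _ n (Im_per (u : holder alpha)) (Im_hol u) (Im_bounded (u : holder alpha))) as [H3 H4].
  change (holder_seminorm alpha u + sup_norm (u : holder alpha)) with (holder_norm alpha u) in *.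
  set (e := D * rho ^ n * holder_norm alpha u) in *.
  replace (4 * D * rho ^ n * holder_norm alpha u) with (2 * e + 2 * e) by (unfold e; ring).
  apply holder_norm_le.
  + intros s t _. eapply Rle_trans; [apply Cmod_le_Re_Im|].
    change (Re ((w : holder alpha) s - (w : holder alpha) t)%C) with (Re ((w : holder alpha) s) - Re ((w : holder alpha) t)).
    change (Im ((w : holder alpha) s - (w : holder alpha) t)%C) with (Im ((w : holder alpha) s) - Im ((w : holder alpha) t)).
    rewrite !HwR, !HwI. specialize (H1 s t). specialize (H3 s t). cbv beta in H1, H3. lra.
  + intros t. eapply Rle_trans; [apply Cmod_le_Re_Im|]. rewrite HwR, HwI.
    specialize (H2 t). specialize (H4 t). lra.
Qed.

Lemma transfer_eigenfunction : exists R0 h Ah m M, 0 < R0 /\ per h /\ hol alpha Ah h /\ 0 < m /\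
  (forall t, m <= h t <= M) /\ (forall t, rop d F h t = R0 * h t).
Proof.
destruct (growth_exists d alpha (holder_seminorm alpha f) (sup_norm f) F Hd Ha weight_ge0 weight_le
  (Re_per f) (Re_hol f) krein_real) as [R0 [HR0 [Hup Hlo]]].
destruct (eigenfunction_exists d alpha (holder_seminorm alpha f) (sup_norm f) F Hd Ha weight_ge0 weight_le
  (Re_per f) (Re_hol f) krein_real R0 HR0 Hup Hlo) as [Ah [h [Hp [Hh [Hpos Heig]]]]].
destruct (per_hol_min alpha Ah h) as [a Hmin]; [lra|exact Hp|exact Hh|].
destruct (per_hol_max alpha Ah h) as [b [_ Hmax]]; [lra|exact Hp|exact Hh|].
exists R0, h, Ah, (h a), (h b). repeat split; auto.
Qed.

(** [h / M <= 1 <= h / m], and the outer functions iterate exactly. *)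
Lemma iter_1_bounds (R0 m M : R) (h : R -> R) (n : nat) (t : R) : 0 < R0 -> 0 < m ->
  (forall t, m <= h t <= M) -> (forall t, rop d F h t = R0 * h t) ->
  m / M * R0 ^ n <= Nat.iter n (rop d F) (fun _ => 1) t <= M / m * R0 ^ n.
Proof.
intros HR0 Hm Hle Heig.
assert (HM : 0 < M) by (specialize (Hle 0); lra).
assert (Him : 0 < / m) by now apply Rinv_0_lt_compat.
assert (HiM : 0 < / M) by now apply Rinv_0_lt_compat.
assert (HRn : 0 < R0 ^ n) by now apply pow_lt.
assert (H1 := iter_le d F Hd weight_ge0 n (fun t => / M * h t) (fun _ => 1)).
assert (H2 := iter_le d F Hd weight_ge0 n (fun _ => 1) (fun t => / m * h t)).
rewrite iter_scal in H1, H2. pose proof (iter_eigen d F R0 h n Heig t) as H3.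
specialize (H1 ltac:(intros s; specialize (Hle s); apply Rmult_le_reg_l with M; [lra|];
  rewrite <- Rmult_assoc, Rinv_r; lra) t).
specialize (H2 ltac:(intros s; specialize (Hle s); apply Rmult_le_reg_l with m; [lra|];
  rewrite <- Rmult_assoc, Rinv_r; lra) t).
cbv beta in H1, H2. rewrite H3 in H1, H2. specialize (Hle t).
split.
- eapply Rle_trans; [|exact H1]. unfold Rdiv.
  replace (m * / M * R0 ^ n) with (/ M * R0 ^ n * m) by ring.
  rewrite <- Rmult_assoc. apply Rmult_le_compat_l; [apply Rmult_le_pos; lra|lra].
- eapply Rle_trans; [exact H2|]. unfold Rdiv.
  replace (M * / m * R0 ^ n) with (/ m * R0 ^ n * M) by ring.
  rewrite <- Rmult_assoc. apply Rmult_le_compat_l; [apply Rmult_le_pos; lra|lra].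
Qed.

End TransferOperator.

Theorem theorem2p6 (d : nat) (alpha : R) (f : holder alpha) :
  (2 <= d)%nat ->
  0 < alpha <= 1 ->
  (forall t : R, Cnonneg (f t)) ->
  krein (transfer d f) ->
  let R0 : R := growth_rate (transfer d f) in
  let L_alpha : bounded_op (HolderSpace alpha) := transfer_holder alpha d f in
  (exists P : bounded_op (HolderSpace alpha),
     is_spectral_projection (HolderSpace alpha) L_alpha R0 P /\
     filterlim
       (fun n : nat =>
          scal (RtoC (/ R0 ^ n) : C_AbsRing)
               (bop_pow (HolderSpace alpha) L_alpha n : BL (HolderSpace alpha)))
       eventually (locally (P : BL (HolderSpace alpha)))) /\
  (exists g : HolderSpace alpha,
     eigenvector (HolderSpace alpha) L_alpha R0 g /\
     filterlim
       (fun n : nat =>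
          scal (RtoC (/ R0 ^ n) : C_AbsRing)
               (bop_pow (HolderSpace alpha) L_alpha n (holder_const alpha 1)))
       eventually (locally g)).
Proof.
intros Hd Ha Hf Hkr R0 L.
destruct (transfer_eigenfunction d alpha f Hd Ha Hf Hkr)
  as [r [h [Ah [m [M [Hr [Hp [Hh [Hm [Hle Heig]]]]]]]]]].
pose proof (fun n t => iter_1_bounds d alpha f Hd Hf r m M h n t Hr Hm Hle Heig) as Hbd.
assert (HM : 0 < M) by (specialize (Hle 0); lra).
assert (HmM : 0 < m / M) by now apply Rdiv_lt_0_compat.
assert (ER : R0 = r).
{ apply (growth_rate_eq _ (m / M) (M / m)); [exact HmM|exact Hr|]. intros n t.
  rewrite (Re_iter_transfer d alpha f Hf). apply (Hbd n t). }
clearbody R0. subst r.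
destruct (transfer_increments d alpha f Hd Ha Hf Hkr R0 Ah m M h Hr Hp Hh Hm Hle Heig)
  as [rho [D [Hrho [HD HT]]]].
destruct (holder_of_fun alpha Ha (fun t => RtoC (h t)) Ah) as [w Hw].
{ intros t. now rewrite Hp. }
{ intros s t _. rewrite <- RtoC_minus, Cmod_R. apply Hh. }
assert (Hw0 : (w : HolderSpace alpha) <> zero).
{ intros H. assert (H0 : w 0 = RtoC 0) by (rewrite H; reflexivity).
  rewrite Hw in H0. apply RtoC_inj in H0. specialize (Hle 0). lra. }
assert (Hweig : L (w : HolderSpace alpha) = scal (RtoC R0 : C_AbsRing) (w : HolderSpace alpha)).
{ apply holder_ext. intros t. change (transfer d f w t = (RtoC R0 * w t)%C).
  rewrite Hw, <- RtoC_mult, <- Heig. apply injective_projections.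
  - change (Re (transfer d f w t) = rop d (fun t => Re (f t)) h t).
    rewrite (Re_transfer d alpha f Hf). f_equal. apply functional_extensionality. intros s. now rewrite Hw.
  - change (Im (transfer d f w t) = 0).
    rewrite (Im_transfer d alpha f Hf).
    replace (fun t => Im (w t)) with (fun t : R => 0 * 1).
    + rewrite rop_scal. ring.
    + apply functional_extensionality. intros s. rewrite Hw. simpl. ring. }
destruct (spectral_decomposition (HolderSpace_complete alpha Ha) L R0 D rho w Hr Hrho HD HT Hw0 Hweig)
  as [P [c [Hc [HP Hconv]]]].
split.
- exists P. split; [exact HP|].
  apply (filterlim_geom (V := BL (HolderSpace alpha)) _ _ c rho Hrho Hc). intros n.
  apply opnorm_le. intros u Hu.
  eapply Rle_trans; [exact (Hconv n u)|].
  assert (0 <= c * rho ^ n) by (apply Rmult_le_pos; [exact Hc|apply pow_le; lra]). nra.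
- set (one := holder_const alpha 1 : HolderSpace alpha).
  exists (P one). split; [split|].
  (* If [P 1] were zero, [R0^-n L^n 1] would tend to 0 in norm, yet its values stay above
     [m / M]. *)
  + intros HP0.
    destruct (geom_small (c * norm one) rho (m / M)) as [n Hn]; [lra|exact HmM|].
    specialize (Hconv n one). rewrite HP0 in Hconv.
    set (x := scal (RtoC (/ R0 ^ n) : C_AbsRing) (bop_pow (HolderSpace alpha) L n one)) in *.
    assert (Hx : norm (minus x zero) = holder_norm alpha x).
    { apply (f_equal (holder_norm alpha)). apply holder_ext. intros t. rewrite HolderSpace_minus.
      change ((x : holder alpha) t - RtoC 0 = (x : holder alpha) t)%C. ring. }
    pose proof (Rle_trans _ _ _ (Req_le _ _ (eq_sym Hx)) Hconv) as Hle1.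
    assert (Hlow : m / M <= holder_norm alpha x).
    { apply Rle_trans with (sup_norm (x : holder alpha)).
      - apply Rle_trans with (Re ((x : holder alpha) 0)).
        + unfold x.
          rewrite <- pow_inv, <- (bop_pow_scal L (/ R0) n one).
          rewrite (Re_bop_pow d alpha f Hf), iter_normalized, pow_inv.
          assert (HRn : 0 < R0 ^ n) by now apply pow_lt.
          destruct (Hbd n 0) as [H1 _].
          change (fun t => Re ((one : holder alpha) t)) with (fun _ : R => 1).
          apply Rmult_le_reg_l with (R0 ^ n); [exact HRn|].
          rewrite <- Rmult_assoc, Rinv_r, Rmult_1_l by lra. lra.
        + eapply Rle_trans; [apply Rle_abs|]. apply Re_bounded.
      - pose proof (holder_seminorm_ge0 alpha x). unfold holder_norm. lra. }
    assert (c * rho ^ n * norm one = c * norm one * rho ^ n) by ring. lra.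
  + destruct HP as [_ [_ HPe]]. apply HPe. now exists one.
  + apply (filterlim_geom (V := HolderSpace alpha) _ _ (c * norm one) rho Hrho).
    * apply Rmult_le_pos; [exact Hc|apply norm_ge_0].
    * intros n. specialize (Hconv n one).
      replace (c * norm one * rho ^ n) with (c * rho ^ n * norm one) by ring. exact Hconv.
Qed.
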